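(* Let $n\ge 2$ be an integer and $k$ a field whose characteristic is zero or greater than $(n+1)/2$. Let $$B=k[p_1,\dots,p_n,q_1,\dots,q_n]/\bigl(\{p_iq_j,\ p_iq_i-p_jq_j \mid 1\le i,j\le n,\ i\neq j\}\bigr).$$ Then $t^B_i(k)=i$ for $0\le i\le n$ and $t^B_{n+1}(k)=n+2$. In particular, the $k$-algebra $B$ is not Koszul.
   Context: $B$ is standard graded with all $p_i,q_i$ of (total) degree one. For a standard graded $k$-algebra $R$ and $i\ge 0$, $t^R_i(k)=\sup\{j\in\mathbb{N}\mid \operatorname{Tor}^R_i(k,k)_j\ne 0\}$, where $j$ denotes the (total) internal degree and $k$ is $R$ modulo its homogeneous maximal ideal. $R$ is Koszul if $\operatorname{Tor}^R_i(k,k)_j=0$ for all $i\geq 0$ and $j\ne i$. *)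

(* Defs.v *)
From HB Require Import structures.
From mathcomp Require Import all_boot all_order all_algebra.
From mathcomp Require Import boolp classical_sets constructive_ereal.
From mathcomp Require Import -(notations) mpoly.

Set Implicit Arguments.
Unset Strict Implicit.
Unset Printing Implicit Defensive.

Import Order.TTheory GRing.Theory Num.Theory.
Local Open Scope classical_set_scope.
Local Open Scope ring_scope.
Local Open Scope quotient_scope.

(* The notations of mpoly cannot be imported together with classical_sets. *)
Local Notation "{ 'mpoly' R [ n ] }" := (mpoly n R)
  (at level 0, R at level 2, format "{ 'mpoly'  R [ n ] }") : type_scope.
Local Notation "''X_' i" := (@mpolyX _ _ (mnm1 i))
  (at level 8, i at level 2, format "''X_' i") : ring_scope.

(* V is the internal direct sum of the subgroups P d, d : nat. *)
Record graded_by (V : zmodType) (P : nat -> set V) : Prop := GradedBy {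
  graded0 : forall d, P d 0;
  gradedB : forall d x y, P d x -> P d y -> P d (x - y);
  graded_span : forall x, exists (N : nat) (f : nat -> V),
    (forall d, P d (f d)) /\ x = \sum_(d < N) f d;
  graded_indep : forall (N : nat) (f : nat -> V), (forall d, P d (f d)) ->
    \sum_(d < N) f d = 0 -> forall d, (d < N)%N -> f d = 0 }.

Record stdGradedAlg (k : fieldType) := StdGradedAlg {
  sga_ring :> comNzRingType;
  sga_const : {rmorphism k -> sga_ring};
  sga_piece : nat -> set sga_ring;
  sga_graded : graded_by sga_piece;
  sga_pieceM : forall i j x y,
    sga_piece i x -> sga_piece j y -> sga_piece (i + j)%N (x * y);
  sga_piece0 : sga_piece 0%N = range sga_const;
  sga_gen1 : exists (m : nat) (x : 'I_m -> sga_ring),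
    (forall i, sga_piece 1%N (x i)) /\
    (forall r, exists p : {mpoly k[m]}, r = mmap sga_const x p) }.

Arguments sga_const {k} _.
Arguments sga_piece {k} _ _ _.

Record gmodule (k : fieldType) (R : stdGradedAlg k) := GModule {
  gm_sort :> lmodType R;
  gm_piece : nat -> set gm_sort;
  gm_graded : graded_by gm_piece;
  gm_pieceZ : forall i j (r : R) x,
    sga_piece R i r -> gm_piece j x -> gm_piece (i + j)%N (r *: x) }.

Arguments gm_piece {k R} _ _ _.

Definition graded_free (k : fieldType) (R : stdGradedAlg k) (M : gmodule R) :=
  exists (X : choiceType) (deg : X -> nat) (e : X -> M),
    [/\ forall x, gm_piece M (deg x) (e x),
        forall m, exists (s : seq X) (c : X -> R),
          m = \sum_(x <- s) c x *: e x
      & forall (s : seq X) (c : X -> R), uniq s ->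
          \sum_(x <- s) c x *: e x = 0 -> forall x, x \in s -> c x = 0].

Record graded_free_resolution (k : fieldType) (R : stdGradedAlg k)
    (M : gmodule R) := GradedFreeResolution {
  res_mod :> nat -> gmodule R;
  res_d : forall i, {linear res_mod i.+1 -> res_mod i};
  res_aug : {linear res_mod 0%N -> M};
  res_free : forall i, graded_free (res_mod i);
  res_d_deg : forall i j x,
    gm_piece (res_mod i.+1) j x -> gm_piece (res_mod i) j (res_d i x);
  res_aug_deg : forall j x,
    gm_piece (res_mod 0%N) j x -> gm_piece M j (res_aug x);
  res_aug_surj : forall m, exists x, res_aug x = m;
  res_exact0 : forall x, res_aug x = 0 <-> exists y, res_d 0%N y = x;
  res_exactS : forall i x, res_d i x = 0 <-> exists y, res_d i.+1 y = x }.

(* A sequence s of pairs stands for the element of M (x)_R N that is the sum of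
   the pure tensors z.1 (x) z.2 for z <- s; two such sums agree in M (x)_R N iff
   all bilinear maps out of M x N identify them. *)
Definition tensor_eq (R : comNzRingType) (M N : lmodType R)
    (s s' : seq (M * N)) : Prop :=
  forall (Z : lmodType R) (b : {bilinear M -> N -> Z}),
    \sum_(z <- s) b z.1 z.2 = \sum_(z <- s') b z.1 z.2.

Definition tensor_mapl (R : comNzRingType) (M M' N : lmodType R) (f : M -> M')
    (s : seq (M * N)) : seq (M' * N) := [seq (f z.1, z.2) | z <- s].

Definition tensor_homog (k : fieldType) (R : stdGradedAlg k) (M N : gmodule R)
    (j : nat) (s : seq (M * N)) : Prop :=
  forall z, z \in s -> exists a b,
    [/\ gm_piece M a z.1, gm_piece N b z.2 & (a + b)%N = j].

Section Tor.
Variables (k : fieldType) (R : stdGradedAlg k) (M N : gmodule R).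

Definition res_cycle (F : graded_free_resolution M) (i : nat) :
    seq (F i * N) -> Prop :=
  match i with
  | 0 => fun _ => True
  | i'.+1 => fun s => tensor_eq (tensor_mapl (res_d F i') s) [::]
  end.

Definition res_boundary (F : graded_free_resolution M) (i j : nat)
    (s : seq (F i * N)) : Prop :=
  exists2 s' : seq (F i.+1 * N),
    tensor_homog j s' & tensor_eq (tensor_mapl (res_d F i) s') s.

(* Tor^R_i(M, N)_j <> 0, i.e. H_i(F (x)_R N)_j <> 0 for a graded free resolution
   F of M; up to isomorphism this homology does not depend on F. *)
Definition Tor_neq0 (i j : nat) : Prop :=
  exists (F : graded_free_resolution M) (s : seq (F i * N)),
    [/\ tensor_homog j s, res_cycle s & ~ res_boundary j s].

End Tor.

Definition ideal_gen (R : comNzRingType) (G : set R) : {pred R} :=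
  fun r => `[< exists2 s : seq (R * R),
    (forall z, z \in s -> G z.2) & r = \sum_(z <- s) z.1 * z.2 >].

Section IdealGen.
Variables (R : comNzRingType) (G : set R).

Lemma ideal_genP r : reflect (exists2 s : seq (R * R),
    (forall z, z \in s -> G z.2) & r = \sum_(z <- s) z.1 * z.2)
  (r \in ideal_gen G).
Proof. exact: asboolP. Qed.

Lemma ideal_gen0 : 0 \in ideal_gen G.
Proof. by apply/ideal_genP; exists [::]; rewrite ?big_nil. Qed.

Lemma ideal_genPD a u v : u \in ideal_gen G -> v \in ideal_gen G ->
  a * u + v \in ideal_gen G.
Proof.
move=> /ideal_genP[s sG ->] /ideal_genP[t tG ->]; apply/ideal_genP.
exists ([seq (a * z.1, z.2) | z <- s] ++ t).
  by move=> z; rewrite mem_cat => /orP[/mapP[y /sG Gy ->]//|/tG].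
rewrite big_cat big_map mulr_sumr; congr (_ + _).
by apply: eq_bigr => z _; rewrite mulrA.
Qed.

Lemma mem_ideal_gen a g : G g -> a * g \in ideal_gen G.
Proof.
move=> Gg; apply/ideal_genP; exists [:: (a, g)]; last by rewrite big_seq1.
by move=> z; rewrite inE => /eqP ->.
Qed.

Lemma ideal_gen_closed : 1 \notin ideal_gen G -> idealr_closed (ideal_gen G).
Proof. by split=> // [|a u v]; [exact: ideal_gen0 | exact: ideal_genPD]. Qed.

End IdealGen.

Section Residue.
Variables (k : fieldType) (R : stdGradedAlg k).

(* The homogeneous maximal ideal of R. *)
Definition hmax : {pred R} :=
  ideal_gen [set x | exists2 d, (0 < d)%N & sga_piece R d x].

Let hplus (x : R) := exists N (f : nat -> R),
  (forall d, sga_piece R d.+1 (f d)) /\ x = \sum_(d < N) f d.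

Let pieceD d (x y : R) :
  sga_piece R d x -> sga_piece R d y -> sga_piece R d (x + y).
Proof.
move=> Px Py; rewrite -[y]opprK; apply: (gradedB (sga_graded R)) => //.
by rewrite -sub0r; apply: (gradedB (sga_graded R)); first exact: graded0 (sga_graded R) d.
Qed.

Let hplusD x y : hplus x -> hplus y -> hplus (x + y).
Proof.
move=> [N [f [Pf ->]]] [N' [f' [Pf' ->]]].
pose cut n (g : nat -> R) d := if (d < n)%N then g d else 0.
have cutE n m (g : nat -> R) : (n <= m)%N -> \sum_(d < n) g d = \sum_(d < m) cut n g d.
  move=> le_nm; rewrite (big_ord_widen _ (fun d => g d) le_nm) big_mkcond.
  by apply: eq_bigr => i _.
have Pcut n (g : nat -> R) : (forall d, sga_piece R d.+1 (g d)) ->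
    forall d, sga_piece R d.+1 (cut n g d).
  by move=> Pg d; rewrite /cut; case: ifP => // _; exact: graded0 (sga_graded R) _.
exists (maxn N N'), (fun d => cut N f d + cut N' f' d); split.
  by move=> d; apply: pieceD; exact: Pcut.
by rewrite big_split /= -!cutE ?leq_maxl ?leq_maxr.
Qed.

Let hplus0 : hplus 0.
Proof.
exists 0%N, (fun=> 0); rewrite big_ord0; split=> // d.
exact: graded0 (sga_graded R) _.
Qed.

Let hplusM d (x y : R) : (0 < d)%N -> sga_piece R d y -> hplus (x * y).
Proof.
case: d => // d _ Py; have [N [f [Pf ->]]] := graded_span (sga_graded R) x.
rewrite mulr_suml; elim/big_rec: _ => [|i z _]; first exact: hplus0.
apply: hplusD; exists (i + d).+1, (fun e => if e == (i + d)%N then f i * y else 0).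
split=> [e|].
  case: eqP => [->|_]; last exact: graded0 (sga_graded R) _.
  by rewrite -addnS; exact: sga_pieceM.
rewrite big_ord_recr /= eqxx big1 ?add0r // => e _.
by rewrite ltn_eqF.
Qed.

Let hmax_hplus x : x \in hmax -> hplus x.
Proof.
move=> /ideal_genP[s sG ->]; rewrite big_seq; elim/big_rec: _ => [|z y zs].
  exact: hplus0.
by apply: hplusD; have [d d0 /(hplusM _ d0)] := sG _ zs; exact.
Qed.

Lemma hmax1 : 1 \notin hmax.
Proof.
apply/negP => /hmax_hplus[N [f [Pf E]]].
pose g d := if d is e.+1 then - f e else (1 : R).
suff /eqP : g 0%N = 0 by rewrite oner_eq0.
apply: (@graded_indep _ _ (sga_graded R) N.+1 g) => //.
  case=> [|d] /=; first by rewrite sga_piece0; exists 1 => //; rewrite rmorph1.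
  by rewrite -sub0r; apply: (gradedB (sga_graded R)); first exact: graded0 (sga_graded R) _.
by rewrite big_ord_recl /= sumrN -E subrr.
Qed.

HB.instance Definition _ := isIdealr.Build R hmax (ideal_gen_closed hmax1).

Definition residue := {ideal_quot hmax}.

HB.instance Definition _ := GRing.Zmodule.on residue.

Definition residue_scale (r : R) (x : residue) : residue :=
  (\pi_{ideal_quot hmax} r : {ideal_quot hmax}) * (x : {ideal_quot hmax}).

Fact residue_scaleA a b x :
  residue_scale a (residue_scale b x) = residue_scale (a * b) x.
Proof. by rewrite /residue_scale rmorphM mulrA. Qed.

Fact residue_scale1 : left_id 1 residue_scale.
Proof. by move=> x; rewrite /residue_scale rmorph1 mul1r. Qed.

Fact residue_scaleDr : right_distributive residue_scale +%R.
Proof. by move=> a x y; rewrite /residue_scale mulrDr. Qed.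

Fact residue_scaleDl x : {morph residue_scale^~ x : a b / a + b}.
Proof. by move=> a b; rewrite /residue_scale rmorphD mulrDl. Qed.

HB.instance Definition _ := GRing.Zmodule_isLmodule.Build R residue
  residue_scaleA residue_scale1 residue_scaleDr residue_scaleDl.

(* R / hmax is concentrated in degree 0. *)
Definition residue_piece (d : nat) : set residue :=
  if d is 0 then setT else [set 0].

Fact residue_graded : graded_by residue_piece.
Proof.
split=> [[|d]|[|d] x y|x|N f Pf] //=.
- by move=> -> ->; rewrite subrr.
- exists 1%N, (fun d => if d is 0 then x else 0); rewrite big_ord1.
  by split=> // -[].
- case: N => // N; rewrite big_ord_recl /= big1; last by move=> i _; exact: (Pf i.+1).
  by rewrite addr0 => f0 [|d] _; [exact: f0 | exact: (Pf d.+1)].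
Qed.

Fact residue_pieceZ i j (r : R) (x : residue) : sga_piece R i r ->
  residue_piece j x -> residue_piece (i + j)%N (r *: x).
Proof.
case: j => [|j] Rr; last first.
  by move=> x0; rewrite addnS (x0 : x = 0) scaler0.
case: i Rr => [//|i] Rr _; rewrite addn0 /=.
suff E : \pi_{ideal_quot hmax} r = 0 :> {ideal_quot hmax}.
  by change (residue_scale r x = 0); rewrite /residue_scale E mul0r.
apply/eqP; rewrite -[X in _ == X](rmorph0 (\pi_{ideal_quot hmax})).
rewrite -Quotient.idealrBE subr0 -[r]mul1r.
by apply: mem_ideal_gen; exists i.+1.
Qed.

Definition residue_gmodule : gmodule R :=
  GModule residue_graded residue_pieceZ.

End Residue.

Section Invariants.
Variables (k : fieldType) (R : stdGradedAlg k).

Definition Tor_residue_neq0 (i j : nat) : Prop :=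
  Tor_neq0 (residue_gmodule R) (residue_gmodule R) i j.

(* t^R_i(k), as a supremum in the extended integers; it is -oo for set0. *)
Definition t_residue (i : nat) : \bar int :=
  supremum -oo%E [set (j%:Z)%:E | j in [set j | Tor_residue_neq0 i j]].

Definition Koszul : Prop := forall i j, j != i -> ~ Tor_residue_neq0 i j.

End Invariants.

Section AlgebraB.
Variables (n : nat) (k : fieldType).

Local Notation S := {mpoly k[n + n]}.

Definition var_p (i : 'I_n) : S := 'X_(lshift n i).
Definition var_q (i : 'I_n) : S := 'X_(rshift n i).

Definition B_rels : set S :=
  [set g | exists i j, i != j /\
    (g = var_p i * var_q j \/ g = var_p i * var_q i - var_p j * var_q j)].

Definition B_ideal : {pred S} := ideal_gen B_rels.

Let homog d (g : S) := g \is @ishomog1 _ _ d mdeg.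

Let var_homog i : homog 1 ('X_i : S).
Proof. by rewrite /homog dhomogX; apply/eqP; exact: mdeg1. Qed.

Let rels_homog g : B_rels g -> homog 2 g.
Proof.
have pq i j : homog 2 (var_p i * var_q j).
  exact: (dhomogM (var_homog (lshift n i)) (var_homog (rshift n j))).
by move=> [i [j [_ [->|->]]]]; [exact: pq | apply: rpredB; exact: pq].
Qed.

Let pihomog_ideal e p : p \in B_ideal -> pihomog mdeg e p \in B_ideal.
Proof.
move=> /ideal_genP[s sG ->]; rewrite raddf_sum big_seq.
elim/big_rec: _ => [|z y /sG Gz yI]; first exact: ideal_gen0.
rewrite -[X in X + _]mul1r; apply: ideal_genPD => //.
have term i : pihomog mdeg e (pihomog mdeg i z.1 * z.2) \in B_ideal.
  have H : homog (i + 2) (pihomog mdeg i z.1 * z.2).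
    by apply: dhomogM; [exact: pihomogP | exact: rels_homog].
  have [<-|ne] := eqVneq (i + 2)%N e.
    by rewrite (pihomog_dE H); exact: mem_ideal_gen.
  by rewrite (pihomog_ne0 ne H); exact: ideal_gen0.
rewrite {1}[z.1](pihomog_partitionE (leqnn (mmeasure mdeg z.1))).
rewrite mulr_suml raddf_sum; elim/big_rec: _ => [|i w _ wI].
  exact: ideal_gen0.
by rewrite -[X in X + _]mul1r; apply: ideal_genPD => //; exact: term.
Qed.

Lemma B_ideal1 : 1 \notin B_ideal.
Proof.
apply/negP => /ideal_genP[s sG /(congr1 (meval (fun=> 0)))] /eqP.
rewrite meval1 raddf_sum big_seq big1 ?oner_eq0 // => z /sG.
rewrite /= mevalM => -[i [j [_ [->|->]]]].
  by rewrite mevalM mevalXU !(mul0r, mulr0).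
by rewrite mevalB !mevalM !mevalXU !(mul0r, subrr, mulr0).
Qed.

HB.instance Definition _ := isIdealr.Build S B_ideal (ideal_gen_closed B_ideal1).

Definition B_ring := {ideal_quot B_ideal}.

HB.instance Definition _ := GRing.ComNzRing.on B_ring.

Definition B_pi : {rmorphism S -> B_ring} := \pi_{ideal_quot B_ideal}.

Definition B_const : {rmorphism k -> B_ring} := B_pi \o (@mpolyC (n + n) k).

Definition B_piece (d : nat) : set B_ring :=
  [set B_pi g | g in [set g : S | g \is @ishomog1 _ _ d mdeg]].

Let B_pi_eq0 g : (B_pi g == 0) = (g \in B_ideal).
Proof. by rewrite -(rmorph0 B_pi) -Quotient.idealrBE subr0. Qed.

Let B_pi_surj x : exists g, B_pi g = x.
Proof. by exists (repr x); exact: reprK. Qed.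

Fact B_graded : graded_by B_piece.
Proof.
split=> [d|d _ _ [g hg <-] [h hh <-]|x|N f Pf].
- by exists 0; [exact: rpred0 | rewrite rmorph0].
- by exists (g - h); [exact: rpredB | rewrite rmorphB].
- have [g <-] := B_pi_surj x.
  exists (mmeasure mdeg g), (fun d => B_pi (pihomog mdeg d g)); split.
    by move=> d; exists (pihomog mdeg d g) => //; exact: pihomogP.
  by rewrite {1}[g](pihomog_partitionE (leqnn (mmeasure mdeg g))) raddf_sum.
have /boolp.choice[g gP] d : exists h, homog d h /\ B_pi h = f d.
  by have [h ? ?] := Pf d; exists h.
rewrite (eq_bigr (fun d : 'I_N => B_pi (g d))) => [|i _]; last first.
  by case: (gP i).
rewrite -raddf_sum => /eqP; rewrite B_pi_eq0 => gI d ltdN.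
have [hd <-] := gP d; apply/eqP; rewrite B_pi_eq0.
have := pihomog_ideal d gI; rewrite raddf_sum (bigD1 (Ordinal ltdN)) //=.
rewrite (pihomog_dE hd) big1 ?addr0 // => i ne.
by rewrite (@pihomog_ne0 _ _ _ i) //; case: (gP i).
Qed.

Fact B_pieceM i j x y : B_piece i x -> B_piece j y -> B_piece (i + j)%N (x * y).
Proof.
move=> [g hg <-] [h hh <-]; exists (g * h); last by rewrite rmorphM.
exact: dhomogM.
Qed.

Fact B_piece0 : B_piece 0%N = range B_const.
Proof.
apply/seteqP; split=> [_ [g /dhomogP hg <-]|_ [c _ <-]].
  exists (mcoeff mnm0 g) => //=; congr (B_pi _).
  apply/mpolyP => m; rewrite mcoeffC; case: eqVneq => [<-|ne]; rewrite ?mulr1 ?mulr0 //.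
  apply/esym/memN_msupp_eq0; apply: contra ne => /hg /eqP.
  by rewrite mdeg_eq0 eq_sym.
exists (mpolyC _ c) => //; apply/dhomogP => m.
by rewrite msuppC; case: ifP => // _; rewrite inE => /eqP ->; exact: mdeg0.
Qed.

Fact B_gen1 : exists (m : nat) (x : 'I_m -> B_ring),
  (forall i, B_piece 1%N (x i)) /\
  (forall r, exists p : {mpoly k[m]}, r = mmap B_const x p).
Proof.
exists (n + n)%N, (fun i => B_pi 'X_i); split=> [i|r].
  by exists 'X_i => //; exact: var_homog.
have [p <-] := B_pi_surj r; exists p.
rewrite {1}[p]mpolyE raddf_sum; apply: eq_bigr => m _ /=.
rewrite -mul_mpolyC rmorphM; congr (_ * _).
rewrite mpolyXE_id rmorph_prod; apply: eq_bigr => i _.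
by rewrite rmorphXn.
Qed.

Definition algB : stdGradedAlg k :=
  StdGradedAlg B_graded B_pieceM B_piece0 B_gen1.

End AlgebraB.

(* Main.v *)
From HB Require Import structures.
From mathcomp Require Import -(notations) boolp classical_sets functions.
From mathcomp Require Import constructive_ereal.
From mathcomp Require Import -(notations) finmap.
From mathcomp Require Import all_boot all_order all_algebra.
From mathcomp Require Import -(notations) monalg mpoly.
From mathcomp Require Import zify ring.
Require Import Defs.

(** Let K be the Koszul complex of B on its 2n variables, bigraded by the
    exterior degree b and by the degree e of the coefficients, and let w be
    the common value of the products p_i q_i. Modulo w, which spans the socle
    of B in degree 2, the algebra B is glued from k[p] and k[q] along k.

    The homology of K ([koszul_B_exact], [koszul_homology_basis]). The Koszul
    complexes of k[p] and k[q] are exact in positive coefficient degree, so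
    that K can have homology only for e <= 1 and, because of the forms
    w zeta with zeta constant, for e = 2. The differential of a form of
    coefficient degree 1 can be made equal to w times the contraction of an
    arbitrary constant form by sum_i p_i q_i ([koszul_koszul_const]). This
    contraction is a Lefschetz operator: it is onto the forms of degree b < n,
    as long as the integers up to (n + 1) / 2 are invertible in k
    ([lefschetz_surj]). Hence there is no homology for e >= 3, and none for
    e = 2 and b < n.

    Upper bounds ([Tor_residue_high]). Let F be a graded free resolution of k.
    A class in Tor_i(k, k)_j is represented by an element m of F_i of degree j
    with d m in the maximal ideal times F, that is d m = kos y for a form y
    with coefficients in F_(i-1). One descends in the double complex F (x) K
    until F_0 is reached; the obstructions on the way lie in the Koszul
    homology of coefficient degree 1. Their coefficients are again cycles
    modulo the maximal ideal, of an internal degree larger than their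
    homological degree, so they are removed by induction
    ([koszul_cycle_lift], [vanish_high]). For j > i the descent succeeds as
    long as i <= n. For i = n + 1 it ends with exterior degree n, where
    there is homology for e = 2, and j > n + 2 is required.

    Lower bounds ([Tor_diagonal], [Tor_off_diagonal]). Lifting 1 to F_0 and
    then solving d U_(a+1) = (sum_i p_i e_i) U_a gives elements U_a(A) of
    degree a of F_a, indexed by the sets A of size a, whose differentials lie
    in the maximal ideal. As w is annihilated by the variables, w U_n on the
    top form is a cycle, hence the differential of some m in F_(n+1) of degree
    n + 2. These elements are shown not to be boundaries modulo the maximal
    ideal by mapping F to the Koszul complex of p_1, .., p_n on a module which
    is an extension of k[p] by its dual vector space, and on which w maps 1 to
    the functional of the constant coefficient. That complex is exact in
    exterior degrees 0 < a < n, so a comparison map exists through degree n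
    ([test_lift]). Its values on the U_a(A) have Kronecker deltas as constant
    coefficients, and its value on d m is a nonzero element of the dual. *)

Set Implicit Arguments.
Unset Strict Implicit.
Unset Printing Implicit Defensive.

Import Order.TTheory GRing.Theory Num.Theory.

Local Notation "{ 'mpoly' R [ n ] }" := (mpoly n R)
  (at level 0, R at level 2, format "{ 'mpoly'  R [ n ] }") : type_scope.
Local Notation "''X_' i" := (@mpolyX _ _ (mnm1 i))
  (at level 8, i at level 2, format "''X_' i") : ring_scope.
Local Notation "p @_ m" := (mcoeff m p)
  (at level 3, m at level 2, left associativity, format "p @_ m") : ring_scope.
Local Notation "'U_(' i )" := (mnm1 i) (at level 0, i at level 2).
Declare Scope mnm_scope.
Delimit Scope mnm_scope with MM.
Local Notation "m1 + m2" := (mnm_add m1 m2) : mnm_scope.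
Local Notation "m1 - m2" := (mnm_sub m1 m2) : mnm_scope.
Local Notation "0" := mnm0 : mnm_scope.
Local Notation homog d g := (g \is @ishomog1 _ _ d mdeg).
Local Open Scope ring_scope.

(** * Koszul operators on alternating forms *)

Section Exterior.
Variables (I : finType) (rk : I -> nat) (rk_inj : injective rk).
Variable (A : comNzRingType).

(** A form is the function of its coordinates on the subsets of [I]. The
    injection [rk] orders the basis covectors, and [ext_sign i S] is the sign
    of the permutation that moves e_i from the front of e_i e_S to its place. *)
Definition ext_sign (i : I) (S : {set I}) : A :=
  (-1) ^+ #|[set j in S | (rk j < rk i)%N]|.

Lemma ext_signK i (S : {set I}) : ext_sign i S * ext_sign i S = 1.
Proof. by rewrite -expr2 sqrr_sign. Qed.

Lemma ext_sign_or i (S : {set I}) : ext_sign i S = 1 \/ ext_sign i S = -1.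
Proof.
by rewrite /ext_sign -signr_odd; case: (odd _); rewrite ?expr0 ?expr1; [right|left].
Qed.

Lemma ext_signU i j (S : {set I}) : j \notin S ->
  ext_sign i (j |: S) = (if (rk j < rk i)%N then - ext_sign i S else ext_sign i S).
Proof.
move=> jS; rewrite /ext_sign; case: ifP => ji; last first.
  congr (_ ^+ #|pred_of_set _|); apply/setP => l; rewrite !inE.
  by case: eqP => [->|//]; rewrite ji (negbTE jS).
rewrite (_ : [set l in j |: S | _] = j |: [set l in S | (rk l < rk i)%N]).
  by rewrite cardsU1 !inE (negbTE jS) add1n exprS mulN1r.
by apply/setP => l; rewrite !inE; case: eqP => [->|//].
Qed.

Lemma ext_sign_id i (S : {set I}) : ext_sign i (i |: S) = ext_sign i S.
Proof.
rewrite /ext_sign; congr (_ ^+ #|pred_of_set _|); apply/setP => l.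
by rewrite !inE; case: eqP => [->|//]; rewrite ltnn !andbF.
Qed.

Section Operators.
Variable (L : lmodType A).
Local Notation X := {ffun {set I} -> L}.

Definition contract (i : I) (z : X) : X :=
  [ffun S : {set I} => if i \in S then 0 else ext_sign i S *: z (i |: S)].

Definition wedge (i : I) (z : X) : X :=
  [ffun S : {set I} => if i \in S then ext_sign i S *: z (S :\ i) else 0].

Lemma contract_linear i : linear (contract i).
Proof.
move=> a x y; apply/ffunP => S; rewrite !ffunE.
by case: ifP => _; rewrite ?scaler0 ?addr0 // scalerDr !scalerA mulrC.
Qed.
HB.instance Definition _ i :=
  GRing.isLinear.Build A X X _ (contract i) (contract_linear i).

Lemma wedge_linear i : linear (wedge i).
Proof.
move=> a x y; apply/ffunP => S; rewrite !ffunE.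
by case: ifP => _; rewrite ?scaler0 ?addr0 // scalerDr !scalerA mulrC.
Qed.
HB.instance Definition _ i :=
  GRing.isLinear.Build A X X _ (wedge i) (wedge_linear i).

Lemma contract_contract i j z : contract i (contract j z) = - contract j (contract i z).
Proof.
apply/ffunP => S; rewrite !ffunE !in_setU1 (eq_sym j i).
have [<-|ij] := eqVneq i j.
  by rewrite /=; case: (i \in S); rewrite ?scaler0 oppr0.
have [iS|iS] /= := boolP (i \in S); have [jS|jS] /= := boolP (j \in S);
  rewrite ?scaler0 ?oppr0 //.
rewrite !scalerA setUCA -scaleNr; congr (_ *: _).
rewrite !ext_signU //.
have : rk i != rk j by apply: contra ij => /eqP /rk_inj ->.
by case: ltngtP => // _ _; rewrite ?mulrN ?mulNr ?opprK mulrC.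
Qed.

Lemma contract2 i z : contract i (contract i z) = 0.
Proof. by apply/ffunP => S; rewrite !ffunE in_setU1 eqxx; case: ifP; rewrite ?scaler0. Qed.

Lemma wedge2 i z : wedge i (wedge i z) = 0.
Proof. by apply/ffunP => S; rewrite !ffunE setD11 scaler0; case: ifP. Qed.

Lemma contract_wedge_id i z (S : {set I}) :
  contract i (wedge i z) S = (if i \in S then 0 else z S).
Proof.
rewrite !ffunE setU11; case: ifP => // /negbT iS.
by rewrite scalerA ext_sign_id ext_signK scale1r setU1K.
Qed.

Lemma wedge_contract_id i z (S : {set I}) :
  wedge i (contract i z) S = (if i \in S then z S else 0).
Proof.
rewrite !ffunE setD11; case: ifP => // iS.
rewrite scalerA setD1K // -[X in ext_sign i X * _](setD1K iS) ext_sign_id.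
by rewrite ext_signK scale1r.
Qed.

Lemma contract_wedge i j z : i != j ->
  contract i (wedge j z) = - wedge j (contract i z).
Proof.
move=> ij; apply/ffunP => S; rewrite !ffunE in_setU1 in_setD1 (eq_sym j i) ij.
rewrite (negbTE ij) /=.
have [iS|iS] /= := boolP (i \in S); have [jS|jS] /= := boolP (j \in S);
  rewrite ?scaler0 ?oppr0 //.
rewrite !scalerA -scaleNr.
have -> : (i |: S) :\ j = i |: S :\ j.
  apply/setP => l; rewrite !inE; case: eqP => // ->.
  by rewrite eq_sym (negbTE ij).
congr (_ *: _); rewrite -{1}(setD1K jS) ext_signU ?setD11 // ext_signU //.
have : rk i != rk j by apply: contra ij => /eqP /rk_inj ->.
by case: ltngtP => // _ _; rewrite ?mulrN ?mulNr ?opprK mulrC.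
Qed.

Lemma wedge_wedge i j z : wedge i (wedge j z) = - wedge j (wedge i z).
Proof.
have [->|ij] := eqVneq i j; first by rewrite wedge2 oppr0.
apply/ffunP => S; rewrite !ffunE !in_setD1 (eq_sym j i) ij /=.
have [iS|iS] /= := boolP (i \in S); have [jS|jS] /= := boolP (j \in S);
  rewrite ?scaler0 ?oppr0 //.
rewrite !scalerA setDDl setUC -setDDl -scaleNr; congr (_ *: _).
have iSj : i \in S :\ j by rewrite in_setD1 ij.
have jSi : j \in S :\ i by rewrite in_setD1 eq_sym ij.
rewrite -{1}(setD1K jS) -{3}(setD1K iS) !ext_signU ?setD11 //.
have : rk i != rk j by apply: contra ij => /eqP /rk_inj ->.
by case: ltngtP => // _ _; rewrite ?mulrN ?mulNr ?opprK mulrC.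
Qed.

Definition koszul (a : I -> A) (z : X) : X := \sum_i a i *: contract i z.
Definition cokoszul (a : I -> A) (z : X) : X := \sum_i a i *: wedge i z.

Lemma koszul_linear a : linear (koszul a).
Proof.
move=> c x y; rewrite /koszul scaler_sumr -big_split /=; apply: eq_bigr => i _.
by rewrite linearP scalerDr !scalerA mulrC.
Qed.
HB.instance Definition _ a :=
  GRing.isLinear.Build A X X _ (koszul a) (koszul_linear a).

Lemma cokoszul_linear a : linear (cokoszul a).
Proof.
move=> c x y; rewrite /cokoszul scaler_sumr -big_split /=; apply: eq_bigr => i _.
by rewrite linearP scalerDr !scalerA mulrC.
Qed.
HB.instance Definition _ a :=
  GRing.isLinear.Build A X X _ (cokoszul a) (cokoszul_linear a).

Lemma koszulE a z (S : {set I}) :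
  koszul a z S = \sum_(i | i \notin S) a i *: (ext_sign i S *: z (i |: S)).
Proof.
rewrite /koszul sum_ffunE [RHS]big_mkcond /=; apply: eq_bigr => i _.
by rewrite !ffunE; case: ifP; rewrite ?scaler0.
Qed.

Lemma cokoszulE a z (S : {set I}) :
  cokoszul a z S = \sum_(i | i \in S) a i *: (ext_sign i S *: z (S :\ i)).
Proof.
rewrite /cokoszul sum_ffunE [RHS]big_mkcond /=; apply: eq_bigr => i _.
by rewrite !ffunE; case: ifP; rewrite ?scaler0.
Qed.

(** The terms at (i, j) and (j, i) cancel. Splitting the sum along [rk] avoids
    a division by 2. *)
Lemma sum_antisym (V : zmodType) (G : I -> I -> V) :
  (forall i, G i i = 0) -> (forall i j, G i j = - G j i) ->
  \sum_i \sum_j G i j = 0.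
Proof.
move=> G0 GN.
have split_row i : \sum_j G i j =
    \sum_(j | (rk j < rk i)%N) G i j + \sum_(j | (rk i < rk j)%N) G i j.
  rewrite (bigID (fun j => (rk j < rk i)%N)) /=; congr (_ + _).
  rewrite (bigD1 i) ?ltnn //= G0 add0r; apply: eq_bigl => j.
  have [->|] := eqVneq j i; first by rewrite ltnn andbF.
  by move/(contra_neq (@rk_inj _ _)); case: ltngtP.
rewrite (eq_bigr _ (fun i _ => split_row i)) big_split /=.
rewrite [X in _ + X](exchange_big_dep xpredT) //= -big_split big1 //= => i _.
by rewrite -big_split big1 //= => j _; rewrite (GN i) addNr.
Qed.

Lemma koszul_koszul a z : koszul a (koszul a z) = 0.
Proof.
rewrite {1}/koszul (eq_bigr (fun i => \sum_j (a i * a j) *: contract i (contract j z))).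
  apply: sum_antisym => [i|i j]; first by rewrite contract2 scaler0.
  by rewrite contract_contract scalerN mulrC.
move=> i _; rewrite raddf_sum scaler_sumr; apply: eq_bigr => j _.
by rewrite /= linearZ /= scalerA.
Qed.

Lemma cokoszul_cokoszul a z : cokoszul a (cokoszul a z) = 0.
Proof.
rewrite {1}/cokoszul (eq_bigr (fun i => \sum_j (a i * a j) *: wedge i (wedge j z))).
  apply: sum_antisym => [i|i j]; first by rewrite wedge2 scaler0.
  by rewrite wedge_wedge scalerN mulrC.
move=> i _; rewrite raddf_sum scaler_sumr; apply: eq_bigr => j _.
by rewrite /= linearZ /= scalerA.
Qed.

(** Contraction by e_j and multiplication by e_i anticommute for j != i and
    have sum the identity for j = i. Hence multiplication by e_i is a homotopy
    between 0 and multiplication by [a i] on the Koszul complex. *)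
Lemma koszul_wedge a i z : koszul a (wedge i z) + wedge i (koszul a z) = a i *: z.
Proof.
rewrite /koszul raddf_sum -big_split /= (bigD1 i) //= big1 => [|j ji].
  rewrite addr0 linearZ /= -scalerDr; congr (_ *: _); apply/ffunP => S.
  rewrite ffunE contract_wedge_id wedge_contract_id.
  by case: (i \in S); rewrite ?add0r ?addr0.
by rewrite contract_wedge // linearZ /= scalerN addNr.
Qed.

End Operators.

Section Functor.
Variables (L L' : lmodType A) (f : {linear L -> L'}).
Local Notation X := {ffun {set I} -> L}.
Local Notation X' := {ffun {set I} -> L'}.

Definition ext_map (z : X) : X' := [ffun S : {set I} => f (z S)].

Lemma ext_map_linear : linear ext_map.
Proof. by move=> a x y; apply/ffunP => S; rewrite !ffunE linearP. Qed.
HB.instance Definition _ := GRing.isLinear.Build A X X' _ ext_map ext_map_linear.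

Lemma ext_map_contract i z : ext_map (contract i z) = contract i (ext_map z).
Proof.
by apply/ffunP => S; rewrite !ffunE; case: ifP; rewrite ?raddf0 // linearZ.
Qed.

Lemma ext_map_wedge i z : ext_map (wedge i z) = wedge i (ext_map z).
Proof.
by apply/ffunP => S; rewrite !ffunE; case: ifP; rewrite ?raddf0 // linearZ.
Qed.

Lemma ext_map_koszul a z : ext_map (koszul a z) = koszul a (ext_map z).
Proof.
rewrite /koszul raddf_sum; apply: eq_bigr => i _.
by rewrite /= linearZ /= ext_map_contract.
Qed.

Lemma ext_map_cokoszul a z : ext_map (cokoszul a z) = cokoszul a (ext_map z).
Proof.
rewrite /cokoszul raddf_sum; apply: eq_bigr => i _.
by rewrite /= linearZ /= ext_map_wedge.
Qed.

End Functor.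
End Exterior.

(** * Exactness of Koszul complexes by division by one variable at a time *)

Section DivisionHomotopy.
Variables (I : finType) (rk : I -> nat) (rk_inj : injective rk).
Variables (A : comNzRingType) (L : lmodType A) (a : I -> A).
Variable dv : I -> {additive L -> L}.
Hypothesis dv_comm : forall i j x, i != j -> dv i (a j *: x) = a j *: dv i x.
Local Notation X := {ffun {set I} -> L}.
Local Notation kos := (koszul rk a).

(** If [dv i] inverts multiplication by [a i] on one side, then multiplication
    by e_i followed by [dv i] is a homotopy between 0 and a projection. *)
Definition div_homotopy (i : I) (z : X) : X :=
  [ffun S : {set I} => dv i (wedge rk i z S)].

(** By [koszul_wedge], the differential of z wedge e_i is a_i z on a cycle z.
    As [dv i] commutes with every a_j but a_i, it passes through all the
    summands of the differential except the contraction by e_i, and that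
    contraction sees whether i lies in S. *)
Lemma div_homotopyE i z S : kos z = 0 ->
  kos (div_homotopy i z) S =
  if i \in S then dv i (a i *: z S) else a i *: dv i (z S).
Proof.
move=> z0; pose D (x : X) : X := [ffun S : {set I} => dv i (x S)].
have D_contract j x : contract rk j (D x) = D (contract rk j x).
  apply/ffunP => T; rewrite !ffunE; case: ifP; rewrite ?raddf0 // => _.
  by case: (ext_sign_or rk A j T) => ->; rewrite ?scale1r // !scaleN1r raddfN.
have DB x y : D (x + y) = D x + D y.
  by apply/ffunP => T; rewrite !ffunE raddfD.
have D0 : D 0 = 0 by apply/ffunP => T; rewrite !ffunE raddf0.
have D_sum (P : pred I) F : D (\sum_(j | P j) F j) = \sum_(j | P j) D (F j).
  by apply: (big_morph D DB D0).
pose w := wedge rk i z.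
have rest : \sum_(j | j != i) a j *: contract rk j w = a i *: wedge rk i (contract rk i z).
  have := koszul_wedge rk_inj a i z; rewrite z0 raddf0 addr0.
  rewrite /koszul (bigD1 i) //= => /(canRL (addKr _)) ->.
  rewrite addrC -/w.
  rewrite -scalerBr; congr (_ *: _); apply/ffunP => T; rewrite !ffunE.
  have := contract_wedge_id rk i z T; have := wedge_contract_id rk i z T.
  rewrite !ffunE /= => -> ->; case: (i \in T); by rewrite ?subr0 ?subrr.
have -> : kos (div_homotopy i z) = a i *: D (contract rk i w) +
    D (a i *: wedge rk i (contract rk i z)).
  rewrite -rest D_sum /koszul (bigD1 i) //=; congr (_ + _).
    by rewrite -D_contract.
  apply: eq_bigr => j ji; rewrite (_ : div_homotopy i z = D w) // D_contract.
  by apply/ffunP => T; rewrite !ffunE dv_comm // eq_sym.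
have := wedge_contract_id rk i z S; have := contract_wedge_id rk i z S.
rewrite -/w; move: (contract rk i w) (wedge rk i (contract rk i z)) => u v.
rewrite !ffunE => -> ->.
by case: (i \in S); rewrite ?raddf0 ?scaler0 ?raddf0 ?add0r ?addr0.
Qed.

(** The conditions, typically a degree and a support, imposed on the chains
    and on their primitives. *)
Variables (Pz Py : {set I} -> L -> Prop).
Hypothesis Pz_B : forall S x y, Pz S x -> Pz S y -> Pz S (x - y).
Hypothesis Py_0 : forall S, Py S 0.
Hypothesis Py_B : forall S x y, Py S x -> Py S y -> Py S (x - y).
Hypothesis Pz_dv : forall i (S : {set I}) x, i \in S -> Pz (S :\ i) x -> Py S (dv i x).
Hypothesis Py_a : forall i (S : {set I}) x, i \notin S -> Py (i |: S) x -> Pz S (a i *: x).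
Hypothesis Pz_0 : forall S, Pz S 0.

Let Pz_N S x : Pz S x -> Pz S (- x).
Proof. by move=> h; rewrite -sub0r; exact: Pz_B. Qed.
Let Pz_D S x y : Pz S x -> Pz S y -> Pz S (x + y).
Proof. by move=> h1 h2; rewrite -[y]opprK; apply: Pz_B => //; exact: Pz_N. Qed.
Let Py_N S x : Py S x -> Py S (- x).
Proof. by move=> h; rewrite -sub0r; exact: Py_B. Qed.
Let Pz_sign S T i x : Pz S x -> Pz S (ext_sign rk A i T *: x).
Proof.
case: (ext_sign_or rk A i T) => ->; rewrite ?scale1r // scaleN1r; exact: Pz_N.
Qed.

Let Pz_koszul (y : X) : (forall S, Py S (y S)) -> forall S, Pz S (kos y S).
Proof.
move=> hy S; rewrite koszulE; elim/big_ind: _ => // [u v|i iS]; first exact: Pz_D.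
by rewrite scalerA mulrC -scalerA; apply: Pz_sign; apply: Py_a.
Qed.

Let Py_homotopy i (z : X) : (forall S, Pz S (z S)) -> forall S, Py S (div_homotopy i z S).
Proof.
move=> hz S; rewrite !ffunE; case: ifP => iS; last by rewrite raddf0.
by apply: Pz_dv => //; apply: Pz_sign.
Qed.

(** When [dv i] is a left inverse of [a i], subtracting the boundary of the
    homotopy makes the cycle vanish on the sets that contain i and puts its
    other coordinates in the kernel of [dv i]. Both properties survive the
    treatment of the next variables. *)
Lemma koszul_exact_inj (s : seq I) (z : X) : uniq s ->
    (forall i, i \in s -> forall x, dv i (a i *: x) = x) ->
    (forall i j x, dv i (dv j x) = dv j (dv i x)) ->
    kos z = 0 -> (forall S, Pz S (z S)) ->
  exists y : X, [/\ forall S, Py S (y S),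
    forall i (S : {set I}), i \in s -> i \in S -> z S = kos y S &
    forall i (S : {set I}), i \in s -> dv i (z S - kos y S) = 0].
Proof.
elim: s => [|i s IH] /=.
  move=> _ _ _ _ _; exists 0; split=> [S|//|//]; by rewrite ffunE.
move=> /andP[ni us] da dd z0 hz.
have [y [hy y1 y2]] := IH us (fun j js => da j (mem_behead (s:=i::s) js)) dd z0 hz.
pose z' := z - kos y.
have z'0 : kos z' = 0 by rewrite raddfB /= z0 koszul_koszul // subr0.
have hz' S : Pz S (z' S) by rewrite !ffunE; apply: Pz_B => //; exact: Pz_koszul.
have dai x : dv i (a i *: x) = x by apply: da; rewrite mem_head.
have z'E S : (z - kos (y + div_homotopy i z')) S =
    if i \in S then 0 else z' S - a i *: dv i (z' S).
  rewrite raddfD /= opprD addrA -/z' !ffunE div_homotopyE // !ffunE.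
  by case: ifP => // _; rewrite dai subrr.
have z'j j S : j \in s -> dv j (z' S) = 0 by move=> js; rewrite !ffunE y2.
exists (y + div_homotopy i z'); split.
- move=> S; rewrite ffunE -[X in _ + X]opprK; apply: Py_B => //.
  by apply: Py_N; exact: Py_homotopy.
- move=> j S; rewrite inE => /orP[/eqP ->|js] jS; apply/eqP;
    rewrite -subr_eq0; apply/eqP; have := z'E S; rewrite !ffunE => ->.
    by rewrite jS.
  have z'S : z' S = 0 by rewrite !ffunE (y1 j) // subrr.
  by have := z'S; rewrite !ffunE => ->; rewrite raddf0 scaler0 subr0 if_same.
move=> j S; rewrite inE => jis; have := z'E S; rewrite !ffunE => ->.
have <- : z' S = z S - kos y S by rewrite !ffunE.
case: ifP => _; first by rewrite raddf0.
have [->|ji] := eqVneq j i; first by rewrite raddfB /= dai subrr.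
have js : j \in s by move: jis; rewrite (negbTE ji).
by rewrite raddfB /= dv_comm // dd (z'j j) // raddf0 scaler0 subr0.
Qed.

(** When [dv i] is a right inverse of [a i], the same correction makes the
    cycle vanish on the sets that miss i. *)
Lemma koszul_exact_surj (s : seq I) (z : X) :
    (forall i, i \in s -> forall S x, Pz S x -> a i *: dv i x = x) ->
    kos z = 0 -> (forall S, Pz S (z S)) ->
  exists y : X, (forall S, Py S (y S)) /\
    forall i (S : {set I}), i \in s -> i \notin S -> z S = kos y S.
Proof.
elim: s => [|i s IH] /=.
  move=> _ _ _; exists 0; split=> [S|//]; by rewrite ffunE.
move=> da z0 hz.
have [y [hy y1]] := IH (fun j js => da j (mem_behead (s:=i::s) js)) z0 hz.
pose z' := z - kos y.
have z'0 : kos z' = 0 by rewrite raddfB /= z0 koszul_koszul // subr0.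
have hz' S : Pz S (z' S) by rewrite !ffunE; apply: Pz_B => //; exact: Pz_koszul.
have dai S x : Pz S x -> a i *: dv i x = x by apply: da; rewrite mem_head.
have z'E S : (z - kos (y + div_homotopy i z')) S =
    if i \in S then z' S - dv i (a i *: z' S) else 0.
  rewrite raddfD /= opprD addrA -/z' !ffunE div_homotopyE // !ffunE.
  by case: ifP => // _; rewrite (dai S) ?subrr //; have := hz' S; rewrite !ffunE.
exists (y + div_homotopy i z'); split.
- move=> S; rewrite ffunE -[X in _ + X]opprK; apply: Py_B => //.
  by apply: Py_N; exact: Py_homotopy.
- move=> j S; rewrite inE => /orP[/eqP ->|js] jS; apply/eqP;
    rewrite -subr_eq0; apply/eqP; have := z'E S; rewrite !ffunE => ->.
    by rewrite (negbTE jS).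
  have z'S : z' S = 0 by rewrite !ffunE (y1 j) // subrr.
  by have := z'S; rewrite !ffunE => ->; rewrite scaler0 raddf0 subr0 if_same.
Qed.

End DivisionHomotopy.

(** * A Lefschetz property of the exterior algebra *)

Section Lefschetz.
Variables (n : nat) (k : fieldType).
Hypothesis small_unit : forall r, (0 < r)%N -> (r.*2 <= n.+1)%N -> r%:R != 0 :> k.
Local Notation I := 'I_(n + n).
Local Notation l i := (lshift n i).
Local Notation r i := (rshift n i).

Definition pair_set (i : 'I_n) : {set I} := [set l i; r i].
Definition full_pairs (T : {set I}) : {set 'I_n} := [set i | (l i \in T) && (r i \in T)].
Definition empty_pairs (T : {set I}) : {set 'I_n} :=
  [set i | (l i \notin T) && (r i \notin T)].

Lemma card_pairs (T : {set I}) : (#|T| + #|empty_pairs T| = n + #|full_pairs T|)%N.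
Proof.
have nE : n = (\sum_(i < n) 1)%N by rewrite sum1_card card_ord.
rewrite -!sum1_card [X in (X + _)%N]big_mkcond [X in (_ + X = _)%N]big_mkcond.
rewrite [X in (_ = _ + X)%N]big_mkcond [X in (_ = X + _)%N]nE big_split_ord /= -!big_split /=.
apply: eq_bigr => i _; rewrite !inE.
by case: (l i \in T); case: (r i \in T).
Qed.

Lemma in_pair_setU (i : 'I_n) (T : {set I}) j :
  (l j \in pair_set i :|: T) = (j == i) || (l j \in T).
Proof. by rewrite !inE !(inj_eq (@lshift_inj _ _)) eq_lrshift orbF. Qed.

Lemma in_pair_setUr (i : 'I_n) (T : {set I}) j :
  (r j \in pair_set i :|: T) = (j == i) || (r j \in T).
Proof. by rewrite !inE !(inj_eq (@rshift_inj _ _)) eq_rlshift. Qed.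

(** The solution c of s c(s) + (m + 1 - s) c(s + 1) = [s = 0] for s <= m. *)
Fixpoint lefschetz_coef (m s : nat) : k :=
  if s is s'.+1 then ((s' == 0%N)%:R - s'%:R * lefschetz_coef m s') / (m.+1 - s')%:R
  else 0.

(** Let P be the set of the m pairs contained in S. As |S| < n there are m + 1
    pairs disjoint from S; let E be a set of m + 1 of them. The form C lives
    on the sets that agree with S outside the pairs of W = P u E and that
    contain exactly m + 1 pairs of W and no half of one, and its value depends
    only on the number of those pairs that are not in P. For a set T that
    contains m pairs of W, s of them outside P, the sum over the pairs that
    can be added has s terms for a pair of P and m + 1 - s terms for a pair of
    E. This is the recurrence of [lefschetz_coef], whose denominators are at
    most m + 1 <= (n + 1) / 2. *)
Lemma lefschetz_delta (S : {set I}) : (#|S| < n)%N ->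
  exists C : {set I} -> k, (forall T : {set I}, #|T| != #|S|.+2 -> C T = 0) /\
    forall T, \sum_(i | i \in empty_pairs T) C (pair_set i :|: T) = (T == S)%:R.
Proof.
move=> Sn; pose P := full_pairs S; pose m := #|P|.
have m2 : (m.*2 <= #|S|)%N.
  have : (m + #|empty_pairs S| <= n)%N.
    have <- : #|P :|: empty_pairs S| = (m + #|empty_pairs S|)%N.
      rewrite cardsU (_ : P :&: empty_pairs S = set0) ?cards0 ?subn0 //.
      by apply/setP => i; rewrite !inE; case: (l i \in S); rewrite ?andbF.
    by rewrite -[X in (_ <= X)%N]card_ord max_card.
  by have := card_pairs S; rewrite -/P -/m -addnn; lia.
have [E [EE cE]] : exists E : {set 'I_n}, E \subset empty_pairs S /\ #|E| = m.+1.
  have : (m.+1 <= #|empty_pairs S|)%N.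
    by have := card_pairs S; rewrite -/P -/m; lia.
  case/card_geqP => s [us ss sE]; exists [set x in s]; split.
    by apply/subsetP => x; rewrite inE => /sE.
  by rewrite cardsE (card_uniqP us).
have PE0 : [disjoint P & E].
  rewrite disjoint_sym disjoint_subset; apply/subsetP => i /(subsetP EE).
  by rewrite !inE => /andP[/negbTE -> _].
pose W := P :|: E.
pose ok (T : {set I}) := [forall i, if i \in W then (l i \in T) == (r i \in T)
  else ((l i \in T) == (l i \in S)) && ((r i \in T) == (r i \in S))].
pose C (T : {set I}) := if ok T && (#|full_pairs T| == m.+1)
  then lefschetz_coef m #|full_pairs T :\: P| else 0.
have okS : ok S.
  apply/forallP => i; case: ifP; rewrite ?eqxx // !inE => /orP[/andP[-> ->]//|].
  by move/(subsetP EE); rewrite !inE => /andP[/negbTE -> /negbTE ->].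
have full_sub T : ok T -> full_pairs T \subset W.
  move=> /forallP okT; apply/subsetP => i; rewrite inE => /andP[li ri].
  have := okT i; case: ifP => // iW; rewrite li ri !(eq_sym true) !eqb_id => h.
  by rewrite -iW /W !inE h.
have full_pairU i T : full_pairs (pair_set i :|: T) = i |: full_pairs T.
  by apply/setP => j; rewrite inE in_pair_setU in_pair_setUr !inE; case: (j == i).
have okU i T : i \in empty_pairs T -> i \in W -> ok (pair_set i :|: T) = ok T.
  rewrite inE => /andP[/negbTE li /negbTE ri] iW; apply: eq_forallb => j.
  rewrite in_pair_setU in_pair_setUr; have [->|//] := eqVneq j i.
  by rewrite iW li ri.
have okUN i T : i \notin W -> ok (pair_set i :|: T) = false.
  move=> iW; apply/forallP => /(_ i); rewrite (negbTE iW).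
  rewrite in_pair_setU in_pair_setUr eqxx /= !(eq_sym true) !eqb_id => h.
  by move: iW; rewrite !inE h.
have ok_empty T i : ok T -> (i \in empty_pairs T) && (i \in W) = (i \in W :\: full_pairs T).
  move=> /forallP /(_ i); rewrite in_setD; case iW: (i \in W); rewrite ?andbF //.
  by move=> /eqP; rewrite !inE => ->; case: (r i \in T).
(* The pairs of W are full or empty in such a T, so that its size determines
   the number of full pairs. *)
have card_ok T : ok T -> #|T| = (#|S| + #|full_pairs T| * 2 - m * 2)%N.
  move=> okT.
  have pW (U : {set I}) : ok U -> (#|empty_pairs U| + #|full_pairs U|)%N =
     (#|W| + #|[set i in ~: W | (l i \notin S) && (r i \notin S)]|)%N.
    move=> okU'; have /forallP h := okU'.
    rewrite -(cardsID (full_pairs U) W) (setIidPr (full_sub _ okU')) addnC -addnA.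
    congr (_ + _)%N; rewrite -[LHS](cardsID W); congr (_ + _)%N; apply: eq_card => i.
      by rewrite in_setI ok_empty.
    rewrite !inE; have := h i; rewrite !inE.
    by case: ifP => //= _ /andP[/eqP -> /eqP ->].
  have := pW _ okT; have := pW _ okS; have := card_pairs T; have := card_pairs S.
  by rewrite -/P -/m; lia.
exists C; split=> [T|T].
  rewrite /C; case: ifP => // /andP[okT /eqP fT] /eqP[].
  by rewrite card_ok // fT; lia.
have [okT|nokT] := boolP (ok T); last first.
  rewrite big1 => [|i iT]; last first.
    rewrite /C; have [iW|iW] := boolP (i \in W); last by rewrite okUN.
    by rewrite okU // (negbTE nokT).
  by case: eqP nokT => [->|//]; rewrite okS.
have -> : \sum_(i | i \in empty_pairs T) C (pair_set i :|: T) =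
    \sum_(i in W :\: full_pairs T) C (pair_set i :|: T).
  rewrite (bigID [in W]) /= [X in _ + X]big1 ?addr0 => [|i /andP[_ iW]].
    by apply: eq_bigl => i; rewrite ok_empty.
  by rewrite /C okUN.
set Q := full_pairs T; have QW : Q \subset W := full_sub _ okT.
have CE i : i \in W :\: Q -> C (pair_set i :|: T) =
   if #|Q| == m then lefschetz_coef m #|(i |: Q) :\: P| else 0.
  move=> iWQ; have : (i \in empty_pairs T) && (i \in W) by rewrite ok_empty.
  move=> /andP[iT iW]; rewrite /C okU // okT full_pairU cardsU1 -/Q /=.
  by move: iWQ; rewrite in_setD => /andP[-> _].
rewrite (eq_bigr _ CE).
have [Qm|Qm] := eqVneq #|Q| m; last first.
  by rewrite big1 //; case: (T =P S) Qm => // TS; rewrite /Q TS eqxx.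
pose s := #|Q :\: P|.
have sm : (s <= m)%N by rewrite -Qm subset_leq_card // subsetDl.
have cPQ : #|P :\: Q| = s.
  have := cardsID P Q; have := cardsID Q P; rewrite setIC -/m Qm -/s; lia.
have cEQ : #|E :\: Q| = (m.+1 - s)%N.
  have : #|E :&: Q| = s.
    rewrite /s; apply: eq_card => i; rewrite in_setI in_setD.
    have [iQ|] := boolP (i \in Q); last by rewrite !andbF.
    have := subsetP QW _ iQ; rewrite in_setU.
    have [iE _|iE] := boolP (i \in E); last by rewrite orbF => ->.
    by rewrite (disjointFl PE0 iE).
  by have := cardsID Q E; lia.
have -> : \sum_(i in W :\: Q) lefschetz_coef m #|(i |: Q) :\: P| =
    s%:R * lefschetz_coef m s + (m.+1 - s)%:R * lefschetz_coef m s.+1.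
  rewrite -[in s%:R]cPQ -cEQ !mulr_natl -!sumr_const.
  rewrite (bigID [in P]) /=; congr (_ + _).
    apply: eq_big => [i|i /andP[_ iP]].
      by rewrite !in_setD in_setU; case: (i \in P); rewrite ?andbF ?andbT.
    congr lefschetz_coef; apply: eq_card => j; rewrite !in_setD in_setU1.
    by case: eqP => // ->; rewrite iP.
  apply: eq_big => [i|i /andP[iQ iP]].
    rewrite !in_setD in_setU; have [iE|iE] := boolP (i \in E).
      by rewrite (disjointFl PE0 iE) !andbT.
    by rewrite orbF andbF -andbA andbN andbF.
  rewrite (_ : #|(i |: Q) :\: P| = s.+1) // (_ : (i |: Q) :\: P = i |: (Q :\: P)).
    by rewrite cardsU1 -/s !in_setD; move: iQ; rewrite in_setD => /andP[/negbTE -> _]; rewrite andbF.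
  by apply/setP => j; rewrite !in_setD !in_setU1 !in_setD; case: eqP => // ->; rewrite iP.
(* A set T with Q = P agrees with S on W as well. *)
have TS : (T == S) = (s == 0%N).
  rewrite cards_eq0 setD_eq0; apply/eqP/idP => [TS|QP]; first by rewrite /Q TS.
  have QPe : Q = P by apply/eqP; rewrite eqEcard QP Qm leqnn.
  apply/setP => x; have /forallP okx := okT; case: (split_ordP x) => i ->.
    have := okx i; case: ifP => [iW|_ /andP[/eqP]//] /eqP h.
    have := congr1 (fun A : {set 'I_n} => i \in A) QPe; rewrite !inE -h andbb => ->.
    have /forallP/(_ i) := okS; rewrite iW => /eqP ->; by rewrite andbb.
  have := okx i; case: ifP => [iW|_ /andP[_ /eqP]//] /eqP h.
  have := congr1 (fun A : {set 'I_n} => i \in A) QPe; rewrite !inE h andbb => ->.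
  have /forallP/(_ i) := okS; rewrite iW => /eqP <-; by rewrite andbb.
rewrite TS /= mulrC [X in _ + X]mulrC divfK; last first.
  by apply: small_unit; [lia | rewrite -addnn; lia].
by rewrite mulrC addrC subrK.
Qed.

(** By [lefschetz_delta], every basis form of degree b is a contraction by the
    two-form sum_i p_i q_i. *)
Lemma lefschetz_surj b (zeta : {set I} -> k) : (b < n)%N ->
    (forall S : {set I}, #|S| != b -> zeta S = 0) ->
  exists C : {set I} -> k, (forall T : {set I}, #|T| != b.+2 -> C T = 0) /\
    forall T, \sum_(i | i \in empty_pairs T) C (pair_set i :|: T) = zeta T.
Proof.
move=> bn hz.
have /boolp.choice[D hD] (S : {set I}) : exists C : {set I} -> k, #|S| = b ->
    (forall T : {set I}, #|T| != b.+2 -> C T = 0) /\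
    forall T, \sum_(i | i \in empty_pairs T) C (pair_set i :|: T) = (T == S)%:R.
  have [Sb|Sb] := eqVneq #|S| b; last by exists (fun=> 0) => Sb'; rewrite Sb' eqxx in Sb.
  have Sn : (#|S| < n)%N by rewrite Sb.
  by have [C hC] := lefschetz_delta Sn; exists C => _; rewrite Sb in hC.
exists (fun T => \sum_(S : {set I} | #|S| == b) zeta S * D S T); split=> [T Tb|T].
  by rewrite big1 // => S /eqP/hD[-> //]; rewrite mulr0.
rewrite exchange_big /=.
rewrite (eq_bigr (fun S : {set I} => zeta S * (T == S)%:R)) => [|S /eqP/hD[_ <-]]; last first.
  by rewrite mulr_sumr.
have [Tb|Tb] := eqVneq #|T| b; last first.
  rewrite big1 ?hz // => S /eqP Sb; case: (T =P S) Tb => [->|]; last by rewrite mulr0.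
  by rewrite Sb eqxx.
rewrite (bigD1 T) /=; last exact/eqP.
rewrite eqxx mulr1 big1 ?addr0 // => S /andP[_]; rewrite eq_sym => /negbTE ->.
by rewrite mulr0.
Qed.

End Lefschetz.

(** * The structure of B *)

Lemma mpoly_ind_var (R : comNzRingType) (m : nat) (P : {mpoly R[m]} -> Prop) :
  (forall c, P (mpolyC _ c)) -> (forall p q, P p -> P q -> P (p + q)) ->
  (forall i p, P p -> P ('X_i * p)) -> forall p, P p.
Proof.
move=> PC PD PX p; rewrite [p]mpolyE; elim/big_ind: _ => [||mm _] //.
  by rewrite -mpolyC0.
rewrite -mul_mpolyC mulrC mpolyXE_id; move: (p@_mm) => c.
have PXn i d q : P q -> P ('X_i ^+ d * q).
  by move=> Pq; elim: d => [|d IH]; rewrite ?expr0 ?mul1r // exprS -mulrA; apply: PX.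
elim/big_rec: _ => [|i q _ Pq]; first by rewrite mul1r.
by rewrite -mulrA; apply: PXn.
Qed.

Lemma mcoeff_XM (R : comNzRingType) (m : nat) i (p : {mpoly R[m]}) (mm : multinom m) :
  ('X_i * p)@_mm = if (0 < mm i)%N then p@_(mm - U_(i))%MM else 0.
Proof.
rewrite mulrC; case: ifP => h.
  have {1}-> : mm = (U_(i) + (mm - U_(i)))%MM.
    apply/mnmP => j; rewrite mnmDE mnmBE mnm1E.
    by case: eqP h => [<-|]; rewrite ?add0n ?subn0 // => h; rewrite subnKC.
  by rewrite mcoeffMX.
rewrite mcoeffM big1 // => kk /eqP mmE.
rewrite mcoeffX; case: eqP => [e|]; rewrite ?mulr0 //.
have /mnmP/(_ i) := mmE; rewrite mnmDE -e mnm1E eqxx addn1 => hi.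
by rewrite hi in h.
Qed.

Lemma mcoeff_XM0 (R : comNzRingType) (m : nat) i (p : {mpoly R[m]}) : ('X_i * p)@_0%MM = 0.
Proof. by rewrite mcoeff_XM mnm0E. Qed.

Lemma mcoeff_XMU (R : comNzRingType) (m : nat) i j (p : {mpoly R[m]}) :
  ('X_i * p)@_U_(j)%MM = if i == j then p@_0%MM else 0.
Proof.
rewrite mcoeff_XM mnm1E eq_sym; case: eqP => //= ->.
by congr mcoeff; apply/mnmP => l; rewrite mnmBE mnm0E subnn.
Qed.

Lemma mmap_piece (k : fieldType) (m : nat) (R : comNzRingType) (P : nat -> R -> Prop)
    (c : {rmorphism k -> R}) (h : 'I_m -> R) :
  (forall d, P d 0) -> (forall d x y, P d x -> P d y -> P d (x + y)) ->
  (forall i j x y, P i x -> P j y -> P (i + j)%N (x * y)) ->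
  (forall a, P 0%N (c a)) -> (forall i, P 1%N (h i)) ->
  forall d f, homog d f -> P d (mmap c h f).
Proof.
move=> P0 PD PM Pc Ph d f /dhomogP hf; rewrite /mmap big_seq.
elim/big_ind: _ => [||mm /hf dE]; [exact: P0 | by move=> x y; exact: PD |].
have {dE} <- : mdeg mm = d := dE.
rewrite -[X in P X _]add0n; apply: (PM) => //; rewrite /mmap1 (mdegE mm).
have P1 : P 0%N 1 by have := Pc 1; rewrite rmorph1.
elim/big_ind2: _ => // [x x' y y'|i _]; first exact: PM.
elim: (mm i) => [|e IH]; first by rewrite expr0.
by rewrite exprS -add1n; apply: (PM).
Qed.

Section StructureB.
Variables (n : nat) (k : fieldType).
Local Notation S := {mpoly k[n]}.
Local Notation S2 := {mpoly k[n + n]}.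
Local Notation B := (B_ring n k).
Local Notation pi := (@B_pi n k).
Local Notation const := (@B_const n k).

Lemma B_pi_eq0 g : (pi g == 0) = (g \in @B_ideal n k).
Proof. by rewrite -(rmorph0 pi) -Quotient.idealrBE subr0. Qed.

Lemma B_pi_repr (b : B) : pi (repr b) = b.
Proof. exact: reprK. Qed.

Definition var (i : 'I_(n + n)) : B := pi 'X_i.
Local Notation p_ i := (var (lshift n i)).
Local Notation q_ i := (var (rshift n i)).

Lemma B_ind (P : B -> Prop) :
  (forall c, P (const c)) -> (forall x y, P x -> P y -> P (x + y)) ->
  (forall i x, P x -> P (var i * x)) -> forall x, P x.
Proof.
move=> PC PD PX x; rewrite -(B_pi_repr x).
elim/mpoly_ind_var: (repr x) => [c|p q Pp Pq|i p Pp]; first exact: PC.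
  by rewrite rmorphD; exact: PD.
by rewrite rmorphM; exact: PX.
Qed.

Lemma pq_neq i j : i != j -> p_ i * q_ j = 0.
Proof.
move=> ij; rewrite -rmorphM; apply/eqP; rewrite B_pi_eq0 -[X in X \in _]mul1r.
by apply: mem_ideal_gen; exists i, j; split=> //; left.
Qed.

Lemma pq_eq i j : p_ i * q_ i = p_ j * q_ j.
Proof.
have [->//|ij] := eqVneq i j.
rewrite -!rmorphM; apply/eqP; rewrite -subr_eq0 -rmorphB B_pi_eq0 -[X in X \in _]mul1r.
by apply: mem_ideal_gen; exists i, j; split=> //; right.
Qed.

(** Functions on B are defined through representatives, and this makes them
    independent of the representative. *)
Lemma B_descent (V : zmodType) (phi : {additive S2 -> V}) :
  (forall a g, B_rels g -> phi (a * g) = 0) ->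
  forall g, phi (repr (pi g)) = phi g.
Proof.
move=> h g; apply/eqP; rewrite -subr_eq0 -raddfB; apply/eqP.
have : repr (pi g) - g \in @B_ideal n k by rewrite -B_pi_eq0 rmorphB B_pi_repr subrr.
move=> /ideal_genP[s sG ->]; rewrite raddf_sum big_seq big1 // => z /sG; exact: h.
Qed.

(** Restriction to the p-axes for [side = true], to the q-axes for [side =
    false]. *)
Definition restr_var (side : bool) (i : 'I_(n + n)) : S :=
  match split i with inl j => if side then 'X_j else 0
                   | inr j => if side then 0 else 'X_j end.
Fact restr_key : unit. Proof. exact: tt. Qed.
Definition restr_mpoly : bool -> {rmorphism S2 -> S} := locked_with restr_key
  (fun side => mmap (@mpolyC n k) (restr_var side) : {rmorphism S2 -> S}).

Lemma restr_varl side i : restr_var side (lshift n i) = if side then 'X_i else 0.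
Proof. by rewrite /restr_var -[lshift n i]/(unsplit (inl i)) unsplitK. Qed.
Lemma restr_varr side i : restr_var side (rshift n i) = if side then 0 else 'X_i.
Proof. by rewrite /restr_var -[rshift n i]/(unsplit (inr i)) unsplitK. Qed.

Lemma restr_mpolyX side i : restr_mpoly side 'X_i = restr_var side i.
Proof. by rewrite /restr_mpoly unlock /= mmapX mmap1U. Qed.

Lemma restr_mpolyC side c : restr_mpoly side (mpolyC _ c) = (mpolyC _ c).
Proof. by rewrite /restr_mpoly unlock /= mmapC. Qed.

Definition restr : bool -> B -> S :=
  locked_with restr_key (fun side b => restr_mpoly side (repr b)).

Lemma restr_pi side g : restr side (pi g) = restr_mpoly side g.
Proof.
rewrite /restr unlock.
apply: (B_descent (phi := restr_mpoly side)) => a h [i [j [_ hE]]].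
change (restr_mpoly side (a * h) = 0); rewrite rmorphM; case: hE => ->; rewrite ?rmorphB !rmorphM !restr_mpolyX
  !restr_varl !restr_varr; by case: side; rewrite ?(mulr0, mul0r) ?subrr ?mulr0.
Qed.

Lemma restr_is_zmod_morphism side : zmod_morphism (restr side).
Proof.
move=> x y; rewrite -(B_pi_repr x) -(B_pi_repr y) -rmorphB.
by rewrite !restr_pi rmorphB.
Qed.
HB.instance Definition _ side :=
  GRing.isZmodMorphism.Build B S (restr side) (restr_is_zmod_morphism side).

Lemma restr_is_monoid_morphism side : monoid_morphism (restr side).
Proof.
split; first by rewrite -(rmorph1 pi) restr_pi rmorph1.
move=> x y; rewrite -(B_pi_repr x) -(B_pi_repr y) -rmorphM.
by rewrite !restr_pi rmorphM.
Qed.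
HB.instance Definition _ side :=
  GRing.isMonoidMorphism.Build B S (restr side) (restr_is_monoid_morphism side).

Lemma restrD side : {morph restr side : x y / x + y}. Proof. exact: raddfD. Qed.
Lemma restrB side : {morph restr side : x y / x - y}. Proof. exact: raddfB. Qed.
Lemma restrM side : {morph restr side : x y / x * y}. Proof. exact: rmorphM. Qed.
Lemma restr0 side : restr side 0 = 0. Proof. exact: raddf0. Qed.
Lemma restr1 side : restr side 1 = 1. Proof. exact: rmorph1. Qed.

Lemma restr_var_B side i : restr side (var i) = restr_var side i.
Proof. by rewrite restr_pi restr_mpolyX. Qed.

Lemma restr_const side c : restr side (const c) = (mpolyC _ c).
Proof. by rewrite restr_pi restr_mpolyC. Qed.

Lemma restr_coef0 side b : (restr side b)@_0%MM = (restr true b)@_0%MM.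
Proof.
elim/B_ind: b => [c|x y hx hy|i x _]; first by rewrite !restr_const.
  by rewrite !restrD !mcoeffD hx hy.
rewrite !restrM !restr_var_B; case: (split_ordP i) => j ->.
  by rewrite !restr_varl; case: side; rewrite ?mcoeff_XM0 ?mul0r ?mcoeff0.
by rewrite !restr_varr; case: side; rewrite ?mcoeff_XM0 ?mul0r ?mcoeff0.
Qed.

Definition aug0 (b : B) : k := (restr true b)@_0%MM.

(** The products p_i q_i have a common class w in B, hence the sum of their
    coefficients. *)
Definition wcoef_mpoly (g : S2) : k := \sum_i g@_(U_(lshift n i) + U_(rshift n i))%MM.

Lemma wcoef_mpoly_is_zmod_morphism : zmod_morphism wcoef_mpoly.
Proof. by move=> x y; rewrite /wcoef_mpoly -sumrB; apply: eq_bigr => i _; rewrite mcoeffB. Qed.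
HB.instance Definition _ :=
  GRing.isZmodMorphism.Build S2 k wcoef_mpoly wcoef_mpoly_is_zmod_morphism.

Lemma wcoef_mpolyXl i g : wcoef_mpoly ('X_(lshift n i) * g) = g@_U_(rshift n i)%MM.
Proof.
rewrite /wcoef_mpoly (bigD1 i) //= big1 ?addr0 => [|j ji]; rewrite mcoeff_XM mnmDE !mnm1E.
  rewrite eqxx /=; congr mcoeff; apply/mnmP => l; rewrite mnmBE mnmDE; lia.
by rewrite (inj_eq (@lshift_inj _ _)) (negbTE ji) eq_rlshift.
Qed.

Lemma wcoef_mpolyXr i g : wcoef_mpoly ('X_(rshift n i) * g) = g@_U_(lshift n i)%MM.
Proof.
rewrite /wcoef_mpoly (bigD1 i) //= big1 ?addr0 => [|j ji]; rewrite mcoeff_XM mnmDE !mnm1E.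
  rewrite eqxx addn1 /=; congr mcoeff; apply/mnmP => l; rewrite mnmBE mnmDE; lia.
by rewrite (inj_eq (@rshift_inj _ _)) (negbTE ji) eq_lrshift.
Qed.

Definition wcoef : B -> k := locked_with restr_key (fun b => wcoef_mpoly (repr b)).

Lemma wcoef_pi g : wcoef (pi g) = wcoef_mpoly g.
Proof.
rewrite /wcoef unlock.
apply: (B_descent (phi := wcoef_mpoly)) => a h [i [j [ij hE]]].
rewrite mulrC; case: hE => ->; rewrite ?mulrBl ?raddfB /= -!mulrA !wcoef_mpolyXl
  !mcoeff_XMU !(inj_eq (@rshift_inj _ _)) ?eqxx ?subrr //.
by rewrite eq_sym (negbTE ij).
Qed.

Lemma wcoef_is_zmod_morphism : zmod_morphism wcoef.
Proof.
move=> x y; rewrite -(B_pi_repr x) -(B_pi_repr y) -rmorphB.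
by rewrite !wcoef_pi raddfB.
Qed.
HB.instance Definition _ :=
  GRing.isZmodMorphism.Build B k wcoef wcoef_is_zmod_morphism.

Lemma restr_mpoly_coef0 side g : (restr_mpoly side g)@_0%MM = g@_0%MM.
Proof.
elim/mpoly_ind_var: g => [c|x y hx hy|j x _].
- by rewrite restr_mpolyC !mcoeffC !eqxx.
- by rewrite rmorphD !mcoeffD hx hy.
- rewrite rmorphM restr_mpolyX mcoeff_XM0; case: (split_ordP j) => l ->.
    by rewrite restr_varl; case: side; rewrite ?mcoeff_XM0 ?mul0r ?mcoeff0.
  by rewrite restr_varr; case: side; rewrite ?mcoeff_XM0 ?mul0r ?mcoeff0.
Qed.

Lemma restr_mpoly_coef1 side i g : (restr_mpoly side g)@_U_(i) =
  g@_U_(if side then lshift n i else rshift n i).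
Proof.
elim/mpoly_ind_var: g => [c|x y hx hy|j x _].
- by rewrite restr_mpolyC !mcoeffC !mnm1_eq0.
- by rewrite rmorphD !mcoeffD hx hy.
- rewrite rmorphM restr_mpolyX mcoeff_XMU; case: (split_ordP j) => l ->;
  rewrite ?restr_varl ?restr_varr; case: side; rewrite ?mcoeff_XMU ?mul0r ?mcoeff0
   ?restr_mpoly_coef0 ?(inj_eq (@lshift_inj _ _)) ?(inj_eq (@rshift_inj _ _))
   ?eq_lrshift ?eq_rlshift //.
Qed.

Lemma wcoefD : {morph wcoef : x y / x + y}. Proof. exact: raddfD. Qed.
Lemma wcoef0 : wcoef 0 = 0. Proof. exact: raddf0. Qed.

Lemma wcoef_p i b : wcoef (p_ i * b) = (restr false b)@_U_(i)%MM.
Proof.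
by rewrite -(B_pi_repr b) -rmorphM wcoef_pi wcoef_mpolyXl restr_pi restr_mpoly_coef1.
Qed.

Lemma wcoef_q i b : wcoef (q_ i * b) = (restr true b)@_U_(i)%MM.
Proof.
by rewrite -(B_pi_repr b) -rmorphM wcoef_pi wcoef_mpolyXr restr_pi restr_mpoly_coef1.
Qed.

Lemma wcoef_const c : wcoef (const c) = 0.
Proof.
rewrite wcoef_pi /wcoef_mpoly big1 // => i _; rewrite mcoeffC.
case: eqP => [/mnmP/(_ (lshift n i))|]; rewrite ?mulr0 //.
by rewrite mnmDE mnm1E eqxx mnm0E.
Qed.

Lemma coef1M (f g : S) i :
  (f * g)@_U_(i) = f@_0%MM * g@_U_(i) + f@_U_(i) * g@_0%MM.
Proof.
elim/mpoly_ind_var: f => [c|x y hx hy|j x _].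
- by rewrite !mcoeffCM !mcoeffC mnm1_eq0 eqxx mulr1 mulr0 mul0r addr0.
- rewrite mulrDl !mcoeffD hx hy; ring.
- rewrite -mulrA !mcoeff_XMU mcoeff_XM0 mul0r add0r.
  case: eqP; rewrite ?mul0r // => _; exact: rmorphM.
Qed.

Lemma aug0_var j x : aug0 (var j * x) = 0.
Proof.
rewrite /aug0 restrM restr_var_B; case: (split_ordP j) => l ->.
  by rewrite restr_varl mcoeff_XM0.
by rewrite restr_varr mul0r mcoeff0.
Qed.

(** Besides w times a constant, only the products of a linear term in p with a
    linear term in q of the same index contribute to w. *)
Lemma wcoefM b c : wcoef (b * c) = aug0 b * wcoef c + wcoef b * aug0 c +
  \sum_i ((restr true b)@_U_(i) * (restr false c)@_U_(i) +
          (restr false b)@_U_(i) * (restr true c)@_U_(i)).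
Proof.
elim/B_ind: b => [a|x y hx hy|j x _].
- rewrite wcoef_const mul0r addr0 big1 => [|i _]; last first.
    by rewrite !restr_const !mcoeffC mnm1_eq0 !mulr0 !mul0r addr0.
  rewrite addr0 /aug0 restr_const mcoeffC eqxx mulr1 -(B_pi_repr c).
  rewrite (_ : const a = pi (mpolyC _ a)) // -rmorphM !wcoef_pi.
  by rewrite /wcoef_mpoly mulr_sumr; apply: eq_bigr => i _; rewrite mcoeffCM.
- pose G u := \sum_i ((restr true u)@_U_(i) * (restr false c)@_U_(i) +
          (restr false u)@_U_(i) * (restr true c)@_U_(i)).
  have GD : G (x + y) = G x + G y.
    by rewrite /G -big_split; apply: eq_bigr => i _; rewrite /= !restrD !mcoeffD; ring.
  rewrite -/(G (x + y)) GD mulrDl !wcoefD hx hy /aug0 restrD mcoeffD -/(G x) -/(G y).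
  by ring.
rewrite aug0_var mul0r add0r -mulrA.
have sumE side (l : 'I_n) (F : 'I_n -> k) :
    \sum_i (('X_l * restr side x : S)@_U_(i) * F i) = aug0 x * F l.
  rewrite (bigD1 l) //= big1 ?addr0 ?mcoeff_XMU ?eqxx ?restr_coef0 // => i il.
  by rewrite mcoeff_XMU eq_sym (negbTE il) mul0r.
case: (split_ordP j) => l ->.
- rewrite !wcoef_p restrM coef1M restr_coef0 -/(aug0 x) -/(aug0 c) addrC; congr (_ + _).
    by rewrite /aug0 (restr_coef0 false).
  rewrite -[LHS](sumE true l (fun i => (restr false c)@_U_(i))); apply: eq_bigr => i _.
  by rewrite !restrM !restr_var_B !restr_varl mul0r mcoeff0 mul0r addr0.
- rewrite !wcoef_q restrM coef1M -/(aug0 x) -/(aug0 c) addrC; congr (_ + _).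
  rewrite -[LHS](sumE false l (fun i => (restr true c)@_U_(i))); apply: eq_bigr => i _.
  by rewrite !restrM !restr_var_B !restr_varr mul0r mcoeff0 mul0r add0r.
Qed.

Section WithIndex.
Hypothesis n_gt1 : (1 < n)%N.
(** Any index would do, by [pq_eq]. *)
Definition i0 : 'I_n := Ordinal (ltnW n_gt1).
Definition wB : B := p_ i0 * q_ i0.

Lemma pqE i j : p_ i * q_ j = if i == j then wB else 0.
Proof. by case: eqP => [->|/eqP]; [exact: pq_eq | exact: pq_neq]. Qed.

Lemma other_index (i : 'I_n) : exists j, j != i.
Proof.
have [->|] := eqVneq i i0; last by rewrite eq_sym; exists i0.
by exists (Ordinal n_gt1).
Qed.

(** Write w = p_l q_l for an index l other than that of the variable: then the
    variable annihilates one of the factors. Hence the need for two indices. *)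
Lemma var_w i : var i * wB = 0.
Proof.
case: (split_ordP i) => j ->; have [l lj] := other_index j.
  by rewrite /wB (pq_eq i0 l) mulrCA pqE eq_sym (negbTE lj) mulr0.
by rewrite /wB (pq_eq i0 l) mulrC -mulrA [q_ l * _]mulrC mulrA pqE (negbTE lj) mul0r.
Qed.

Definition emb : bool -> {rmorphism S -> B} := locked_with restr_key
  (fun side => mmap const (fun i => if side then p_ i else q_ i) : {rmorphism S -> B}).

Lemma embC side c : emb side (mpolyC _ c) = const c.
Proof. by rewrite /emb unlock; exact: mmapC. Qed.
Lemma embX side i : emb side 'X_i = if side then p_ i else q_ i.
Proof. by rewrite /emb unlock /= mmapX mmap1U. Qed.

Lemma emb_mul side i f :
  (if side then q_ i else p_ i) * emb side f =
  const f@_0%MM * (if side then q_ i else p_ i) + const f@_U_(i) * wB.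
Proof.
elim/mpoly_ind_var: f => [c|x y hx hy|j x _].
- by rewrite embC !mcoeffC eqxx mnm1_eq0 mulr1 mulr0 rmorph0 mul0r addr0 mulrC.
- by rewrite rmorphD !mcoeffD !rmorphD mulrDr hx hy; ring.
rewrite rmorphM embX mcoeff_XM0 mcoeff_XMU rmorph0 mul0r add0r mulrA.
have -> : (if side then q_ i else p_ i) * (if side then p_ j else q_ j) =
    if j == i then wB else 0.
  case: side; last by rewrite pqE eq_sym.
  by rewrite mulrC pqE.
case: eqP => _; rewrite ?rmorph0 ?mul0r //.
elim/mpoly_ind_var: x => [c|x y hx hy|l x _].
- by rewrite embC mcoeffC eqxx mulr1 mulrC.
- by rewrite rmorphD mcoeffD rmorphD mulrDr hx hy mulrDl.
rewrite rmorphM embX mcoeff_XM0 rmorph0 mul0r mulrA.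
by case: side; rewrite [wB * _]mulrC var_w mul0r.
Qed.

(** The monomials in the p's, the monomials in the q's and w form a basis of
    B; the two families share the monomial 1, which is counted twice by the
    restrictions. *)
Lemma B_normal_form b : b = emb true (restr true b) + emb false (restr false b)
  - const (aug0 b) + const (wcoef b) * wB.
Proof.
elim/B_ind: b => [c|x y hx hy|j x hx].
- rewrite !restr_const !embC /aug0 restr_const mcoeffC eqxx mulr1 wcoef_const rmorph0.
  by rewrite mul0r addr0 addrK.
- rewrite !restrD !rmorphD wcoefD /aug0 restrD mcoeffD !rmorphD mulrDl.
  by rewrite {1}hx {1}hy /aug0; ring.
rewrite aug0_var rmorph0 subr0.
rewrite {1}hx mulrDr mulrA (mulrC _ (const _)) -mulrA var_w mulr0 addr0.
rewrite !restrM !restr_var_B; case: (split_ordP j) => l -> {hx}.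
- rewrite !restr_varl mul0r rmorph0 addr0 rmorphM embX wcoef_p mulrBr mulrDr.
  rewrite (emb_mul false) restr_coef0 -/(aug0 x).
  by rewrite [p_ l * const _]mulrC [X in _ + X - _]addrC addrA addrK.
- rewrite !restr_varr mul0r rmorph0 add0r rmorphM embX wcoef_q mulrBr mulrDr.
  rewrite (emb_mul true) -/(aug0 x).
  by rewrite [q_ l * const _]mulrC; ring.
Qed.

Lemma restr_emb side f : restr side (emb side f) = f.
Proof.
elim/mpoly_ind_var: f => [c|x y hx hy|j x hx].
- by rewrite embC restr_const.
- by rewrite rmorphD restrD hx hy.
rewrite rmorphM restrM hx embX; congr (_ * _).
by case: side {hx}; rewrite restr_var_B ?restr_varl ?restr_varr.
Qed.

Lemma restr_embN side f : restr (~~ side) (emb side f) = mpolyC _ f@_0%MM.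
Proof.
elim/mpoly_ind_var: f => [c|x y hx hy|j x _].
- by rewrite embC restr_const mcoeffC eqxx mulr1.
- by rewrite rmorphD restrD hx hy mcoeffD rmorphD.
rewrite rmorphM restrM embX mcoeff_XM0 mpolyC0.
by case: side; rewrite restr_var_B ?restr_varl ?restr_varr mul0r.
Qed.

Lemma restr_w side : restr side wB = 0.
Proof. by rewrite /wB restrM !restr_var_B restr_varl restr_varr; case: side; rewrite ?mulr0 ?mul0r. Qed.

Lemma wcoef_w : wcoef wB = 1.
Proof. by rewrite /wB wcoef_p restr_var_B restr_varr mcoeffXU eqxx. Qed.

Local Notation piece := (@B_piece n k).

Lemma B_piece_add d x y : piece d x -> piece d y -> piece d (x + y).
Proof.
move=> [g hg <-] [h hh <-]; exists (g + h); last by rewrite rmorphD.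
by apply: rpredD.
Qed.

Lemma B_piece_0 d : piece d 0.
Proof. by exists 0; rewrite ?rmorph0 //; exact: rpred0. Qed.

Lemma B_piece_opp d x : piece d x -> piece d (- x).
Proof.
move=> [g hg <-]; exists (- g); last by rewrite rmorphN.
by rewrite /= dhomogN.
Qed.

Lemma B_piece_var i : piece 1%N (var i).
Proof.
exists 'X_i => //=; rewrite dhomogX; apply/eqP; exact: mdeg1.
Qed.

Lemma B_piece_const c : piece 0%N (const c).
Proof. by rewrite B_piece0; exists c. Qed.

Lemma B_piece_w : piece 2%N wB.
Proof. by apply: (@B_pieceM n k 1 1); exact: B_piece_var. Qed.

Lemma emb_piece side d f : homog d f -> piece d (emb side f).
Proof.
rewrite /emb unlock; apply: (mmap_piece (P := piece)).
- exact: B_piece_0.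
- exact: B_piece_add.
- exact: B_pieceM.
- exact: B_piece_const.
- by case: side => i; exact: B_piece_var.
Qed.

Lemma restr_piece side d b : piece d b -> homog d (restr side b).
Proof.
move=> [g hg <-]; rewrite restr_pi /restr_mpoly unlock.
apply: (mmap_piece (P := fun d (f : S) => homog d f)) hg => //.
- by move=> e; exact: rpred0.
- by move=> e x y; exact: rpredD.
- by move=> i j x y; exact: dhomogM.
- move=> a; apply/dhomogP => m; rewrite msuppC; case: ifP => // _.
  by rewrite inE => /eqP ->; exact: mdeg0.
- move=> i; rewrite /restr_var; case: (split i) => j; case: side;
    try exact: rpred0; by rewrite dhomogX; apply/eqP; exact: mdeg1.
Qed.

Lemma homog_coef d (f : S) m : homog d f -> mdeg m != d -> f@_m = 0.
Proof. exact: dhomog_nemf_coeff. Qed.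

Lemma wcoef_piece d b : piece d b -> d != 2%N -> wcoef b = 0.
Proof.
move=> [g hg <-] d2; rewrite wcoef_pi /wcoef_mpoly big1 // => i _.
apply: (dhomog_nemf_coeff hg); apply: contra d2 => /eqP <-; apply/eqP.
by rewrite [LHS]mdegD !mdeg1.
Qed.

End WithIndex.
End StructureB.

(** * Exactness of the Koszul complex of B *)

Section Bihomogeneous.
Variables (I : finType) (rk : I -> nat) (A : comNzRingType) (L : lmodType A).
Variables (P : nat -> L -> Prop).

(** The tensor product of the piece of degree e with the forms of degree b. *)
Definition bihom (b e : nat) (z : {ffun {set I} -> L}) :=
  forall S : {set I}, if #|S| == b then P e (z S) else z S = 0.

Hypothesis P_0 : forall d, P d 0.
Hypothesis P_B : forall d x y, P d x -> P d y -> P d (x - y).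

Lemma bihom_N_closed d x : P d x -> P d (- x).
Proof. by move=> h; rewrite -sub0r; apply: P_B. Qed.

Lemma bihom_D_closed d x y : P d x -> P d y -> P d (x + y).
Proof. by move=> hx hy; rewrite -[y]opprK; apply: P_B => //; apply: bihom_N_closed. Qed.

Lemma bihom_sign_closed d i S x : P d x -> P d (ext_sign rk A i S *: x).
Proof.
by case: (ext_sign_or rk A i S) => ->; rewrite ?scale1r // scaleN1r;
  exact: bihom_N_closed.
Qed.

Lemma bihom0 b e : bihom b e 0.
Proof. by move=> S; rewrite ffunE; case: ifP. Qed.

Lemma bihomB b e x y : bihom b e x -> bihom b e y -> bihom b e (x - y).
Proof.
move=> hx hy S; have := hx S; have := hy S; rewrite !ffunE.
by case: ifP => _; [move=> *; exact: P_B | move=> -> ->; rewrite subr0].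
Qed.

Lemma bihomD b e x y : bihom b e x -> bihom b e y -> bihom b e (x + y).
Proof.
move=> hx hy; rewrite -[y]opprK; apply: bihomB => //.
by rewrite -sub0r; apply: bihomB => //; exact: bihom0.
Qed.

Lemma bihom_sum b e (J : Type) (r : seq J) (Q : pred J) F :
  (forall j, Q j -> bihom b e (F j)) -> bihom b e (\sum_(j <- r | Q j) F j).
Proof.
by move=> h; elim/big_ind: _ => //; [exact: bihom0 | move=> x y; exact: bihomD].
Qed.

Lemma wedge_bihom i b e z : bihom b e z -> bihom b.+1 e (wedge rk i z).
Proof.
move=> hz S; rewrite ffunE; case: (boolP (i \in S)) => iS; last by case: ifP.
have := hz (S :\ i); rewrite (cardsD1 i S) iS add1n eqSS.
by case: ifP => _ h; [exact: bihom_sign_closed | rewrite h scaler0].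
Qed.

Variable a : I -> A.
Hypothesis P_a : forall i d x, P d x -> P d.+1 (a i *: x).

Lemma koszul_bihom b e z : bihom b.+1 e z -> bihom b e.+1 (koszul rk a z).
Proof.
move=> hz S; rewrite koszulE; case: ifP => Sb.
  elim/big_ind: _ => // [x y|i iS]; first exact: bihom_D_closed.
  apply: P_a; apply: bihom_sign_closed.
  by have := hz (i |: S); rewrite cardsU1 iS add1n eqSS Sb.
rewrite big1 // => i iS.
by have := hz (i |: S); rewrite cardsU1 iS add1n eqSS Sb => ->; rewrite !scaler0.
Qed.

Lemma cokoszul_bihom b e z : bihom b e z -> bihom b.+1 e.+1 (cokoszul rk a z).
Proof.
move=> hz S; rewrite cokoszulE; case: ifP => Sb.
  elim/big_ind: _ => // [x y|i iS]; first exact: bihom_D_closed.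
  apply: P_a; apply: bihom_sign_closed.
  by have := hz (S :\ i); move: Sb; rewrite (cardsD1 i S) iS add1n eqSS => ->.
rewrite big1 // => i iS.
by have := hz (S :\ i); move: Sb; rewrite (cardsD1 i S) iS add1n eqSS => -> ->; rewrite !scaler0.
Qed.
End Bihomogeneous.

Section KoszulMorphism.
Variables (I : finType) (rk : I -> nat).

Lemma koszul_rmorph (A A' : comNzRingType) (f : {rmorphism A -> A'}) (a : I -> A)
    (z : {ffun {set I} -> A^o}) :
  [ffun S : {set I} => f (koszul rk a z S)] =
  koszul rk (fun i => f (a i)) ([ffun S => f (z S)] : {ffun {set I} -> A'^o}).
Proof.
apply/ffunP => S; rewrite ffunE koszulE rmorph_sum (@koszulE I rk A' A'^o); apply: eq_bigr => i _.
rewrite ffunE /GRing.scale /= !rmorphM; congr (_ * (_ * _)).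
by rewrite /ext_sign rmorph_sign.
Qed.

Lemma koszul_addl (A : comNzRingType) (L : lmodType A) (a b : I -> A)
    (z : {ffun {set I} -> L}) :
  koszul rk (fun i => a i + b i) z = koszul rk a z + koszul rk b z.
Proof. by rewrite /koszul -big_split; apply: eq_bigr => i _; rewrite scalerDl. Qed.
End KoszulMorphism.

Section MonomialDivision.
Variables (n : nat) (k : fieldType).
Local Notation S := {mpoly k[n]}.

Fact mdiv_key : unit. Proof. exact: tt. Qed.
(** The left inverse of multiplication by 'X_j that kills the monomials
    without 'X_j. *)
Definition mdiv : 'I_n -> S -> S := locked_with mdiv_key (fun j g =>
  \sum_(m : bmultinom n (msize g)) g@_(m + U_(j))%MM *: mpolyX k m).

Lemma mcoeff_mdiv j g m : (mdiv j g)@_m = g@_(m + U_(j))%MM.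
Proof.
rewrite /mdiv unlock; have [h|h] := ltnP (mdeg m) (msize g).
  by rewrite (mcoeff_mpoly (fun m => g@_(m + U_(j))%MM)).
rewrite [RHS]memN_msupp_eq0; last first.
  apply: contraL h => /msize_mdeg_lt; rewrite mdegD mdeg1 -ltnNge => h.
  by apply: leq_ltn_trans h; rewrite leq_addr.
rewrite raddf_sum big1 //= => i _; rewrite mcoeffZ mcoeffX.
case: eqP => [e|]; rewrite ?mulr0 //.
by have := bmdeg i; rewrite e ltnNge h.
Qed.

Lemma mdiv_is_zmod_morphism j : zmod_morphism (mdiv j).
Proof. by move=> x y; apply/mpolyP => m; rewrite mcoeffB !mcoeff_mdiv mcoeffB. Qed.
HB.instance Definition _ j :=
  GRing.isZmodMorphism.Build S S (mdiv j) (mdiv_is_zmod_morphism j).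

Lemma mdivXK j g : mdiv j ('X_j * g) = g.
Proof.
apply/mpolyP => m; rewrite mcoeff_mdiv mcoeff_XM mnmDE mnm1E eqxx addn1 /=.
by congr mcoeff; apply: addmK.
Qed.

Lemma mdivX_comm j l g : j != l -> mdiv j ('X_l * g) = 'X_l * mdiv j g.
Proof.
move=> jl; apply/mpolyP => m; rewrite mcoeff_mdiv !mcoeff_XM mnmDE mnm1E.
rewrite (negbTE jl) addn0; case: ifP => // ml; rewrite mcoeff_mdiv; congr mcoeff.
apply/mnmP => i; rewrite !(mnmDE, mnmBE) !mnm1E.
by case: (l =P i) ml => [<-|_]; case: (j =P _) jl => //=; lia.
Qed.

Lemma mdiv_comm j l g : mdiv j (mdiv l g) = mdiv l (mdiv j g).
Proof.
apply/mpolyP => m; rewrite !mcoeff_mdiv; congr mcoeff.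
by apply/mnmP => i; rewrite !mnmDE addnAC.
Qed.

Lemma mdiv_homog j d g : homog d.+1 g -> homog d (mdiv j g).
Proof.
move=> /dhomogP hg; apply/dhomogP => m; rewrite mcoeff_msupp mcoeff_mdiv -mcoeff_msupp.
by move=> /hg /=; rewrite mdegD mdeg1 addn1 => -[].
Qed.

Lemma mdiv_const g : (forall j, mdiv j g = 0) -> g = mpolyC _ g@_0%MM.
Proof.
move=> hg; apply/mpolyP => m; rewrite mcoeffC; have [<-|m0] := eqVneq 0%MM m.
  by rewrite mulr1.
rewrite mulr0; have [j mj] : exists j, (0 < m j)%N.
  apply/existsP; apply: contraR m0 => /existsPn h; apply/eqP/mnmP => i.
  by rewrite mnm0E; have := h i; rewrite -eqn0Ngt => /eqP.
have <- : ((m - U_(j)) + U_(j))%MM = m.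
  by apply/mnmP => i; rewrite mnmDE mnmBE mnm1E; case: eqP mj => [->|]; lia.
by rewrite -mcoeff_mdiv hg mcoeff0.
Qed.
End MonomialDivision.

Section KoszulB.
Variables (n : nat) (k : fieldType).
Local Notation S := {mpoly k[n]}.
Local Notation B := (B_ring n k).
Local Notation II := 'I_(n + n).
Local Notation const := (@B_const n k).
Local Notation var := (@var n k).
Local Notation p_ i := (var (lshift n i)).
Local Notation q_ i := (var (rshift n i)).
Local Notation piece := (@B_piece n k : nat -> B^o -> Prop).
Local Notation homogS := (fun d (f : S^o) => is_true (homog d (f : S))).

(** With p_i and q_i consecutive, contracting by both never produces a sign. *)
Definition prank (i : II) : nat :=
  match split i with inl j => j.*2 | inr j => j.*2.+1 end.

Lemma splitl (i : 'I_n) : split (lshift n i) = inl i.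
Proof. by rewrite -[lshift n i]/(unsplit (inl i)) unsplitK. Qed.
Lemma splitr (i : 'I_n) : split (rshift n i) = inr i.
Proof. by rewrite -[rshift n i]/(unsplit (inr i)) unsplitK. Qed.

Lemma prankl i : prank (lshift n i) = i.*2.
Proof. by rewrite /prank splitl. Qed.
Lemma prankr i : prank (rshift n i) = i.*2.+1.
Proof. by rewrite /prank splitr. Qed.

Lemma prank_inj : injective prank.
Proof.
move=> i j; case: (split_ordP i) => i' ->; case: (split_ordP j) => j' ->;
  rewrite ?prankl ?prankr => h; try lia.
  by congr lshift; apply: val_inj => /=; lia.
by congr rshift; apply: val_inj => /=; lia.
Qed.

Local Notation kosB := (koszul prank var).
Local Notation kosS side := (koszul prank (@restr_var n k side)).

Definition side_index (side : bool) (j : 'I_n) : II :=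
  if side then lshift n j else rshift n j.

Definition mdiv_side (side : bool) (i : II) (g : S) : S :=
  match split i with inl j => if side then mdiv j g else 0
                   | inr j => if side then 0 else mdiv j g end.

Lemma mdiv_side_is_zmod_morphism side i : zmod_morphism (mdiv_side side i).
Proof.
move=> x y; rewrite /mdiv_side; case: (split i) => j; case: side;
  by rewrite ?raddfB ?subr0.
Qed.
HB.instance Definition _ side i :=
  GRing.isZmodMorphism.Build S^o S^o (mdiv_side side i) (mdiv_side_is_zmod_morphism side i).

(** The n variables of the other side act by 0, so this is a direct sum of
    Koszul complexes of n variables of a polynomial ring, which have no
    homology in positive coefficient degree. *)
Lemma koszul_mpoly_exact side b e (z : {ffun {set II} -> S^o}) :
    bihom homogS b e.+1 z -> kosS side z = 0 ->
  exists y : {ffun {set II} -> S^o}, bihom homogS b.+1 e y /\ z = kosS side y.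
Proof.
move=> hz z0.
pose dv i : {additive S^o -> S^o} := mdiv_side side i.
have homB d (x y : S^o) : homogS d x -> homogS d y -> homogS d (x - y).
  by exact: rpredB.
have hom0 d : homogS d 0 by exact: rpred0.
pose Pz (T : {set II}) (x : S^o) := if #|T| == b then homogS e.+1 x else x = 0.
pose Py (T : {set II}) (x : S^o) := if #|T| == b.+1 then homogS e x else x = 0.
have PB (d c : nat) (T : {set II}) (x y : S^o) :
   (if #|T| == d then homogS c x else x = 0) ->
   (if #|T| == d then homogS c y else y = 0) ->
   (if #|T| == d then homogS c (x - y) else x - y = 0).
  by case: ifP => _; [exact: homB | move=> -> ->; rewrite subr0].
have [||T||i T x iT|i T x iT|T|||i j x|||y [hy _ y2]] :=
  @koszul_exact_inj _ prank prank_inj S S^o (restr_var k side) dv _ Pz Py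
    _ _ _ _ _ _ [seq side_index side j | j <- enum 'I_n] z.
- move=> i j x ij; rewrite /dv /= /mdiv_side /restr_var /GRing.scale /=.
  move: ij; case: (split_ordP i) => i' ->; case: (split_ordP j) => j' -> ij;
  rewrite ?splitl ?splitr;
  case: {dv hz z0} side; rewrite ?mul0r ?mulr0 ?raddf0 // mdivX_comm //.
  by apply: contra ij => /eqP ->.
- exact: PB.
- by rewrite /Py; case: ifP.
- exact: PB.
- rewrite /Pz /Py (cardsD1 i T) iT add1n eqSS; case: ifP => _; last by move=> ->; rewrite raddf0.
  rewrite /dv /= /mdiv_side; case: (split i) => j; case: {dv z0} side => h;
    by [exact: mdiv_homog | exact: rpred0].
- rewrite /Pz /Py cardsU1 iT add1n eqSS; case: ifP => _; last by move=> ->; rewrite scaler0.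
  move=> h; rewrite /restr_var /GRing.scale /=; case: (split i) => j; case: {dv z0} side;
    rewrite ?mul0r; try exact: rpred0; rewrite -[e.+1]add1n; apply: dhomogM => //;
    by rewrite dhomogX; apply/eqP; exact: mdeg1.
- by rewrite /Pz; case: ifP.
- rewrite map_inj_uniq ?enum_uniq // => i j; rewrite /side_index.
  by case: {dv z0} side; [exact: lshift_inj | exact: rshift_inj].
- move=> i /mapP[j _ ->] x; rewrite /dv /= /mdiv_side /side_index /GRing.scale /= /restr_var.
  by case: {dv z0} side;
   rewrite ?splitl ?splitr mdivXK.
- rewrite /dv /= /mdiv_side; case: (split i) => i'; case: (split j) => j';
    case: {dv z0} side; rewrite ?raddf0 //; exact: mdiv_comm.
- exact: z0.
- exact: hz.
exists y; split=> //; apply/ffunP => T.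
apply/eqP; rewrite -subr_eq0; apply/eqP.
have hk : bihom homogS b e.+1 (kosS side y).
  apply: koszul_bihom hy => // i d x h.
  rewrite /restr_var /GRing.scale /=; case: (split i) => j; case: {dv z0 y2} side;
    rewrite ?mul0r; try exact: rpred0; rewrite -[d.+1]add1n; apply: dhomogM => //;
    by rewrite dhomogX; apply/eqP; exact: mdeg1.
have hzy : Pz T (z T - kosS side y T) by apply: PB; [exact: hz | exact: hk].
have divs0 j : mdiv j (z T - kosS side y T : S) = 0.
  have := y2 (side_index side j) T (map_f _ (mem_enum _ j)).
  rewrite /dv /= /mdiv_side /side_index; case: {dv z0 y2 hk hzy} side;
  by rewrite ?splitl ?splitr.
move: hzy; rewrite /Pz; case: ifP => // _ hd.
rewrite (mdiv_const divs0) (homog_coef hd) ?mpolyC0 //.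
by rewrite mdeg0.
Qed.

Lemma piece0 d : piece d 0. Proof. exact: B_piece_0. Qed.
Lemma pieceB d (x y : B^o) : piece d x -> piece d y -> piece d (x - y).
Proof. by move=> hx hy; apply: B_piece_add => //; apply: B_piece_opp. Qed.
Lemma piece_var i d (x : B^o) : piece d x -> piece d.+1 (var i *: x).
Proof. by move=> hx; rewrite -[d.+1]add1n; apply: B_pieceM => //; apply: B_piece_var. Qed.

Hypothesis n_gt1 : (1 < n)%N.
Local Notation wB := (wB k n_gt1).

Definition emb_ext (side : bool) (y : {ffun {set II} -> S^o}) : {ffun {set II} -> B^o} :=
  [ffun T : {set II} => @emb n k side (y T)].

Lemma emb_ext_bihom side b e y : bihom homogS b e y -> bihom piece b e (emb_ext side y).
Proof.
move=> hy T; rewrite ffunE; have := hy T; case: ifP => _; last by move=> ->; rewrite rmorph0.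
exact: emb_piece.
Qed.

Lemma restr_koszul side (z : {ffun {set II} -> B^o}) :
  [ffun T : {set II} => restr side (kosB z T)] =
  kosS side ([ffun T : {set II} => restr side (z T)] : {ffun {set II} -> S^o}).
Proof.
pose f : {rmorphism B -> S} := restr side.
apply: (etrans (koszul_rmorph prank f var z)).
by apply: eq_bigr => i _; rewrite /f /= restr_var_B.
Qed.

Lemma restr_koszulE side (z : {ffun {set II} -> B^o}) T :
  restr side (kosB z T) = kosS side ([ffun U : {set II} => restr side (z U)] : {ffun {set II} -> S^o}) T.
Proof. by rewrite -restr_koszul ffunE. Qed.

Lemma restr_koszul_emb side y T :
  restr side (kosB (emb_ext side y) T) = kosS side y T.
Proof.
rewrite restr_koszulE; suff -> : ([ffun U : {set II} => restr side (emb_ext side y U)] :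
  {ffun {set II} -> S^o}) = y by [].
by apply/ffunP => U; rewrite ffunE [emb_ext _ _ _]ffunE restr_emb.
Qed.

Lemma restr_koszul_embN side b e y T : bihom homogS b e.+1 y ->
  restr (~~ side) (kosB (emb_ext side y) T) = 0.
Proof.
move=> hy; rewrite restr_koszulE (_ : finfun _ = 0) ?raddf0 ?ffunE //.
apply/ffunP => U; rewrite [LHS]ffunE [emb_ext _ _ _]ffunE restr_embN ffunE.
have := hy U; case: ifP => _.
  by move=> h; rewrite (homog_coef h) ?mpolyC0 ?mdeg0.
by move=> ->; rewrite mcoeff0 mpolyC0.
Qed.

Definition const_ext (C : {set II} -> k) : {ffun {set II} -> B^o} :=
  [ffun T : {set II} => const (C T)].
Definition var_side (side : bool) (i : II) : B :=
  match split i with inl j => if side then p_ j else 0 | inr j => if side then 0 else q_ j end.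

Lemma var_sideD i : var i = var_side true i + var_side false i.
Proof.
rewrite /var_side; case: (split_ordP i) => j ->; rewrite ?splitl ?splitr;
  by rewrite ?addr0 ?add0r.
Qed.

Lemma B_const_sum (J : Type) (r : seq J) (Q : pred J) (F : J -> k) :
  const (\sum_(j <- r | Q j) F j) = \sum_(j <- r | Q j) const (F j).
Proof. exact: (rmorph_sum const). Qed.

(** The differential of B is the sum of its p-part and its q-part, and the
    p-part squares to 0. In the q-part of the p-part of a constant form, p_i
    q_j survives only for i = j, where it is w. Thus the boundaries of the
    forms so obtained are w times a contraction by sum_i p_i q_i. *)
Lemma koszul_koszul_const (C : {set II} -> k) (T : {set II}) :
  kosB (koszul prank (var_side true) (const_ext C)) T =
  const (\sum_(i | i \in empty_pairs T) C (pair_set i :|: T)) * wB.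
Proof.
have split_sum (F : II -> B) : \sum_i F i =
    \sum_(i < n) F (lshift n i) + \sum_(i < n) F (rshift n i) by exact: big_split_ord.
have sc0 (x : B^o) : (0 : B) *: x = 0 by exact: mul0r.
have vs00 i : var_side false (lshift n i) = 0 by rewrite /var_side splitl.
have vs01 i : var_side false (rshift n i) = q_ i by rewrite /var_side splitr.
have vs10 i : var_side true (lshift n i) = p_ i by rewrite /var_side splitl.
have vs11 i : var_side true (rshift n i) = 0 by rewrite /var_side splitr.
have -> : kosB (koszul prank (var_side true) (const_ext C)) =
   koszul prank (var_side false) (koszul prank (var_side true) (const_ext C)).
  transitivity (koszul prank (fun i => var_side true i + var_side false i)
     (koszul prank (var_side true) (const_ext C))).
    by rewrite /koszul; apply: eq_bigr => i _; rewrite var_sideD.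
  by rewrite koszul_addl koszul_koszul ?add0r //; exact: prank_inj.
rewrite B_const_sum mulr_suml [RHS]big_mkcond koszulE [LHS]big_mkcond split_sum.
rewrite [X in X + _]big1 => [|i _]; last by case: ifP => _ //; rewrite vs00 sc0.
rewrite add0r; apply: eq_bigr => i _; rewrite vs01 [i \in empty_pairs T]inE.
have [riT|riT] := boolP (rshift n i \in T); first by rewrite andbF.
rewrite andbT koszulE.
pose s := ext_sign prank B (rshift n i) T.
pose G j : B := if lshift n j \in T then 0 else p_ j * (ext_sign prank B (lshift n j) (rshift n i |: T) *
   const (C (lshift n j |: (rshift n i |: T)))).
transitivity (q_ i * (s * \sum_(j < n) G j)).
  congr (_ * (_ * _)); rewrite big_mkcond split_sum.
  rewrite [X in _ + X]big1 => [|j _]; last by case: ifP => _ //; rewrite vs11 sc0.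
  rewrite addr0; apply: eq_bigr => j _; rewrite in_setU1 eq_lrshift /= /G.
  by case: (lshift n j \in T) => //; rewrite vs10 ffunE.
rewrite !mulr_sumr (bigD1 i) //= big1 ?addr0 => [|j ji]; last first.
  rewrite /G; case: (_ \in _); first by rewrite !mulr0.
  transitivity (p_ j * q_ i * (s * (ext_sign prank B (lshift n j) (rshift n i |: T) *
    const (C (lshift n j |: (rshift n i |: T)))))); last by rewrite (pqE k n_gt1) (negbTE ji) mul0r.
  by ring.
rewrite /G; have [|liT] := boolP (lshift n i \in T); first by rewrite !mulr0.
rewrite ext_signU // prankl prankr ltnNge leqnSn /=.
have -> : ext_sign prank B (lshift n i) T = s.
  rewrite /s /ext_sign; congr (_ ^+ #|pred_of_set _|); apply/setP => l; rewrite !inE.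
  rewrite prankl prankr ltnS [in RHS]leq_eqVlt -prankl (inj_eq prank_inj).
  by case: eqP => [->|]; rewrite ?(negbTE liT).
have ss : s * s = 1 by exact: ext_signK.
transitivity ((s * s) * (const (C (lshift n i |: (rshift n i |: T))) * (p_ i * q_ i))).
  by ring.
by rewrite ss mul1r (pqE k n_gt1) eqxx /pair_set setUA.
Qed.

Hypothesis small_unit : forall r, (0 < r)%N -> (r.*2 <= n.+1)%N -> r%:R != 0 :> k.

(** Restricting a cycle to the p-axes and to the q-axes gives cycles over
    polynomial rings, and their primitives lift to B. Once the corresponding
    boundaries are subtracted, both restrictions are zero, so that by
    [B_normal_form] the cycle is w times a constant form. This is 0 unless e =
    2, and for e = 2 and b < n it is a boundary by [koszul_koszul_const] and
    [lefschetz_surj]. *)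
Lemma koszul_B_exact b e (z : {ffun {set II} -> B^o}) :
    (2 <= e)%N -> (e == 2%N) ==> (b < n)%N ->
    bihom piece b e z -> kosB z = 0 ->
  exists y, bihom piece b.+1 e.-1 y /\ z = kosB y.
Proof.
case: e => [|[|e]] // _ eb hz z0.
have exS side : exists y : {ffun {set II} -> S^o}, bihom homogS b.+1 e.+1 y /\
    forall T, restr side (z T) = kosS side y T.
  have [||y [hy zy]] := @koszul_mpoly_exact side b e.+1
      ([ffun T : {set II} => restr side (z T)] : {ffun {set II} -> S^o}).
  - move=> T; rewrite ffunE; have := hz T; case: ifP => _; last by move=> ->; rewrite restr0.
    exact: restr_piece.
  - by rewrite -restr_koszul z0; apply/ffunP => T; rewrite !ffunE restr0.
  by exists y; split=> // T; rewrite -zy ffunE.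
have [yp [hyp yp1]] := exS true; have [yq [hyq yq1]] := exS false.
pose Y := emb_ext true yp + emb_ext false yq.
have hY : bihom piece b.+1 e.+1 Y.
  by apply: bihomD; [exact: piece0|exact: pieceB|exact: emb_ext_bihom|exact: emb_ext_bihom].
pose z' := z - kosB Y.
have hz' : bihom piece b e.+2 z'.
  apply: bihomB => //; first exact: pieceB.
  by apply: koszul_bihom => //; [exact: piece0|exact: pieceB|exact: piece_var].
have r0 side T : restr side (z' T) = 0.
  have -> : z' T = z T - (kosB (emb_ext true yp) T + kosB (emb_ext false yq) T).
    by rewrite /z' /Y raddfD ffunE [X in _ + X]ffunE [X in - X]ffunE.
  have sub_eq (x a c u : S) : x = u -> a = u -> c = 0 -> x - (a + c) = 0.
    by move=> -> -> ->; rewrite addr0 subrr.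
  rewrite restrB restrD; case: side.
    exact: sub_eq (yp1 T) (restr_koszul_emb true yp T) (@restr_koszul_embN false _ _ _ T hyq).
  rewrite [_ + restr _ _]addrC.
  exact: sub_eq (yq1 T) (restr_koszul_emb false yq T) (@restr_koszul_embN true _ _ _ T hyp).
have z'E T : z' T = const (wcoef (z' T)) * wB.
  rewrite {1}(B_normal_form n_gt1 (z' T)) /aug0 !r0 !rmorph0 ?mcoeff0 ?rmorph0.
  by rewrite addr0 subr0 add0r.
suff [Y' [hY' z'Y]] : exists Y', bihom piece b.+1 e.+1 Y' /\ z' = kosB Y'.
  exists (Y + Y'); split; first by apply: bihomD => //; [exact: piece0|exact: pieceB].
  by rewrite raddfD /= -z'Y /z' addrC subrK.
have [e0|e0] := eqVneq e 0%N; last first.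
  exists 0; split; first by apply: bihom0; exact: piece0.
  rewrite raddf0; apply/ffunP => T; rewrite [RHS]ffunE z'E.
  have := hz' T; case: ifP => _; last by move=> ->; rewrite wcoef0 rmorph0 mul0r.
  by move/wcoef_piece => -> //; rewrite rmorph0 mul0r.
subst e.
have [||C [hC CE]] := @lefschetz_surj n k small_unit b (fun T => wcoef (z' T)).
- by [].
- by move=> T Tb; have := hz' T; rewrite (negbTE Tb) => ->; rewrite wcoef0.
exists (koszul prank (var_side true) (const_ext C)); split; last first.
  by apply/ffunP => T; rewrite koszul_koszul_const CE -z'E.
apply: koszul_bihom; [exact: piece0|exact: pieceB| |].
  move=> i d x hx; rewrite /var_side; case: (split i) => j; rewrite ?scale0r;
    by [exact: piece0 | exact: piece_var].
move=> T; rewrite ffunE; case: ifP => Tb; first exact: B_piece_const.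
by rewrite hC ?Tb // rmorph0.
Qed.
End KoszulB.

(** * Graded free modules and their coordinates *)

Section GradedBases.
Variables (k : fieldType) (R : stdGradedAlg k).

Section Pieces.
Variable M : gmodule R.
Lemma gm_piece0 d : gm_piece M d 0. Proof. exact: graded0 (gm_graded M) d. Qed.
Lemma gm_pieceB d x y : gm_piece M d x -> gm_piece M d y -> gm_piece M d (x - y).
Proof. exact: gradedB (gm_graded M) d x y. Qed.
Lemma gm_pieceN d x : gm_piece M d x -> gm_piece M d (- x).
Proof. by move=> h; rewrite -sub0r; apply: gm_pieceB => //; exact: gm_piece0. Qed.
Lemma gm_pieceD d x y : gm_piece M d x -> gm_piece M d y -> gm_piece M d (x + y).
Proof. by move=> hx hy; rewrite -[y]opprK; apply: gm_pieceB => //; exact: gm_pieceN. Qed.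
Lemma gm_piece_sum d (J : Type) (r : seq J) (Q : pred J) (F : J -> M) :
  (forall j, Q j -> gm_piece M d (F j)) -> gm_piece M d (\sum_(j <- r | Q j) F j).
Proof.
by move=> h; elim/big_ind: _ => //; [exact: gm_piece0 | move=> x y; exact: gm_pieceD].
Qed.
End Pieces.

Record gbasis (M : gmodule R) := GBasis {
  gb_index : choiceType;
  gb_deg : gb_index -> nat;
  gb_elt : gb_index -> M;
  gb_coord : gb_index -> M -> R;
  gb_supp : M -> seq gb_index;
  gb_elt_piece : forall x, gm_piece M (gb_deg x) (gb_elt x);
  gb_coord_linear : forall x (a : R) m m',
    gb_coord x (a *: m + m') = a * gb_coord x m + gb_coord x m';
  gb_coord_elt : forall x y, gb_coord x (gb_elt y) = (x == y)%:R;
  gb_supp_uniq : forall m, uniq (gb_supp m);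
  gb_coord_supp : forall x m, x \notin gb_supp m -> gb_coord x m = 0;
  gb_expand : forall m, m = \sum_(x <- gb_supp m) gb_coord x m *: gb_elt x;
  gb_coord_piece : forall x j m, gm_piece M j m ->
    if (gb_deg x <= j)%N then sga_piece R (j - gb_deg x)%N (gb_coord x m)
    else gb_coord x m = 0 }.

Lemma sum_uniq_widen (T : eqType) (V : zmodType) (s t : seq T) (F : T -> V) :
  uniq s -> uniq t -> {subset s <= t} -> (forall x, x \notin s -> F x = 0) ->
  \sum_(x <- t) F x = \sum_(x <- s) F x.
Proof.
move=> us ut st F0; rewrite (bigID [in s]) /= [X in _ + X]big1 => [|x]; last exact: F0.
rewrite addr0 -big_filter; apply: perm_big; apply: uniq_perm => //.
  exact: filter_uniq.
by move=> x; rewrite mem_filter; case: (boolP (x \in s)) => // /st ->.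
Qed.

Lemma graded_comp_eq (V : zmodType) (P : nat -> set V) (gP : graded_by P)
    (N e : nat) (f : nat -> V) (m : V) :
  (forall d, P d (f d)) -> P e m -> m = \sum_(d < N) f d ->
  m = if (e < N)%N then f e else 0.
Proof.
move=> Pf Pm mE.
pose g d := (if (d < N)%N then f d else 0) - (if d == e then m else 0).
have Pg d : P d (g d).
  apply: (gradedB gP); first by case: ifP => // _; exact: (graded0 gP).
  by case: eqP => [->//|_]; exact: (graded0 gP).
have sg : \sum_(d < maxn N e.+1) g d = 0.
  rewrite sumrB; apply/eqP; rewrite subr_eq0; apply/eqP.
  transitivity m.
    rewrite [RHS]mE (big_ord_widen (maxn N e.+1)) ?leq_maxl // [RHS]big_mkcond /=.
    by apply: eq_bigr.
  have eN : (e < maxn N e.+1)%N by rewrite leq_max ltnSn orbT.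
  rewrite (bigD1 (Ordinal eN)) //= eqxx big1 ?addr0 // => i ie.
  by rewrite (_ : (i == e :> nat) = false) //; apply/negbTE.
have := graded_indep gP Pg sg; move=> /(_ e); rewrite leq_max ltnSn orbT => /(_ isT).
by rewrite /g eqxx => /eqP; rewrite subr_eq0 => /eqP ->.
Qed.

(** Independence makes the coordinates unique; uniqueness makes them linear,
    and compatible with the grading since the components of an expansion of a
    homogeneous element are expansions of its components. *)
Lemma graded_freeP (M : gmodule R) : graded_free M -> inhabited (gbasis M).
Proof.
case=> X [deg [e [hdeg hspan hind]]].
have /boolp.choice[sc scP] (m : M) : exists sc : seq X * (X -> R),
    [/\ uniq sc.1, forall x, x \notin sc.1 -> sc.2 x = 0 &
        m = \sum_(x <- sc.1) sc.2 x *: e x].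
  have [s [c ->]] := hspan m.
  exists (undup s, fun x => c x *+ count_mem x s); split => /=.
  - exact: undup_uniq.
  - by move=> x; rewrite mem_undup -has_pred1 has_count -eqn0Ngt => /eqP ->.
  - rewrite -[LHS]big_undup_iterop_count; apply: eq_bigr => x _.
    by rewrite -scalerMnl.
pose coord x m := (sc m).2 x.
have coord_uniq (s : seq X) (c : X -> R) m : uniq s -> (forall x, x \notin s -> c x = 0) ->
    m = \sum_(x <- s) c x *: e x -> forall x, coord x m = c x.
  move=> us c0 mE x; have [us' c0' mE'] := scP m.
  pose t := undup (s ++ (sc m).1).
  have ut : uniq t by exact: undup_uniq.
  have [xt|xt] := boolP (x \in t); last first.
    move: xt; rewrite mem_undup mem_cat negb_or => /andP[xs xs'].
    by rewrite /coord c0 // c0'.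
  apply/eqP; rewrite -subr_eq0; apply/eqP.
  apply: (hind t (fun x => coord x m - c x) ut) => //.
  rewrite (eq_bigr (fun x => coord x m *: e x - c x *: e x)) => [|y _]; last first.
    by rewrite scalerBl.
  rewrite sumrB.
  rewrite (@sum_uniq_widen _ _ (sc m).1 t (fun x => coord x m *: e x)) //; last 2 first.
  - by move=> y ys; rewrite mem_undup mem_cat ys orbT.
  - by move=> y ys; rewrite /coord c0' // scale0r.
  rewrite (@sum_uniq_widen _ _ s t (fun x => c x *: e x)) //; last 2 first.
  - by move=> y ys; rewrite mem_undup mem_cat ys.
  - by move=> y ys; rewrite c0 // scale0r.
  by rewrite -mE' -mE subrr.
have coord_lin x (a : R) m m' : coord x (a *: m + m') = a * coord x m + coord x m'.
  have [us1 c1 m1] := scP m; have [us2 c2 m2] := scP m'.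
  pose t := undup ((sc m).1 ++ (sc m').1).
  apply: (coord_uniq t (fun x => a * coord x m + coord x m')).
  - exact: undup_uniq.
  - move=> y; rewrite mem_undup mem_cat negb_or => /andP[y1 y2].
    by rewrite /coord c1 // c2 // mulr0 addr0.
  rewrite (eq_bigr (fun x => a *: (coord x m *: e x) + coord x m' *: e x)); last first.
    by move=> y _; rewrite scalerDl scalerA.
  rewrite big_split /= -scaler_sumr; congr (_ *: _ + _).
    rewrite {1}m1; apply/esym/sum_uniq_widen => //; first exact: undup_uniq.
      by move=> y ys; rewrite mem_undup mem_cat ys.
    by move=> y ys; rewrite /coord c1 // scale0r.
  rewrite {1}m2; apply/esym/sum_uniq_widen => //; first exact: undup_uniq.
    by move=> y ys; rewrite mem_undup mem_cat ys orbT.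
  by move=> y ys; rewrite /coord c2 // scale0r.
unshelve refine (inhabits (@GBasis M X deg e coord (fun m => (sc m).1) hdeg coord_lin _ _ _ _ _)) => //.
- move=> x y; apply: (coord_uniq [:: y] (fun x => (x == y)%:R)) => //.
    by move=> z; rewrite inE => /negbTE ->.
  by rewrite big_seq1 eqxx scale1r.
- by move=> m; case: (scP m).
- by move=> x m; have [_ h _] := scP m; exact: h.
- by move=> m; case: (scP m).
move=> x j m hm; have [us c0 mE] := scP m.
have /boolp.choice[Nf NfP] (y : X) : exists Nf : nat * (nat -> R),
   (forall d, sga_piece R d (Nf.2 d)) /\ coord y m = \sum_(d < Nf.1) Nf.2 d.
  by have [N [f [h1 h2]]] := graded_span (sga_graded R) (coord y m); exists (N, f).
pose f y d := if (d < (Nf y).1)%N then (Nf y).2 d else 0.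
have hf y d : sga_piece R d (f y d).
  by rewrite /f; case: ifP => _; [case: (NfP y) | exact: (graded0 (sga_graded R))].
pose s := (sc m).1.
pose N := (\sum_(y <- s) ((Nf y).1 + deg y))%N.
have leN y : y \in s -> ((Nf y).1 + deg y <= N)%N.
  by move=> ys; rewrite /N (big_rem y ys) /= leq_addr.
have cE y : y \in s -> coord y m *: e y =
    \sum_(d < N) (if (deg y <= d)%N then f y (d - deg y)%N *: e y else 0).
  move=> ys; have [_ ->] := NfP y; rewrite scaler_suml.
  rewrite (big_ord_widen_cond N predT (fun d => (Nf y).2 d *: e y)); last first.
    by apply: leq_trans (leN _ ys); rewrite leq_addr.
  rewrite -(big_mkord (fun d => d < (Nf y).1)%N (fun d => (Nf y).2 d *: e y)).
  rewrite -(big_mkord predT (fun d => if (deg y <= d)%N then f y (d - deg y)%N *: e y else 0)).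
  have dN : (deg y <= N)%N by apply: leq_trans (leN _ ys); rewrite leq_addl.
  rewrite [RHS](@big_cat_nat _ _ _ (deg y)) //= [X in _ = X + _]big_nat [X in _ = X + _]big1 ?add0r; last first.
    by move=> i /andP[_ h]; rewrite leqNgt h.
  have := big_addn 0%N N (deg y) predT
    (fun i => if (deg y <= i)%N then f y (i - deg y)%N *: e y else 0).
  rewrite add0n => ->; rewrite big_mkcond /=.
  rewrite [LHS](@big_cat_nat _ _ _ (N - deg y)%N) ?leq_subr //=.
  rewrite [X in _ + X = _]big_nat [X in _ + X = _]big1 ?addr0; last first.
    by move=> i /andP[h _]; case: ifP => // h'; have := leN _ ys; lia.
  apply: eq_bigr => d _; rewrite leq_addl addnK /f.
  by case: ifP => //; rewrite scale0r.
pose g d := \sum_(y <- s) (if (deg y <= d)%N then f y (d - deg y)%N *: e y else 0).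
have gP d : gm_piece M d (g d).
  apply: gm_piece_sum => y _; case: ifP => h; last exact: gm_piece0.
  by rewrite -[X in gm_piece M X](subnK h); apply: gm_pieceZ.
have mg : m = \sum_(d < N) g d.
  rewrite exchange_big /= {1}mE; apply: eq_big_seq => y ys; exact: cE.
have mE' := graded_comp_eq (gm_graded M) gP hm mg.
have coordE : coord x m = if (x \in s) && ((deg x <= j) && (j < N))%N then f x (j - deg x)%N else 0.
  case: ifP => [/andP[xs /andP[dj jN]]|h].
    rewrite {1}mE' jN; apply: etrans (coord_uniq s (fun y => if (y \in s) && (deg y <= j)%N then f y (j - deg y)%N else 0) _ us _ _ x) _.
    - by move=> y /negbTE ->.
    - rewrite /g; apply: eq_big_seq => y ys; rewrite ys /=.
      by case: ifP; rewrite ?scale0r.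
    - by rewrite xs dj.
  have [xs|xs] := boolP (x \in s); last by rewrite /coord c0.
  move: h; rewrite xs /=; case: (ltnP j N) => jN; rewrite ?andbT ?andbF => h; last first.
    by rewrite mE' ltnNge jN /=; apply: (coord_uniq [::] (fun=> 0)) => //; rewrite big_nil.
  rewrite mE' jN; apply: etrans (coord_uniq s (fun y => if (y \in s) && (deg y <= j)%N then f y (j - deg y)%N else 0) _ us _ _ x) _.
  - by move=> y /negbTE ->.
  - rewrite /g; apply: eq_big_seq => y ys; rewrite ys /=.
    by case: ifP; rewrite ?scale0r.
  - by rewrite h andbF.
rewrite -/(coord x m) coordE; case: (boolP (deg x <= j)%N) => dj; last by rewrite andbF.
case: ifP => // _; exact: (graded0 (sga_graded R)).
Qed.

Section Extension.
Variables (M : gmodule R) (b : gbasis M).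

Lemma gb_sum_widen (L : lmodType R) (v : gb_index b -> L) (m : M) (t : seq (gb_index b)) :
  uniq t -> {subset gb_supp b m <= t} ->
  \sum_(x <- t) gb_coord x m *: v x = \sum_(x <- gb_supp b m) gb_coord x m *: v x.
Proof.
move=> ut st; apply: sum_uniq_widen => //; first exact: gb_supp_uniq.
by move=> x xs; rewrite gb_coord_supp // scale0r.
Qed.

Definition gb_extend (L : lmodType R) (v : gb_index b -> L) (m : M) : L :=
  \sum_(x <- gb_supp b m) gb_coord x m *: v x.

Lemma gb_extend_linear (L : lmodType R) (v : gb_index b -> L) : linear (gb_extend v).
Proof.
move=> a m m'; pose t := undup (gb_supp b (a *: m + m') ++ gb_supp b m ++ gb_supp b m').
have ut : uniq t by exact: undup_uniq.
rewrite /gb_extend -!(gb_sum_widen _ ut); first last.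
- by move=> x xs; rewrite mem_undup !mem_cat xs.
- by move=> x xs; rewrite mem_undup !mem_cat xs orbT.
- by move=> x xs; rewrite mem_undup !mem_cat xs !orbT.
rewrite scaler_sumr -big_split; apply: eq_bigr => x _.
by rewrite gb_coord_linear scalerDl scalerA.
Qed.
HB.instance Definition _ (L : lmodType R) (v : gb_index b -> L) :=
  GRing.isLinear.Build R M L _ (gb_extend v) (gb_extend_linear v).

Lemma gb_coord0 (x : gb_index b) : gb_coord x 0 = 0.
Proof.
have := gb_coord_linear x (-1) 0 0.
by rewrite scaler0 addr0 mulN1r addNr.
Qed.

Lemma gb_extend_elt (L : lmodType R) (v : gb_index b -> L) (x : gb_index b) :
  gb_extend v (gb_elt x) = v x.
Proof.
pose t := undup (x :: gb_supp b (gb_elt x)).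
have ut : uniq t by exact: undup_uniq.
rewrite /gb_extend -(gb_sum_widen _ ut); last first.
  by move=> y ys; rewrite mem_undup inE ys orbT.
rewrite (bigD1_seq x) //=; last by rewrite mem_undup mem_head.
rewrite gb_coord_elt eqxx scale1r big1 ?addr0 // => y yx.
by rewrite gb_coord_elt (negbTE yx) scale0r.
Qed.

Lemma gb_coord_is_linear (x : gb_index b) : linear (gb_coord x : M -> R^o).
Proof. by move=> a m m'; rewrite gb_coord_linear. Qed.
HB.instance Definition _ (x : gb_index b) :=
  GRing.isLinear.Build R M R^o _ (gb_coord x) (gb_coord_is_linear x).
End Extension.
End GradedBases.

(** * Tor with the residue field in terms of elements *)

Section TorElements.
Variables (k : fieldType) (R : stdGradedAlg k).
Local Notation res := (residue R).
Local Notation hm := (@hmax k R).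
Local Notation qt := ({ideal_quot hm}).

Definition rone : res := (1 : {ideal_quot hm}).

Lemma residue_scale_pi (r s : R) :
  r *: ((\pi_{ideal_quot hm} s)%qT : res) = (\pi_{ideal_quot hm} (r * s)%R)%qT :> res.
Proof. by rewrite rmorphM. Qed.

Lemma scale_rone (r : R) : r *: rone = (\pi_{ideal_quot hm} r)%qT :> res.
Proof. by rewrite -[r in RHS]mulr1 -residue_scale_pi rmorph1. Qed.

Lemma scale_rone_eq0 (r : R) : (r *: rone = 0) <-> r \in hm.
Proof.
rewrite scale_rone; split=> [h|h].
  have : (\pi_{ideal_quot hm} r)%qT == (\pi_{ideal_quot hm} 0)%qT :> qt.
    by rewrite rmorph0; apply/eqP.
  by rewrite -Quotient.idealrBE subr0.
have : (\pi_{ideal_quot hm} r)%qT == (\pi_{ideal_quot hm} 0)%qT :> qt.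
  by rewrite -Quotient.idealrBE subr0.
by rewrite rmorph0 => /eqP.
Qed.

Lemma residue_gen (x : res) : exists r : R, x = r *: rone.
Proof. by exists (repr (x : qt)); rewrite scale_rone reprK. Qed.

Lemma hmax_scale (r : R) (x : res) : r \in hm -> r *: x = 0.
Proof.
move=> h; have [s ->] := residue_gen x.
by rewrite scalerA mulrC -scalerA (iffRL (scale_rone_eq0 r) h) scaler0.
Qed.

Lemma hmaxD (a u v : R) : u \in hm -> v \in hm -> a * u + v \in hm.
Proof. exact: ideal_genPD. Qed.

Lemma residue_const (x : res) : exists c : k, x = sga_const R c *: rone.
Proof.
have [r ->] := residue_gen x.
have [N [f [Pf ->]]] := graded_span (sga_graded R) r.
case: N => [|N]; first by exists 0; rewrite big_ord0 rmorph0.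
have := Pf 0%N; rewrite sga_piece0 => -[c _ fc]; exists c.
rewrite big_ord_recl scalerDl fc -[RHS]addr0; congr (_ + _).
apply/scale_rone_eq0; elim/big_ind: _ => [|u v hu hv|i _].
- exact: ideal_gen0.
- by rewrite -[u]mul1r; exact: hmaxD.
- by rewrite -[f _]mul1r; apply: mem_ideal_gen; exists (bump 0 i) => //; exact: Pf.
Qed.

Section Reduce.
Variables (M : gmodule R).
Local Notation N := (residue_gmodule R).

(** The residue field is spanned by the class [rone] of 1, so a sum of pure
    tensors is m (x) 1. Taking the scalars in k keeps m homogeneous. *)
Lemma tensor_reduce (s : seq (M * N)) : exists m : M,
  (forall (Z : lmodType R) (g : M -> N -> Z), (forall n, linear (g^~ n)) ->
     (forall x, linear (g x)) -> \sum_(z <- s) g z.1 z.2 = g m rone) /\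
  (forall j, tensor_homog j s -> gm_piece M j m).
Proof.
elim: s => [|[x n] s [m [mE hm']]].
  exists 0; split=> [Z g gl gr|j _]; last exact: gm_piece0.
  rewrite big_nil; have := gl rone (-1) 0 0.
  by rewrite scaler0 addr0 scaleN1r addNr.
have [c0 nE] := residue_const n.
pose c := if n == 0 then 0 else c0.
have {}nE : n = sga_const R c *: rone.
  by rewrite /c; case: eqP nE => // -> _; rewrite rmorph0 scale0r.
exists (sga_const R c *: x + m); split=> [Z g gl gr|j hs].
  rewrite big_cons (mE Z g gl gr) gl /= {1}nE.
  have g0 : g x 0 = 0 by have := gr x (-1) 0 0; rewrite scaler0 addr0 scaleN1r addNr.
  by have := gr x (sga_const R c) rone 0; rewrite addr0 g0 addr0 => ->.
apply: gm_pieceD; last by apply: hm' => z zs; apply: hs; rewrite inE zs orbT.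
have [|a [b [ha hb <-]]] := hs (x, n); first by rewrite mem_head.
case: b hb => [_|b /= hb].
  rewrite addn0 -[X in gm_piece M X]add0n; apply: gm_pieceZ => //.
  by rewrite sga_piece0; exists c.
by rewrite /c (_ : n = 0) // eqxx rmorph0 scale0r; exact: gm_piece0.
Qed.

(** The submodule hmax M, which is the kernel of m |-> m (x) 1. *)
Definition in_max (x : M) := exists s : seq (R * M),
  (forall z, z \in s -> z.1 \in hm) /\ x = \sum_(z <- s) z.1 *: z.2.

Lemma in_max_kill (Z : lmodType R) (g : M -> N -> Z) (x : M) :
  (forall n, linear (g^~ n)) -> (forall x, linear (g x)) ->
  in_max x -> g x rone = 0.
Proof.
move=> gl gr [s [hs ->]].
have g0 n : g 0 n = 0.
  by have := gl n (-1) 0 0; rewrite scaler0 addr0 scaleN1r addNr.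
have gx0 y : g y 0 = 0.
  by have := gr y (-1) 0 0; rewrite scaler0 addr0 scaleN1r addNr.
elim: s hs => [|z s IH] hs; first by rewrite big_nil g0.
rewrite big_cons gl IH ?addr0; last by move=> y ys; apply: hs; rewrite inE ys orbT.
have := gr z.2 z.1 rone 0; rewrite addr0 gx0 addr0 => <-.
have /scale_rone_eq0 -> : z.1 \in hm by apply: hs; rewrite mem_head.
exact: gx0.
Qed.

Section Form.
Variable h : M -> R.
Hypothesis h_lin : forall (a : R) x y (n : N),
  h (a *: x + y) *: n = a *: (h x *: n) + h y *: n.
(** Equality in a tensor product is tested on bilinear maps; these are the
    ones with values in the residue field. The function h need not be linear,
    only its residue. *)
Definition test_form (x : M) (n : N) : N := h x *: n.
Lemma test_form_bilinear : bilinear_for *:%R *:%R test_form.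
Proof.
split=> [n a x y|x a n n'] /=; first exact: h_lin.
by rewrite /test_form scalerDr !scalerA mulrC.
Qed.
HB.instance Definition _ :=
  bilinear_isBilinear.Build R M N N *:%R *:%R test_form test_form_bilinear.
Definition test_bilinear : {bilinear M -> N -> N} := test_form.
End Form.

End Reduce.

Section Resolution.
Local Notation N := (residue_gmodule R).
Variable F : graded_free_resolution (residue_gmodule R).

(** The condition that m (x) 1 be a cycle. *)
Definition cycle_mod_max (i : nat) : F i -> Prop :=
  match i with
  | 0 => fun _ => True
  | i'.+1 => fun m => in_max (res_d F i' m)
  end.

Lemma bilinear_linl (M M' Z : lmodType R) (b : {bilinear M -> M' -> Z}) n : linear (b^~ n).
Proof. by move=> a x y; rewrite linearPl. Qed.
Lemma bilinear_linr (M M' Z : lmodType R) (b : {bilinear M -> M' -> Z}) x : linear (b x).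
Proof. by move=> a n n'; rewrite linearPr. Qed.

Lemma tensor_mapl_sum (M M' Z : lmodType R) (f : {linear M -> M'}) (s : seq (M * N))
    (b : {bilinear M' -> N -> Z}) :
  \sum_(z <- tensor_mapl f s) b z.1 z.2 = \sum_(z <- s) b (f z.1) z.2.
Proof. by rewrite big_map. Qed.

(** Vanishing of Tor only requires to solve m = d m' modulo hmax for the
    homogeneous m whose differential lies in hmax: the coordinates of d m in a
    basis are detected by bilinear maps into the residue field. *)
Lemma Tor_elements (i j : nat) (s : seq (F i * N)) :
    tensor_homog j s -> res_cycle s ->
    (forall m, gm_piece (F i) j m -> cycle_mod_max m ->
       exists m', gm_piece (F i.+1) j m' /\ in_max (m - res_d F i m')) ->
  res_boundary j s.
Proof.
move=> hs cs H; have [m [mE mh]] := tensor_reduce s.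
have hm' := mh j hs.
have cm : cycle_mod_max m.
  case: i s hs cs {H} m mE {mh hm'} => [//|i] s hs cs m mE /=.
  have [b] := graded_freeP (res_free F i).
  exists [seq (gb_coord x (res_d F i m), gb_elt x) | x <- gb_supp b (res_d F i m)].
  split; last by rewrite big_map -gb_expand.
  move=> z /mapP[x _ ->] /=; apply/scale_rone_eq0.
  have hlin (a : R) y y' (n : N) : gb_coord x (a *: y + y') *: n =
     a *: (gb_coord x y *: n) + gb_coord x y' *: n.
    by rewrite gb_coord_linear scalerDl scalerA.
  have := cs _ (test_bilinear hlin); rewrite tensor_mapl_sum big_nil.
  rewrite (mE _ (fun y n => test_bilinear hlin (res_d F i y) n)) //.
    by move=> n a y y'; rewrite linearP bilinear_linl.
  by move=> y; exact: bilinear_linr.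
have [m' [hm'' [t [ht tE]]]] := H m hm' cm.
exists [:: (m', rone)].
  by move=> z; rewrite inE => /eqP ->; exists j, 0%N; rewrite addn0.
move=> Z b; rewrite tensor_mapl_sum big_seq1 /=.
rewrite (mE Z b (bilinear_linl b) (bilinear_linr b)).
have : b (m - res_d F i m') rone = 0.
  apply: in_max_kill; [exact: bilinear_linl | exact: bilinear_linr | by exists t].
by rewrite linearBl => /eqP; rewrite subr_eq0 => /eqP ->.
Qed.

(** A functional on F_i that is linear over the augmentation is a linear map
    from F_i (x) k to k. If it vanishes on the differentials, it descends to
    Tor_i. *)
Lemma Tor_detect (i j : nat) (m : F i) (aug : R -> k) (phi : F i -> k) :
    (forall r, r - sga_const R (aug r) \in hm) ->
    (forall (a : R) x y, phi (a *: x + y) = aug a * phi x + phi y) ->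
    (forall y, phi (res_d F i y) = 0) ->
    gm_piece (F i) j m -> cycle_mod_max m -> phi m != 0 ->
  Tor_residue_neq0 R i j.
Proof.
move=> haug hphi phid hm' cm pm; exists F, [:: (m, rone)]; split.
- by move=> z; rewrite inE => /eqP ->; exists j, 0%N; rewrite addn0.
- case: i m phi hphi phid hm' cm pm => [//|i] m phi hphi phid hm' cm pm Z b.
  rewrite tensor_mapl_sum big_seq1 big_nil /=.
  by apply: in_max_kill; [exact: bilinear_linl | exact: bilinear_linr |].
case=> s' hs' /(_ N) tE.
have aug_scale (a : R) (n : N) : a *: n = sga_const R (aug a) *: n.
  by apply/eqP; rewrite -subr_eq0 -scalerBl; apply/eqP/hmax_scale.
have hlin (a : R) y y' (n : N) : sga_const R (phi (a *: y + y')) *: n =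
     a *: (sga_const R (phi y) *: n) + sga_const R (phi y') *: n.
  by rewrite hphi rmorphD rmorphM scalerDl -scalerA (aug_scale a).
have := tE (test_bilinear hlin); rewrite tensor_mapl_sum big_seq1 /= big1 => [|z _]; last first.
  by rewrite /test_bilinear /= /test_form phid rmorph0 scale0r.
rewrite /test_bilinear /= /test_form => /esym/scale_rone_eq0 h.
case/negP: (hmax1 R).
have := hmaxD (sga_const R (phi m)^-1) h (ideal_gen0 _).
by rewrite addr0 -rmorphM mulVf // rmorph1.
Qed.
End Resolution.
End TorElements.

(** * Existence of graded free resolutions *)

Section FreeModule.
Variables (k : fieldType) (R : stdGradedAlg k).

(** A generator of degree [delta] of a free module shifts the degrees of its
    coordinate c. Any larger bound N' serves as well, so that one bound can be
    taken for several coordinates. *)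
Lemma shifted_span (c : R) (delta : nat) : exists (N : nat) (f : nat -> R),
  (forall d, if (delta <= d)%N then sga_piece R (d - delta)%N (f d) else f d = 0) /\
  forall N', (N <= N')%N -> c = \sum_(d < N') f d.
Proof.
have [N [f [hf ->]]] := graded_span (sga_graded R) c.
pose f' d := if (d < N)%N then f d else 0.
exists (N + delta)%N, (fun d => if (delta <= d)%N then f' (d - delta)%N else 0).
split=> [d|N' leN].
  case: (leqP delta d) => // _; rewrite /f'; case: ifP => _; [exact: hf | exact: (graded0 (sga_graded R))].
rewrite -(big_mkord predT (fun d => if (delta <= d)%N then f' (d - delta)%N else 0)).
have dN : (delta <= N')%N by apply: leq_trans leN; rewrite leq_addl.
rewrite (@big_cat_nat _ _ _ delta) //= [X in _ = X + _]big_nat [X in _ = X + _]big1 ?add0r;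
  last by move=> i /andP[_ h]; rewrite leqNgt h.
have := big_addn 0%N N' delta predT (fun d => if (delta <= d)%N then f' (d - delta)%N else 0).
rewrite add0n => ->; rewrite big_mkord.
have NN' : (N <= N' - delta)%N by rewrite leq_subRL // addnC.
rewrite (big_ord_widen _ f NN') big_mkcond.
by apply: eq_bigr => i _; rewrite leq_addl addnK.
Qed.

Section Construction.
Variables (X : choiceType) (deg : X -> nat).
Local Notation FM := (malg X R).

Definition free_piece (j : nat) (g : FM) : Prop := forall x,
  if (deg x <= j)%N then sga_piece R (j - deg x)%N (monalg.mcoeff x g)
  else monalg.mcoeff x g = 0.

Lemma free_graded : graded_by (free_piece : nat -> set FM).
Proof.
split=> [d x|d g h hg hh x|g|N f hf].
- rewrite monalg.mcoeff0; case: ifP => // _; exact: (graded0 (sga_graded R)).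
- rewrite monalg.mcoeffB; have := hg x; have := hh x; case: ifP => _.
    by move=> h1 h2; exact: (gradedB (sga_graded R)).
  by move=> -> ->; rewrite subr0.
- have /boolp.choice[Nf NfP] (x : X) := shifted_span (monalg.mcoeff x g) (deg x).
  have /boolp.choice[f fP] := NfP.
  pose s : seq X := enum_fset (monalg.msupp g).
  pose N := (\sum_(x <- s) Nf x)%N.
  exists N, (fun d => \sum_(x <- s) mkmalgU x (f x d)); split.
    move=> d x; rewrite raddf_sum /=.
    have [xs|xs] := boolP (x \in s); last first.
      rewrite big_seq big1 => [|y ys].
        by case: ifP => // _; exact: (graded0 (sga_graded R)).
      by rewrite monalg.mcoeffU; case: eqP ys xs => [-> ->|].
    rewrite (bigD1_seq x) ?fset_uniq //= monalg.mcoeffUU big1 ?addr0; last first.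
      by move=> y yx; rewrite monalg.mcoeffU (negbTE yx).
    by case: (fP x) => h _; exact: h.
  rewrite exchange_big /= {1}(monalgE g); apply: eq_big_seq => x xs.
  have [_ h] := fP x; rewrite -raddf_sum; congr mkmalgU; apply: h.
  by rewrite /N (big_rem x xs) leq_addr.
move=> f0 d ltdN; apply/malgP => x; rewrite monalg.mcoeff0.
have := hf d x; case: ifP => // dx _.
pose h e := monalg.mcoeff x (f (e + deg x)%N).
have hh e : sga_piece R e (h e).
  by have := hf (e + deg x)%N x; rewrite leq_addl addnK.
have := graded_indep (sga_graded R) hh (N := (N - deg x)%N) _ (d := (d - deg x)%N).
rewrite /h subnK //; apply; last by rewrite ltn_sub2r // (leq_ltn_trans dx ltdN).
have := congr1 (monalg.mcoeff x) f0; rewrite raddf_sum monalg.mcoeff0 => {2}<- /=.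
rewrite -[RHS](big_mkord predT (fun d => monalg.mcoeff x (f d))).
have dxN : (deg x <= N)%N by apply: leq_trans dx (ltnW ltdN).
rewrite [RHS](@big_cat_nat _ _ _ (deg x)) //= [X in _ = X + _]big_nat.
rewrite [X in _ = X + _]big1 ?add0r => [|i /andP[_ hi]]; last first.
  by have := hf i x; rewrite leqNgt hi.
have := big_addn 0%N N (deg x) predT (fun d => monalg.mcoeff x (f d)).
by rewrite add0n => ->; rewrite big_mkord.
Qed.

Lemma free_pieceZ i j (r : R) (g : FM) : sga_piece R i r -> free_piece j g ->
  free_piece (i + j)%N (r *: g).
Proof.
move=> hr hg x; rewrite monalg.mcoeffZ; have := hg x; case: ifP => [h1 h2|_ ->].
  by rewrite (leq_trans h1 (leq_addl _ _)) -addnBA //; exact: sga_pieceM.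
by rewrite mulr0; case: ifP => // _; exact: (graded0 (sga_graded R)).
Qed.

Definition free_gmodule : gmodule R := GModule free_graded free_pieceZ.

Definition free_gbasis : gbasis free_gmodule.
Proof.
apply: (@GBasis _ R free_gmodule X deg (fun x => mkmalgU x (1 : R) : FM)
  (fun x (g : FM) => monalg.mcoeff x g) (fun g : FM => enum_fset (monalg.msupp g))).
- move=> x y /=; rewrite monalg.mcoeffU; case: eqP => [<-|_]; last first.
    by case: ifP => // _; exact: (graded0 (sga_graded R)).
  by rewrite leqnn subnn sga_piece0; exists 1 => //; rewrite rmorph1.
- by move=> x a g h; rewrite monalg.mcoeffD monalg.mcoeffZ.
- by move=> x y; rewrite monalg.mcoeffU eq_sym; case: eqP.
- by move=> g; exact: fset_uniq.
- by move=> x g; exact: monalg.mcoeff_outdom.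
- move=> g; rewrite {1}(monalgE g); apply: eq_bigr => x _.
  apply/malgP => y; rewrite monalg.mcoeffZ !monalg.mcoeffU.
  by case: eqP; rewrite ?mulr1 ?mulr0.
- by move=> x j g h; exact: h.
Defined.
End Construction.

Lemma gbasis_free (M : gmodule R) (b : gbasis M) : graded_free M.
Proof.
exists (gb_index b), (@gb_deg _ _ _ b), (@gb_elt _ _ _ b); split.
- exact: gb_elt_piece.
- by move=> m; exists (gb_supp b m), (fun x => gb_coord x m); exact: gb_expand.
move=> s c us s0 x xs.
have := congr1 (gb_coord x) s0; rewrite gb_coord0.
rewrite (raddf_sum (gb_coord x : {additive M -> R^o})) (bigD1_seq x) //=.
have cE y : gb_coord x (c y *: gb_elt y) = c y * (x == y)%:R.
  by rewrite -[c y *: _]addr0 gb_coord_linear gb_coord0 addr0 gb_coord_elt.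
rewrite cE eqxx mulr1 big1 ?addr0 // => y yx.
by rewrite cE eq_sym (negbTE yx) mulr0.
Qed.

(** The submodules to be covered by a free module at each stage of the
    resolution. Keeping them as predicates on the ambient module avoids making
    a kernel into a module. *)
Record gsub := GSub {
  gs_mod : gmodule R;
  gs_in : gs_mod -> Prop;
  gs_in0 : gs_in 0;
  gs_inD : forall (a : R) x y, gs_in x -> gs_in y -> gs_in (a *: x + y);
  gs_hom : forall x, gs_in x -> exists N (f : nat -> gs_mod),
    (forall d, gm_piece gs_mod d (f d) /\ gs_in (f d)) /\ x = \sum_(d < N) f d }.

Section Cover.
Variable Z : gsub.
(** The cover has one generator for each homogeneous element of the submodule. *)
Definition cover_pred (y : nat * gs_mod Z) : bool :=
  asbool (gm_piece (gs_mod Z) y.1 y.2 /\ gs_in y.2).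
Definition cover_index : choiceType := {y : nat * gs_mod Z | cover_pred y}.
Definition cover_deg (x : cover_index) : nat := (val x).1.
Definition cover : gmodule R := free_gmodule cover_deg.
Definition cover_basis : gbasis cover := free_gbasis cover_deg.
Definition cover_map : {linear cover -> gs_mod Z} :=
  gb_extend (b := cover_basis) (fun x : cover_index => (val x).2).

Lemma cover_index_piece (x : cover_index) :
  gm_piece (gs_mod Z) (cover_deg x) (val x).2 /\ gs_in (val x).2.
Proof. by apply/asboolP; exact: (valP x). Qed.

Lemma cover_map_deg j x : gm_piece cover j x -> gm_piece (gs_mod Z) j (cover_map x).
Proof.
move=> hx; apply: gm_piece_sum => y _.
have := gb_coord_piece (g := cover_basis) y hx; rewrite /=; case: ifP => [h1 h2|_ ->].
  rewrite -[X in gm_piece _ X](subnK h1); apply: gm_pieceZ => //.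
  by case: (cover_index_piece y).
by rewrite scale0r; exact: gm_piece0.
Qed.

Lemma gs_in_sum (J : Type) (r : seq J) (P : pred J) (f : J -> gs_mod Z) :
  (forall j, P j -> gs_in (f j)) -> gs_in (\sum_(j <- r | P j) f j).
Proof.
move=> h; elim/big_ind: _ => // [|x y hx hy]; first exact: gs_in0.
by rewrite -[x]scale1r; exact: gs_inD.
Qed.

Lemma cover_map_image z : gs_in z <-> exists y, cover_map y = z.
Proof.
split=> [/gs_hom[N [f [hf ->]]]|[y <-]]; last first.
  apply: gs_in_sum => x _; rewrite -[_ *: _]addr0; apply: gs_inD; last exact: gs_in0.
  by case: (cover_index_piece x).
have px d : cover_pred (d, f d) by apply/asboolP; exact: hf.
exists (\sum_(d < N) gb_elt (g := cover_basis) (exist _ (d : nat, f d) (px d))).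
rewrite raddf_sum; apply: eq_bigr => d _.
exact: (gb_extend_elt (b := cover_basis)).
Qed.

Lemma kernel_hom x : cover_map x = 0 -> exists N (f : nat -> cover),
  (forall d, gm_piece cover d (f d) /\ cover_map (f d) = 0) /\ x = \sum_(d < N) f d.
Proof.
move=> x0; have [N [f [hf xE]]] := graded_span (gm_graded cover) x.
exists N, (fun d => if (d < N)%N then f d else 0); split; last first.
  by rewrite {1}xE; apply: eq_bigr => i _; rewrite ltn_ord.
move=> d; case: ifP => dN; last by split; [exact: gm_piece0 | rewrite raddf0].
split=> //; apply: (graded_indep (gm_graded (gs_mod Z)) (f := fun d => cover_map (f d)) _ _ dN).
  by move=> e; exact: cover_map_deg.
by rewrite -raddf_sum -xE.
Qed.

Definition kernel_gsub : gsub.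
Proof.
apply: (@GSub cover (fun x => cover_map x = 0)).
- exact: raddf0.
- by move=> a x y hx hy; rewrite linearP /= hx hy scaler0 addr0.
- exact: kernel_hom.
Defined.
End Cover.

Definition whole_gsub (M : gmodule R) : gsub.
Proof.
apply: (@GSub M (fun _ => True)) => // x _.
by have [N [f [hf ->]]] := graded_span (gm_graded M) x; exists N, f.
Defined.

Fixpoint syzygy (M : gmodule R) (i : nat) : gsub :=
  if i is i'.+1 then kernel_gsub (syzygy M i') else whole_gsub M.

Lemma resolution_exists (M : gmodule R) : graded_free_resolution M.
Proof.
unshelve eapply (@GradedFreeResolution k R M (fun i => cover (syzygy M i))
  (fun i => cover_map (syzygy M i.+1)) (cover_map (syzygy M 0))).
- move=> i; exact: gbasis_free (cover_basis _).
- move=> i j x; exact: cover_map_deg.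
- move=> j x; exact: cover_map_deg.
- by move=> m; have [h _] := cover_map_image (Z := syzygy M 0) m; exact: h I.
- by move=> x; exact: (cover_map_image (Z := syzygy M 1)).
- by move=> i x; exact: (cover_map_image (Z := syzygy M i.+2)).
Qed.
End FreeModule.

(** * Constant and linear cycles of the Koszul complex of B *)

Section VspaceOfPred.
Variables (k : fieldType) (V : vectType k) (P : V -> Prop).
Hypothesis P0 : P 0.
Hypothesis PD : forall a x y, P x -> P y -> P (a *: x + y).

(** A subspace of maximal dimension inside P contains every vector of P, as it
    could otherwise be enlarged by a line. *)
Lemma vspace_of_pred : exists U : {vspace V}, forall v, v \in U <-> P v.
Proof.
pose Q d := asbool (exists U : {vspace V}, \dim U = d /\ forall v, v \in U -> P v).
have Q0 : exists d, Q d.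
  exists 0%N; apply/asboolP; exists 0%VS; split; first exact: dimv0.
  by move=> v; rewrite memv0 => /eqP ->.
have Qmax d : Q d -> (d <= \dim {:V})%N.
  by move=> /asboolP[U [<- _]]; apply: dimvS; exact: subvf.
case: (ex_maxnP Q0 Qmax) => d /asboolP[U [dU UP]] dmax.
exists U => v; split=> [|Pv]; first exact: UP.
apply/negPn/negP => vU.
have /dmax : Q (\dim (U + <[v]>)).
  apply/asboolP; exists (U + <[v]>)%VS; split=> // w /memv_addP[u uU [x /vlineP[a ->] ->]].
  by rewrite addrC; exact: PD Pv (UP _ uU).
rewrite -dU => h; have : (U == U + <[v]>)%VS by rewrite eqEdim addvSl.
move/eqP => UE; case/negP: vU; rewrite UE.
by apply: (subvP (addvSr U <[v]>)); exact: memv_line.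
Qed.
End VspaceOfPred.

Section AugB.
Variables (n : nat) (k : fieldType).
Hypothesis n_gt1 : (1 < n)%N.
Hypothesis small_unit : forall r, (0 < r)%N -> (r.*2 <= n.+1)%N -> r%:R != 0 :> k.
Local Notation B := (B_ring n k).
Local Notation R := (algB n k).
Local Notation II := 'I_(n + n).
Local Notation const := (@B_const n k).
Local Notation var := (@var n k : II -> B).
Local Notation piece := (@B_piece n k : nat -> B^o -> Prop).
Local Notation kosB := (koszul (@prank n) var).
Local Notation K := {ffun {set II} -> B^o}.

Lemma aug0D x y : aug0 (x + y : B) = aug0 x + aug0 y.
Proof. by rewrite /aug0 restrD mcoeffD. Qed.
Lemma aug0M x y : aug0 (x * y : B) = aug0 x * aug0 y.
Proof. by rewrite /aug0 restrM rmorphM. Qed.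
Lemma aug0_const c : aug0 (const c) = c.
Proof. by rewrite /aug0 restr_const mcoeffC eqxx mulr1. Qed.
Lemma aug0_0 : aug0 (0 : B) = 0.
Proof. by rewrite /aug0 restr0 mcoeff0. Qed.

Lemma var_hmax i : var i \in @hmax k R.
Proof.
rewrite -[var i]mul1r; apply: mem_ideal_gen; exists 1%N => //.
exact: B_piece_var.
Qed.

(** Every variable lies in the maximal ideal, so an element differs from its
    constant term by an element of that ideal. *)
Lemma aug0_hmax (r : B) : r - const (aug0 r) \in @hmax k R.
Proof.
elim/B_ind: r => [c|x y hx hy|i x hx].
- by rewrite aug0_const subrr; exact: ideal_gen0.
- rewrite aug0D rmorphD opprD addrACA -[X in X + _]mul1r.
  exact: (@hmaxD k R 1 _ _ hx hy).
- rewrite aug0_var rmorph0 subr0 mulrC -[_ * _]addr0.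
  exact: (@hmaxD k R x (var i) 0 (var_hmax i) (ideal_gen0 _)).
Qed.

Lemma hmax_aug0 (r : B) : (r \in @hmax k R) <-> aug0 r = 0.
Proof.
split=> [rh|r0]; last by have := aug0_hmax r; rewrite r0 rmorph0 subr0.
have /(hmaxD (R := R) (-1) (aug0_hmax r)) := rh.
rewrite mulN1r opprB subrK => h; apply/eqP; apply: contraT => a0.
have := hmaxD (R := R) (const (aug0 r)^-1) h (ideal_gen0 _).
by rewrite addr0 -(rmorphM const) mulVf // rmorph1 => h1; case/negP: (hmax1 R).
Qed.

Lemma piece1_span (x : B) : piece 1%N x -> exists c : II -> k, x = \sum_i const (c i) * var i.
Proof.
case=> g /dhomogP hg <-; exists (fun i => g@_U_(i)).
have {1}-> : g = \sum_i mpolyC _ g@_U_(i) * 'X_i.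
  apply/mpolyP => m; rewrite raddf_sum /=.
  rewrite (eq_bigr (fun i => g@_U_(i) * (U_(i) == m)%:R)) => [|i _]; last first.
    by rewrite mcoeffCM mcoeffX.
  have [mg|mg] := boolP (m \in msupp g).
    have /eqP/mdeg1P[j /eqP mj] : mdeg m = 1%N by exact: hg.
    rewrite mj (bigD1 j) //= eqxx mulr1 big1 ?addr0 // => i ij.
    by rewrite eq_mnm1 (negbTE ij) mulr0.
  rewrite memN_msupp_eq0 // big1 // => i _; case: eqP => [e|]; rewrite ?mulr0 //.
  by rewrite e memN_msupp_eq0 // mul0r.
by rewrite rmorph_sum; apply: eq_bigr => i _; rewrite rmorphM.
Qed.

Definition lcoef (i : II) (b : B) : k :=
  match split i with inl j => (restr true b)@_U_(j) | inr j => (restr false b)@_U_(j) end.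

Lemma lcoefD i x y : lcoef i (x + y) = lcoef i x + lcoef i y.
Proof. by rewrite /lcoef; case: (split i) => j; rewrite restrD mcoeffD. Qed.
Lemma lcoef0 i : lcoef i 0 = 0.
Proof. by rewrite /lcoef; case: (split i) => j; rewrite restr0 mcoeff0. Qed.
Lemma lcoef_sum i (J : Type) (r : seq J) (P : pred J) (F : J -> B) :
  lcoef i (\sum_(j <- r | P j) F j) = \sum_(j <- r | P j) lcoef i (F j).
Proof. exact: (big_morph (lcoef i) (lcoefD i) (lcoef0 i)). Qed.
Lemma lcoef_var i j (x : B) : lcoef i (var j * x) = if j == i then aug0 x else 0.
Proof.
have raug side : (restr side x)@_0%MM = aug0 x by exact: restr_coef0.
rewrite /lcoef; case: (split_ordP i) => i' ->; case: (split_ordP j) => j' ->;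
  rewrite ?splitl ?splitr restrM restr_var_B ?restr_varl ?restr_varr
  ?mcoeff_XMU ?mul0r ?mcoeff0 ?raug ?(inj_eq (@lshift_inj _ _))
  ?(inj_eq (@rshift_inj _ _)) ?eq_lrshift ?eq_rlshift //.
Qed.

(** For i in T, the coefficient of the variable of index i in the coordinate
    of the boundary on T minus i is, up to a sign, the constant on T. *)
Lemma koszul_const_inj b (z : K) : (0 < b)%N -> bihom piece b 0 z -> kosB z = 0 -> z = 0.
Proof.
move=> b0 hz z0; apply/ffunP => T; rewrite [RHS]ffunE; have := hz T; case: ifP => // /eqP Tb.
rewrite B_piece0 => -[c _ cE]; rewrite -cE.
have [i iT] : exists i, i \in T by apply/set0Pn; rewrite -card_gt0 Tb.
have : lcoef i (kosB z (T :\ i)) = 0 by rewrite z0 ffunE lcoef0.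
rewrite koszulE lcoef_sum (bigD1 i) ?setD11 //= lcoef_var eqxx setD1K // -cE.
rewrite big1 => [|j /andP[_ ji]]; last by rewrite lcoef_var (negbTE ji).
rewrite addr0 aug0M aug0_const => /eqP; rewrite mulf_eq0 => /orP[|/eqP ->]; last by rewrite rmorph0.
have := ext_signK (@prank n) B i (T :\ i) => /(congr1 (@aug0 n k)).
rewrite aug0M => h /eqP s0; move: h; rewrite s0 mul0r.
by rewrite -(rmorph1 const) aug0_const => /eqP; rewrite eq_sym oner_eq0.
Qed.

Local Notation C := {ffun II * {set II} -> k^o}.

(** The forms with linear coefficients are parametrized by a finite
    dimensional vector space over k. *)
Definition linear_form (zeta : C) : K :=
  [ffun T : {set II} => \sum_i const (zeta (i, T)) * var i].

Lemma linear_formP a (x y : C) :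
  linear_form (a *: x + y) = const a *: linear_form x + linear_form y.
Proof.
apply/ffunP => T; rewrite !ffunE scaler_sumr -big_split; apply: eq_bigr => i _.
have cE (c d : k) : const (a * c + d) = const a * const c + const d.
  by rewrite (rmorphD const) (rmorphM const).
transitivity (const (a * x (i, T) + y (i, T)) * var i); first by rewrite !ffunE.
by rewrite cE mulrDl -mulrA.
Qed.

Lemma linear_form0 : linear_form 0 = 0.
Proof.
by apply/ffunP => T; rewrite !ffunE big1 // => i _; rewrite ffunE rmorph0 mul0r.
Qed.

Lemma linear_form_sum (r : nat) (c : 'I_r -> k) (u : 'I_r -> C) :
  linear_form (\sum_l c l *: u l) = \sum_l const (c l) *: linear_form (u l).
Proof.
elim: r c u => [|r IH] c u; first by rewrite !big_ord0 linear_form0.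
by rewrite !big_ord_recl linear_formP IH.
Qed.

Lemma bihomZ b e c (z : K) : bihom piece b e z -> bihom piece b e (const c *: z).
Proof.
move=> hz T; have := hz T; rewrite ffunE; case: ifP => _; last by move=> ->; rewrite scaler0.
by move=> h; rewrite -[e]add0n; apply: B_pieceM => //; exact: B_piece_const.
Qed.

(** Among the forms with linear coefficients, the boundaries of the constant
    forms are a subspace of the cycles. The h_l form a basis of a complement,
    so they represent a basis of the homology in coefficient degree 1. *)
Lemma koszul_homology_basis b : exists (r : nat) (h : 'I_r -> K),
  [/\ forall l, bihom piece b 1 (h l) /\ kosB (h l) = 0,
      forall z, bihom piece b 1 z -> kosB z = 0 ->
        exists (c : 'I_r -> k) (y : K), bihom piece b.+1 0 y /\
          z = \sum_l const (c l) *: h l + kosB y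
    & forall (c : 'I_r -> k) (y : K), bihom piece b.+1 0 y ->
        \sum_l const (c l) *: h l = kosB y -> forall l, c l = 0].
Proof.
have bh0 b' e : bihom piece b' e 0 by apply: bihom0; exact: piece0.
have bhD b' e x y : bihom piece b' e x -> bihom piece b' e y -> bihom piece b' e (x + y).
  by apply: bihomD; [exact: piece0 | exact: pieceB].
have kP a x y : kosB (a *: x + y) = a *: kosB x + kosB y by exact: koszul_linear.
pose PZ (zeta : C) := bihom piece b 1 (linear_form zeta) /\ kosB (linear_form zeta) = 0.
pose PW (zeta : C) := exists y : K, bihom piece b.+1 0 y /\ linear_form zeta = kosB y.
have [|a x y [x1 x2] [y1 y2]|UZ UZP] := @vspace_of_pred k C PZ.
- by rewrite /PZ linear_form0 raddf0.
- rewrite /PZ linear_formP; split; first exact: bhD (bihomZ a x1) y1.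
  by rewrite kP x2 y2 scaler0 addr0.
have [|a x y [x1 [x2 x3]] [y1 [y2 y3]]|UW UWP] := @vspace_of_pred k C PW.
- by exists 0; rewrite linear_form0 raddf0.
- exists (const a *: x1 + y1); split; first exact: bhD (bihomZ a x2) y2.
  by rewrite linear_formP kP x3 y3.
pose u := vbasis (UZ :\: UW); pose h l := linear_form (tnth u l).
have uZ l : tnth u l \in UZ.
  by apply: (subvP (diffvSl UZ UW)); apply: vbasis_mem; exact: mem_tnth.
exists (\dim (UZ :\: UW)), h; split.
- by move=> l; have /UZP := uZ l.
- move=> z hz z0.
  have /boolp.choice[c cE] (T : {set II}) : exists c : II -> k, z T = \sum_i const (c i) * var i.
    have := hz T; case: ifP => [_ /piece1_span //|_ ->].
    by exists (fun=> 0); rewrite big1 // => i _; rewrite rmorph0 mul0r.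
  pose zeta : C := [ffun iT => c iT.2 iT.1].
  have zE : z = linear_form zeta.
    by apply/ffunP => T; rewrite [RHS]ffunE cE; apply: eq_bigr => i _; rewrite ffunE.
  have zU : zeta \in UZ by apply/UZP; rewrite /PZ -zE.
  move: zU; rewrite -{1}(addv_diff_cap UZ UW) => /memv_addP[x xu [y]].
  move=> /(subvP (capvSr UZ UW))/UWP[y' [hy' yE]] zxy.
  exists (fun l => coord u l x), y'; split=> //.
  rewrite zE zxy -[x]scale1r linear_formP rmorph1 !scale1r yE; congr (_ + _).
  rewrite {1}(coord_vbasis xu) linear_form_sum; apply: eq_bigr => l _.
  by rewrite /h (tnth_nth 0).
- move=> c y hy cy l.
  pose x := \sum_l c l *: tnth u l.
  have xW : x \in UW by apply/UWP; exists y; rewrite linear_form_sum.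
  have xD : x \in (UZ :\: UW)%VS.
    by apply: memv_suml => i _; apply: memvZ; apply: vbasis_mem; exact: mem_tnth.
  have x0 : x = 0.
    apply/eqP; rewrite -memv0 -(capv_diff UZ UW).
    by apply/memv_capP.
  have /freeP := basis_free (vbasisP (UZ :\: UW)); apply.
  by rewrite -[RHS]x0; apply: eq_bigr => i _; rewrite (tnth_nth 0).
Qed.

End AugB.

(** * Vanishing of Tor above the diagonal *)

Section Chase.
Variables (k : fieldType) (R : stdGradedAlg k) (I : finType) (rk : I -> nat).
Hypothesis rk_inj : injective rk.
(** The Koszul complex of R on generators v of degree one is supposed to have
    no homology in coefficient degree at least 3, none in coefficient degree 2
    below exterior degree N, none in coefficient degree 0 and positive
    exterior degree, and finite dimensional homology in coefficient degree 1. *)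
Variables (v : I -> R) (N : nat).
Local Notation rpiece := (sga_piece R : nat -> R^o -> Prop).
Local Notation K := {ffun {set I} -> R^o}.
Local Notation kos := (koszul rk v).
Hypothesis v_piece : forall i, sga_piece R 1%N (v i).
Hypothesis v_gen : forall d r, sga_piece R d.+1 r ->
  exists c : I -> R, (forall i, sga_piece R d (c i)) /\ r = \sum_i v i * c i.
Hypothesis kos_high : forall b e (z : K), (2 <= e)%N -> (e == 2%N) ==> (b < N)%N ->
  bihom rpiece b e z -> kos z = 0 -> exists y : K, bihom rpiece b.+1 e.-1 y /\ z = kos y.
Hypothesis kos_const : forall b (z : K), (0 < b)%N ->
  bihom rpiece b 0 z -> kos z = 0 -> z = 0.
Hypothesis kos_basis : forall b, exists (r : nat) (h : 'I_r -> K),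
  [/\ forall l, bihom rpiece b 1 (h l) /\ kos (h l) = 0,
      forall z, bihom rpiece b 1 z -> kos z = 0 ->
        exists (c : 'I_r -> k) (y : K), bihom rpiece b.+1 0 y /\
          z = \sum_l sga_const R (c l) *: h l + kos y
    & forall (c : 'I_r -> k) (y : K), bihom rpiece b.+1 0 y ->
        \sum_l sga_const R (c l) *: h l = kos y -> forall l, c l = 0].

Lemma rpiece0 d : rpiece d 0. Proof. exact: graded0 (sga_graded R) d. Qed.
Lemma rpieceB d (x y : R^o) : rpiece d x -> rpiece d y -> rpiece d (x - y).
Proof. exact: gradedB (sga_graded R) d x y. Qed.

Lemma hmax_piece d r : sga_piece R d.+1 r -> r \in @hmax k R.
Proof. by move=> h; rewrite -[r]mul1r; apply: mem_ideal_gen; exists d.+1. Qed.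

Lemma hmax_piece0 r : sga_piece R 0%N r -> r \in @hmax k R -> r = 0.
Proof.
rewrite sga_piece0 => -[c _ <-] h; have [->|c0] := eqVneq c 0; first by rewrite rmorph0.
have := @hmaxD k R (sga_const R c^-1) _ _ h (ideal_gen0 _).
by rewrite addr0 -rmorphM mulVf // rmorph1 => h1; case/negP: (hmax1 R).
Qed.

Section OneModule.
Variables (M : gmodule R) (b : gbasis M).
Local Notation X := {ffun {set I} -> M}.
Local Notation mpiece := (gm_piece M : nat -> M -> Prop).

Lemma gm_piece_v i d x : gm_piece M d x -> gm_piece M d.+1 (v i *: x).
Proof. by move=> hx; rewrite -[d.+1]add1n; apply: gm_pieceZ. Qed.

(** The elements of M as forms of exterior degree 0. *)
Definition base (w : M) : X := [ffun S : {set I} => if S == set0 then w else 0].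

Lemma koszul_base w : kos (base w) = 0.
Proof.
apply/ffunP => S; rewrite koszulE [RHS]ffunE big1 // => i iS; rewrite ffunE.
by rewrite -cards_eq0 cardsU1 iS !scaler0.
Qed.

Lemma base_bihom w d : gm_piece M d w -> bihom mpiece 0 d (base w).
Proof. by move=> hw S; rewrite ffunE cards_eq0; case: (S == set0). Qed.

Lemma baseD x y : base (x + y) = base x + base y.
Proof. by apply/ffunP => S; rewrite !ffunE; case: ifP; rewrite ?addr0. Qed.
Lemma base0 : base 0 = 0.
Proof. by apply/ffunP => S; rewrite !ffunE if_same. Qed.
Lemma baseZ a x : base (a *: x) = a *: base x.
Proof. by apply/ffunP => S; rewrite !ffunE; case: ifP; rewrite ?scaler0. Qed.

Lemma coord_in_max x m : in_max m -> gb_coord (g := b) x m \in @hmax k R.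
Proof.
move=> [s [hs ->]]; elim: s hs => [|z s IH] hs.
  by rewrite big_nil gb_coord0; exact: ideal_gen0.
rewrite big_cons gb_coord_linear mulrC.
apply: (@hmaxD k R); first by apply: hs; rewrite mem_head.
by apply: IH => y ys; apply: hs; rewrite inE ys orbT.
Qed.

(** The variables generate the maximal ideal, and a coordinate in the maximal
    ideal has no constant term. *)
Lemma in_max_gen d m : in_max m -> gm_piece M d.+1 m ->
  exists w : I -> M, (forall i, gm_piece M d (w i)) /\ m = \sum_i v i *: w i.
Proof.
move=> hm mp.
have /boolp.choice[c cP] (x : gb_index b) : exists c : I -> R,
    gb_coord x m = \sum_i v i * c i /\ forall i, gm_piece M d (c i *: gb_elt x).
  have := gb_coord_piece x mp; case: ifP => [dx|_ ->]; last first.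
    exists (fun=> 0); split=> [|i]; first by rewrite big1 // => i _; rewrite mulr0.
    by rewrite scale0r; exact: gm_piece0.
  case E : (d.+1 - gb_deg x)%N => [|e] hx.
    rewrite (hmax_piece0 hx (coord_in_max x hm)).
    exists (fun=> 0); split=> [|i]; first by rewrite big1 // => i _; rewrite mulr0.
    by rewrite scale0r; exact: gm_piece0.
  have [c [hc ->]] := v_gen hx; exists c; split=> // i.
  have -> : d = (e + gb_deg x)%N by lia.
  by apply: gm_pieceZ => //; exact: gb_elt_piece.
exists (fun i => \sum_(x <- gb_supp b m) c x i *: gb_elt x); split=> [i|].
  by apply: gm_piece_sum => x _; case: (cP x).
rewrite {1}(gb_expand b m).
rewrite [RHS](eq_bigr (fun i => \sum_(x <- gb_supp b m) v i *: (c x i *: gb_elt x)));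
  last by move=> i _; rewrite scaler_sumr.
rewrite exchange_big /=; apply: eq_bigr => x _; have [-> _] := cP x.
by rewrite scaler_suml; apply: eq_bigr => i _; rewrite scalerA.
Qed.

Lemma in_max_koszul d m : in_max m -> gm_piece M d.+1 m ->
  exists y : X, bihom mpiece 1 d y /\ kos y = base m.
Proof.
move=> hm mp; have [w [hw ->]] := in_max_gen hm mp.
exists (\sum_i wedge rk i (base (w i))); split.
  apply: bihom_sum => [|d' x y|i _]; [exact: gm_piece0|exact: gm_pieceB|].
  by apply: wedge_bihom => //; [exact: gm_piece0 | exact: gm_pieceB | exact: base_bihom].
rewrite raddf_sum (big_morph base baseD base0); apply: eq_bigr => i _ /=.
have := koszul_wedge rk_inj v i (base (w i)).
by rewrite koszul_base raddf0 addr0 => ->; rewrite baseZ.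
Qed.

Lemma koszul_in_max (y : X) : in_max (kos y set0).
Proof.
exists [seq (v i, ext_sign rk R i set0 *: y (i |: set0)) | i <- enum I]; split.
  by move=> z /mapP[i _ ->] /=; exact: (hmax_piece (v_piece i)).
rewrite koszulE big_map big_enum /=; apply: eq_bigl => i.
by rewrite inE.
Qed.

Definition tensor_form (h : K) (g : M) : X := [ffun S : {set I} => (h S : R) *: g].

Lemma koszul_tensor_form h g : kos (tensor_form h g) = tensor_form (kos h) g.
Proof.
apply/ffunP => S; rewrite koszulE [RHS]ffunE koszulE scaler_suml.
by apply: eq_bigr => i _; rewrite ffunE !scalerA.
Qed.

Lemma tensor_form0l g : tensor_form 0 g = 0.
Proof. by apply/ffunP => S; rewrite !ffunE scale0r. Qed.
Lemma tensor_form0r h : tensor_form h 0 = 0.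
Proof. by apply/ffunP => S; rewrite !ffunE scaler0. Qed.
Lemma tensor_formDr h g g' : tensor_form h (g + g') = tensor_form h g + tensor_form h g'.
Proof. by apply/ffunP => S; rewrite !ffunE scalerDr. Qed.
Lemma tensor_formDl h h' g : tensor_form (h + h') g = tensor_form h g + tensor_form h' g.
Proof. by apply/ffunP => S; rewrite !ffunE scalerDl. Qed.
Lemma tensor_formZr h a g : tensor_form h (a *: g) = a *: tensor_form h g.
Proof. by apply/ffunP => S; rewrite !ffunE !scalerA mulrC. Qed.
Lemma tensor_formZl h a g : tensor_form (a *: h) g = tensor_form h (a *: g).
Proof. by apply/ffunP => S; rewrite !ffunE !scalerA mulrC. Qed.

Lemma tensor_form_bihom c e d h g : bihom rpiece c e h -> gm_piece M d g ->
  bihom mpiece c (e + d) (tensor_form h g).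
Proof.
move=> hh hg S; rewrite ffunE; have := hh S; case: ifP => _; last by move=> ->; rewrite scale0r.
by move=> hS; apply: gm_pieceZ.
Qed.

(** The maximal ideal annihilates the Koszul homology: by [koszul_wedge], v_i
    h is the boundary of h wedge e_i when h is a cycle. *)
Lemma tensor_form_max c d h g : bihom rpiece c 1 h -> kos h = 0 ->
  in_max g -> gm_piece M d.+1 g ->
  exists y : X, bihom mpiece c.+1 d.+1 y /\ tensor_form h g = kos y.
Proof.
move=> hh h0 mg pg; have [w [hw ->]] := in_max_gen mg pg.
exists (\sum_i wedge rk i (tensor_form h (w i))); split.
  apply: bihom_sum => [|d' x y|i _]; [exact: gm_piece0|exact: gm_pieceB|].
  apply: wedge_bihom; [exact: gm_piece0|exact: gm_pieceB|].
  by rewrite -[d.+1]add1n; apply: tensor_form_bihom.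
rewrite raddf_sum (big_morph _ (tensor_formDr h) (tensor_form0r h)); apply: eq_bigr => i _ /=.
have := koszul_wedge rk_inj v i (tensor_form h (w i)).
by rewrite koszul_tensor_form h0 tensor_form0l raddf0 addr0 => ->; rewrite tensor_formZr.
Qed.

Lemma ext_expand (z : X) : exists s : seq (gb_index b), uniq s /\
  forall t, uniq t -> {subset s <= t} ->
  z = \sum_(x <- t) tensor_form (ext_map (gb_coord x : {linear M -> R^o}) z) (gb_elt x).
Proof.
exists (undup (flatten [seq gb_supp b (z U) | U : {set I}])); split; first exact: undup_uniq.
move=> t ut st; apply/ffunP => S; rewrite sum_ffunE.
rewrite {1}(gb_expand b (z S)) -(gb_sum_widen _ ut) => [|x xs].
  by apply: eq_bigr => x _; rewrite !ffunE.
apply: st; rewrite mem_undup; apply/flattenP; exists (gb_supp b (z S)) => //.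
by apply/mapP; exists S; rewrite ?mem_enum.
Qed.

Lemma coord_bihom c e (z : X) (x : gb_index b) : bihom mpiece c e z ->
  if (gb_deg x <= e)%N
  then bihom rpiece c (e - gb_deg x) (ext_map (gb_coord x : {linear M -> R^o}) z)
  else ext_map (gb_coord x : {linear M -> R^o}) z = 0.
Proof.
move=> hz; case: ifP => dx.
  move=> S; rewrite ffunE /=; have := hz S; case: ifP => _; last by move=> ->; exact: gb_coord0.
  by move/(gb_coord_piece x); rewrite dx.
apply/ffunP => S; rewrite !ffunE /=; have := hz S; case: ifP => _.
  by move/(gb_coord_piece x); rewrite dx.
by move=> ->; exact: gb_coord0.
Qed.

Lemma coord_cycle (z : X) (x : gb_index b) : kos z = 0 ->
  kos (ext_map (gb_coord x : {linear M -> R^o}) z) = 0.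
Proof. by move=> z0; rewrite -ext_map_koszul z0 raddf0. Qed.
End OneModule.

Lemma hom_preimage (M M' : gmodule R) (f : {linear M -> M'}) j x y :
  (forall d z, gm_piece M d z -> gm_piece M' d (f z)) ->
  gm_piece M' j x -> f y = x -> exists y', gm_piece M j y' /\ f y' = x.
Proof.
move=> fd hx fy; have [L [g [hg yE]]] := graded_span (gm_graded M) y.
have := @graded_comp_eq _ _ (gm_graded M') L j (fun d => f (g d)) x (fun d => fd d _ (hg d)) hx.
rewrite -raddf_sum -yE => /(_ (esym fy)); case: ifP => _ ->.
  by exists (g j).
by exists 0; rewrite raddf0; split=> //; exact: gm_piece0.
Qed.

(** A preimage is chosen for each coordinate of the form. *)
Lemma ext_preimage (M M' : gmodule R) (f : {linear M -> M'}) b e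
    (z : {ffun {set I} -> M'}) :
  (forall d x, gm_piece M d x -> gm_piece M' d (f x)) ->
  (forall S, exists y, f y = z S) -> bihom (gm_piece M') b e z ->
  exists y, bihom (gm_piece M) b e y /\ ext_map f y = z.
Proof.
move=> fd hf hz.
have /boolp.choice[y yP] (S : {set I}) : exists y, (if #|S| == b then gm_piece M e y else y = 0)
    /\ f y = z S.
  have := hz S; case: ifP => _ h; last by exists 0; rewrite raddf0 h.
  by have [y fy] := hf S; exact: hom_preimage fd h fy.
exists [ffun S => y S]; split; first by move=> S; rewrite ffunE; case: (yP S).
by apply/ffunP => S; rewrite !ffunE; case: (yP S).
Qed.

Section Resolution.
Variable F : graded_free_resolution (residue_gmodule R).
Local Notation X a := {ffun {set I} -> F a}.
Local Notation bih a := (bihom (gm_piece (F a))).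
Local Notation D a := (ext_map (res_d F a)).

Lemma res_dd a x : res_d F a (res_d F a.+1 x) = 0.
Proof. by have [_ h] := res_exactS (res_d F a.+1 x); apply: h; exists x. Qed.
Lemma res_augd x : res_aug F (res_d F 0 x) = 0.
Proof. by have [_ h] := res_exact0 (res_d F 0 x); apply: h; exists x. Qed.

Lemma ext_dd a (z : X a.+2) : D a (D a.+1 z) = 0.
Proof. by apply/ffunP => S; rewrite !ffunE res_dd. Qed.

(** The kernel of the differential of the resolution, or of the augmentation
    in homological degree 0. *)
Definition dclosed (a : nat) : X a -> Prop :=
  match a with
  | 0 => fun z => ext_map (res_aug F) z = 0
  | a'.+1 => fun z => D a' z = 0
  end.

Lemma dclosed_d a (z : X a.+1) : dclosed (D a z).
Proof.
case: a z => [|a] z /=; last exact: ext_dd.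
by apply/ffunP => S; rewrite !ffunE res_augd.
Qed.

Lemma dclosed_lift a b e (z : X a) : dclosed z -> bih a b e z ->
  exists y : X a.+1, bih a.+1 b e y /\ D a y = z.
Proof.
move=> dz hz; apply: ext_preimage => //; first exact: res_d_deg.
move=> S; case: a z dz hz => [|a] z dz hz.
  have [h _] := res_exact0 (z S); apply: h.
  by have := congr1 (fun f : {ffun _ -> _} => f S) dz; rewrite !ffunE.
have [h _] := res_exactS (z S); apply: h.
by have := congr1 (fun f : {ffun _ -> _} => f S) dz; rewrite !ffunE.
Qed.

Lemma dclosed_pos b e (z : X 0) : bih 0 b e.+1 z -> dclosed z.
Proof.
move=> hz; apply/ffunP => S; rewrite !ffunE; have := hz S; case: ifP => _.
  by move/(res_aug_deg).
by move=> ->; rewrite raddf0.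
Qed.

(** Tor_i(k, k)_j = 0, in the form given by [Tor_elements]. *)
Definition vanish (i j : nat) := forall m : F i, gm_piece (F i) j m -> cycle_mod_max m ->
  exists m', gm_piece (F i.+1) j m' /\ in_max (m - res_d F i m').

Lemma bihB a b e (x y : X a) : bih a b e x -> bih a b e y -> bih a b e (x - y).
Proof. by apply: bihomB => //; [exact: gm_pieceB]. Qed.
Lemma bihD a b e (x y : X a) : bih a b e x -> bih a b e y -> bih a b e (x + y).
Proof. by apply: bihomD => //; [exact: gm_piece0 | exact: gm_pieceB]. Qed.
Lemma bih_sum a b e (J : Type) (r : seq J) (Q : pred J) (G : J -> X a) :
  (forall j, Q j -> bih a b e (G j)) -> bih a b e (\sum_(j <- r | Q j) G j).
Proof. by apply: bihom_sum => //; [exact: gm_piece0 | exact: gm_pieceB]. Qed.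
Lemma bih0 a b e : bih a b e (0 : X a).
Proof. by apply: bihom0; exact: gm_piece0. Qed.
Lemma bih_koszul a b e (z : X a) : bih a b.+1 e z -> bih a b e.+1 (kos z).
Proof.
apply: koszul_bihom; [exact: gm_piece0|exact: gm_pieceB|].
by move=> i d x; exact: gm_piece_v.
Qed.
Lemma bih_d a b e (z : X a.+1) : bih a.+1 b e z -> bih a b e (D a z).
Proof.
move=> hz S; rewrite ffunE; have := hz S; case: ifP => _; first exact: res_d_deg.
by move=> ->; rewrite raddf0.
Qed.

Lemma ext_map_tensor (M M' : gmodule R) (f : {linear M -> M'}) (h : K) (g : M) :
  ext_map f (tensor_form h g) = tensor_form h (f g).
Proof. by apply/ffunP => S; rewrite !ffunE linearZ. Qed.

(** The coordinates of z in a basis of F_0 are Koszul cycles. On a basis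
    element of degree 0 the coordinate has coefficient degree e, so it is a
    Koszul boundary; a basis element of positive degree is killed by the
    augmentation, so it is the differential of some t, and the coordinate
    times t contributes to c. *)
Lemma split_cycle0 b e (z : X 0) : (1 < e)%N -> (e == 2%N) ==> (b < N)%N ->
    bih 0 b e z -> kos z = 0 ->
  exists (y : X 0) (c : X 1), [/\ bih 0 b.+1 e.-1 y, bih 1 b e c, kos c = 0 & z = kos y + D 0 c].
Proof.
move=> e1 eN hz z0; have [bs] := graded_freeP (res_free F 0).
have [s [us /(_ _ us)zE]] := ext_expand bs z.
pose zx (x : gb_index bs) := ext_map (gb_coord x : {linear F 0 -> R^o}) z.
have step (x : gb_index bs) : exists yc : X 0 * X 1,
  [/\ bih 0 b.+1 e.-1 yc.1, bih 1 b e yc.2, kos yc.2 = 0 &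
    tensor_form (zx x) (gb_elt x) = kos yc.1 + D 0 yc.2].
  have := coord_bihom x hz; case: (leqP (gb_deg x) e) => [dx|dx] hx; last first.
    exists (0, 0) => /=; rewrite /zx hx tensor_form0l !raddf0 addr0; split=> //; exact: bih0.
  have kx : kos (zx x) = 0 by exact: coord_cycle.
  case E : (gb_deg x) => [|d].
    move: hx; rewrite E subn0 => hx.
    have [y [hy yE]] := kos_high e1 eN hx kx.
    exists (tensor_form y (gb_elt x), 0) => /=; split; [|exact: bih0|exact: raddf0|].
      rewrite -[e.-1]addn0; apply: tensor_form_bihom => //.
      by have := gb_elt_piece x; rewrite E.
    by rewrite raddf0 addr0 koszul_tensor_form -yE.
  have aug0 : res_aug F (gb_elt x) = 0.
    by have := res_aug_deg (gb_elt_piece x); rewrite E.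
  have [/(_ aug0)[t dt] _] := res_exact0 (gb_elt x).
  have [t' [ht' dt']] := hom_preimage (@res_d_deg _ _ _ F 0) (gb_elt_piece x) dt.
  exists (0, tensor_form (zx x) t') => /=; split; [exact: bih0| | |].
  - by rewrite -(subnK dx); apply: tensor_form_bihom.
  - by rewrite koszul_tensor_form kx tensor_form0l.
  - by rewrite raddf0 add0r ext_map_tensor dt'.
have /boolp.choice[yc ycP] := step.
exists (\sum_(x <- s) (yc x).1), (\sum_(x <- s) (yc x).2); split.
- by apply: bih_sum => x _; case: (ycP x).
- by apply: bih_sum => x _; case: (ycP x).
- by rewrite raddf_sum big1 //= => x _; case: (ycP x).
rewrite {1}zE // !raddf_sum -big_split; apply: eq_bigr => x _.
by case: (ycP x).
Qed.

(** The coordinates of z in a basis of F_(a+1) are Koszul cycles, hence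
    boundaries up to linear cycles: z = kos y + sum_l h_l g_l, where the h_l
    are a basis of the linear Koszul homology. The coefficient g_l has degree
    e - 1. Since D z = 0, the sum of the h_l times d g_l is a boundary, and
    the independence of the h_l forces d g_l to have no constant coordinate,
    that is to lie in hmax. By the vanishing of Tor, g_l is a differential
    modulo hmax, and [tensor_form_max] turns the error into a boundary. *)
Lemma split_cycleS a b e (z : X a.+1) : (0 < b)%N -> (b < N)%N -> (1 < e)%N ->
    vanish a.+1 e.-1 -> bih a.+1 b e z -> kos z = 0 -> D a z = 0 ->
  exists (y : X a.+1) (c : X a.+2),
    [/\ bih a.+1 b.+1 e.-1 y, bih a.+2 b e c, kos c = 0 & z = kos y + D a.+1 c].
Proof.
move=> b0 bN e1 van hz z0 dz; have [bs] := graded_freeP (res_free F a.+1).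
have [s [us /(_ _ us)zE]] := ext_expand bs z.
have [r [h [hP hgen hind]]] := kos_basis b.
pose zx (x : gb_index bs) := ext_map (gb_coord x : {linear F a.+1 -> R^o}) z.
have step (x : gb_index bs) : exists yc : X a.+1 * ('I_r -> k),
  [/\ bih a.+1 b.+1 e.-1 yc.1,
      forall l, gm_piece (F a.+1) e.-1 (sga_const R (yc.2 l) *: gb_elt x) &
    tensor_form (zx x) (gb_elt x) =
      kos yc.1 + \sum_l tensor_form (h l) (sga_const R (yc.2 l) *: gb_elt x)].
  have zero : zx x = 0 -> exists yc : X a.+1 * ('I_r -> k),
    [/\ bih a.+1 b.+1 e.-1 yc.1,
      forall l, gm_piece (F a.+1) e.-1 (sga_const R (yc.2 l) *: gb_elt x) &
    tensor_form (zx x) (gb_elt x) =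
      kos yc.1 + \sum_l tensor_form (h l) (sga_const R (yc.2 l) *: gb_elt x)].
    move=> ->; exists (0, fun=> 0) => /=; split; first exact: bih0.
      by move=> l; rewrite rmorph0 scale0r; exact: gm_piece0.
    rewrite tensor_form0l raddf0 add0r big1 // => l _.
    by rewrite rmorph0 scale0r tensor_form0r.
  have := coord_bihom x hz; case: (leqP (gb_deg x) e) => [dx|dx] hx; last exact: zero.
  have kx : kos (zx x) = 0 by exact: coord_cycle.
  case E : (e - gb_deg x)%N => [|[|d]].
  - by apply: zero; rewrite E in hx; exact: kos_const hx kx.
  - rewrite E in hx; have [c [y [hy yE]]] := hgen _ hx kx.
    have dxe : gb_deg x = e.-1 by lia.
    exists (tensor_form y (gb_elt x), c) => /=; split.
    + rewrite -[e.-1]add0n -dxe; apply: tensor_form_bihom => //; exact: gb_elt_piece.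
    + move=> l; rewrite -[e.-1]add0n -dxe; apply: gm_pieceZ; last exact: gb_elt_piece.
      by rewrite sga_piece0; exists (c l).
    + rewrite (yE : zx x = _) addrC tensor_formDl koszul_tensor_form; congr (_ + _).
      rewrite (big_morph (fun u => tensor_form u (gb_elt x))
        (fun u u' => tensor_formDl u u' _) (tensor_form0l _)).
      by apply: eq_bigr => l _; rewrite tensor_formZl.
  - have e2 : (1 < e - gb_deg x)%N by rewrite E.
    have eN : ((e - gb_deg x)%N == 2%N) ==> (b < N)%N by rewrite bN implybT.
    have [y [hy yE]] := kos_high e2 eN hx kx.
    exists (tensor_form y (gb_elt x), fun=> 0) => /=; split.
    + have -> : e.-1 = ((e - gb_deg x).-1 + gb_deg x)%N by lia.
      by apply: tensor_form_bihom => //; exact: gb_elt_piece.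
    + by move=> l; rewrite rmorph0 scale0r; exact: gm_piece0.
    + rewrite (yE : zx x = _) koszul_tensor_form [Y in _ + Y]big1 ?addr0 // => l _.
      by rewrite rmorph0 scale0r tensor_form0r.
have /boolp.choice[yc ycP] := step.
pose y := \sum_(x <- s) (yc x).1.
pose g l := \sum_(x <- s) sga_const R ((yc x).2 l) *: gb_elt x.
have hy : bih a.+1 b.+1 e.-1 y by apply: bih_sum => x _; case: (ycP x).
have hg l : gm_piece (F a.+1) e.-1 (g l).
  by apply: gm_piece_sum => x _; case: (ycP x).
have zyg : z = kos y + \sum_l tensor_form (h l) (g l).
  rewrite {1}zE // raddf_sum /=.
  rewrite [Y in _ + Y](eq_bigr (fun l => \sum_(x <- s) tensor_form (h l)
    (sga_const R ((yc x).2 l) *: gb_elt x))) => [|l _]; last first.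
    rewrite /g (big_morph (tensor_form (h l)) (tensor_formDr (h l)) (tensor_form0r _ (h l))) //.
  rewrite [Y in _ + Y]exchange_big -big_split; apply: eq_bigr => x _.
  by case: (ycP x).
(* The coordinates of d g_l on basis elements of degree e - 1 are constants
   c_l, and the c_l are the coefficients of a linear relation between the h_l
   in homology. *)
have dg l : in_max (res_d F a (g l)).
  have [bs'] := graded_freeP (res_free F a).
  exists [seq (gb_coord x (res_d F a (g l)), gb_elt x) | x <- gb_supp bs' (res_d F a (g l))].
  split; last by rewrite big_map -gb_expand.
  move=> u /mapP[x _ ->] /=.
  have hx j : _ := gb_coord_piece x (res_d_deg (hg j)).
  have := hx l; case: (ltngtP (gb_deg x) e.-1) => [dx|dx|dx].
  - rewrite -(subnSK dx); exact: hmax_piece.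
  - by move=> ->; exact: ideal_gen0.
  rewrite dx subnn => hxl.
  have /boolp.choice[c cE] j : exists c : k, sga_const R c = gb_coord x (res_d F a (g j)).
    have := hx j; rewrite dx leqnn subnn sga_piece0 => -[c _ <-]; by exists c.
  have hb : bihom rpiece b.+1 0 (- ext_map (gb_coord x : {linear F a -> R^o}) (D a y)).
    have := coord_bihom x (bih_d hy); rewrite dx leqnn subnn => hh.
    rewrite -sub0r; apply: bihomB => //; first exact: rpieceB.
    by apply: bihom0; exact: rpiece0.
  have heq : \sum_l sga_const R (c l) *: h l
      = kos (- ext_map (gb_coord x : {linear F a -> R^o}) (D a y)).
    rewrite raddfN /= -!ext_map_koszul; apply/eqP; rewrite -addr_eq0 addrC; apply/eqP.
    have E0 := congr1 (fun u => ext_map (gb_coord x : {linear F a -> R^o}) (D a u)) zyg.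
    rewrite /= dz !raddf0 2!raddfD /= in E0; rewrite [RHS]E0; congr (_ + _).
    rewrite !raddf_sum /=; apply: eq_bigr => j _; rewrite ext_map_tensor cE.
    by apply/ffunP => S; rewrite !ffunE /= linearZ /=; exact: mulrC.
  by rewrite -cE (hind _ _ hb heq l) rmorph0; exact: ideal_gen0.
have /boolp.choice[g' g'P] l : exists g', gm_piece (F a.+2) e.-1 g' /\
    in_max (g l - res_d F a.+1 g').
  exact: van (hg l) (dg l).
case: e e1 van hz zE step yc ycP y g hy hg zyg dg g' g'P => [|[|e]] //= _ _ hz _ _ yc _ y g hy hg zyg _ g' g'P.
have /boolp.choice[y' y'P] l : exists y' : X a.+1, bih a.+1 b.+1 e.+1 y' /\
    tensor_form (h l) (g l - res_d F a.+1 (g' l)) = kos y'.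
  have [hg' mg'] := g'P l; have [hl hl0] := hP l.
  by apply: tensor_form_max => //; apply: gm_pieceB => //; exact: res_d_deg.
exists (y + \sum_l y' l), (\sum_l tensor_form (h l) (g' l)); split.
- by apply: bihD => //; apply: bih_sum => l _; case: (y'P l).
- apply: bih_sum => l _; rewrite -[e.+2]add1n; apply: tensor_form_bihom.
    by case: (hP l).
  by case: (g'P l).
- rewrite raddf_sum big1 //= => l _; rewrite koszul_tensor_form.
  by have [_ ->] := hP l; rewrite tensor_form0l.
rewrite {1}zyg raddfD /= -addrA; congr (_ + _).
rewrite !raddf_sum -big_split; apply: eq_bigr => l _ /=.
have [_ <-] := y'P l; rewrite ext_map_tensor -tensor_formDr.
by rewrite subrK.
Qed.

(** The last inequality is stronger at a + b = N because the descent then ends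
    in F_0 with exterior degree N, where the Koszul homology of coefficient
    degree 2 may be nonzero. *)
Definition acyclic_range (a b e : nat) :=
  ((a + b < N)%N && (a.+1 < e)%N) || ((a + b == N)%N && (a.+2 < e)%N).

(** Write z = kos y + D c by [split_cycle0] or [split_cycleS]. If a = 0, then
    y has positive degree, so it is the differential of some y', and kos y' +
    c lifts z. If a > 0, the same holds after y has been modified by a Koszul
    cycle x that makes it closed; such an x lifts D y, and it is found by
    induction, with a smaller by one, exterior degree larger by one and
    coefficient degree smaller by one. *)
Lemma koszul_cycle_lift a : forall b e (z : X a), (0 < b)%N -> acyclic_range a b e ->
    (forall a' j, (0 < a' <= a)%N -> (a' < j)%N -> vanish a' j) ->
    bih a b e z -> kos z = 0 -> dclosed z ->
  exists x : X a.+1, [/\ bih a.+1 b e x, kos x = 0 & D a x = z].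
Proof.
elim: a => [|a IH] b e z b0 /orP hr van hz z0 dz.
  have e1 : (1 < e)%N by case: hr => /andP[]; lia.
  have eN : (e == 2%N) ==> (b < N)%N by apply/implyP => ?; case: hr => /andP[]; lia.
  have [y [c [hy hc c0 zE]]] := split_cycle0 e1 eN hz z0.
  case: e e1 hy hz hc {hr eN} => [|[|e]] //= _ hy hz hc.
  have [y' [hy' dy']] := dclosed_lift (dclosed_pos hy) hy.
  exists (kos y' + c); split.
  - by apply: bihD => //; exact: bih_koszul.
  - by rewrite raddfD /= koszul_koszul // c0 addr0.
  - by rewrite raddfD /= ext_map_koszul dy' zE.
have e1 : (a.+2 < e)%N by case: hr => /andP[]; lia.
have bN : (b < N)%N by case: hr => /andP[]; lia.
have e2 : (1 < e)%N by lia.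
have vanS : vanish a.+1 e.-1 by apply: van; lia.
have [y [c [hy hc c0 zE]]] := split_cycleS b0 bN e2 vanS hz z0 dz.
have dyk : kos (D a y) = 0.
  have := congr1 (fun u => D a u) zE; rewrite /= (dz : D a z = 0) raddfD /= ext_dd addr0.
  by rewrite ext_map_koszul.
have hr' : acyclic_range a b.+1 e.-1.
  by apply/orP; case: hr => /andP[h1 h2]; [left|right]; apply/andP; split; lia.
have van' a' j : (0 < a' <= a)%N -> (a' < j)%N -> vanish a' j.
  by move=> /andP[h1 h2]; apply: van; rewrite h1 ltnW.
have [x [hx x0 dx]] := IH b.+1 e.-1 (D a y) isT hr' van' (bih_d hy) dyk (dclosed_d y).
have dyx : dclosed (y - x) by rewrite /= raddfB /= dx subrr.
have [y' [hy' dy']] := dclosed_lift dyx (bihB hy hx).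
case: e e1 e2 hy' hc {hr hr' vanS hz hy hx} => [|e] //= _ _ hy' hc.
exists (kos y' + c); split.
- by apply: bihD => //; exact: bih_koszul.
- by rewrite raddfD /= koszul_koszul // c0 addr0.
- by rewrite raddfD /= ext_map_koszul dy' raddfB /= x0 subr0 zE.
Qed.

(** If m and the Koszul boundary kos y differ by a cycle of the resolution,
    then m = d m' + kos y, and kos y has coefficients in the maximal ideal. *)
Lemma vanish_of_koszul i j (m : F i) (y : X i) : (0 < j)%N ->
  gm_piece (F i) j m -> bih i 1 j.-1 y -> dclosed (base m - kos y) ->
  exists m', gm_piece (F i.+1) j m' /\ in_max (m - res_d F i m').
Proof.
case: j => // j _ hm hy dm.
have hc : bih i 0 j.+1 (base m - kos y).
  by apply: bihB; [exact: base_bihom | exact: bih_koszul].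
have [u [hu du]] := dclosed_lift dm hc.
exists (u set0); split; first by have := hu set0; rewrite cards0 eqxx.
have -> : m - res_d F i (u set0) = kos y set0; last exact: koszul_in_max.
have := congr1 (fun f : {ffun _ -> _} => f set0) du.
by rewrite !ffunE eqxx => ->; rewrite opprB addrC subrK.
Qed.

Lemma ext_map_base (M M' : gmodule R) (f : {linear M -> M'}) w :
  ext_map f (base w) = base (f w).
Proof. by apply/ffunP => S; rewrite !ffunE; case: (S == set0); rewrite ?raddf0. Qed.

(** Since d m lies in hmax, it is the Koszul boundary of a form y of exterior
    degree 1. By [koszul_cycle_lift] applied to D y, whose hypotheses hold by
    induction on i, one may correct y by a Koszul cycle so that y = D y'. Then
    m - kos y' is a cycle of the resolution. *)
Lemma vanish_high i j : ((i <= N)%N && (i < j)%N) || ((i == N.+1) && (N.+2 < j)%N) ->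
  vanish i j.
Proof.
have [l] := ubnP i; elim: l i j => // l IH i j il hr m hm cm.
case: i il hr m hm cm => [|i] il hr m hm cm.
  have dm : res_aug F m = 0.
    have := res_aug_deg hm; have : (0 < j)%N by case/orP: hr => /andP[]; lia.
    by case: (j).
  have [/(_ dm)[y dy] _] := res_exact0 m.
  have [m' [hm' dm']] := hom_preimage (@res_d_deg _ _ _ F 0) hm dy.
  by exists m'; split=> //; exists [::]; rewrite dm' subrr big_nil.
have j2 : (i.+1 < j)%N by case/orP: hr => /andP[]; lia.
case: j j2 hr hm => [|[|j]] // j2 hr hm.
have [b0] := graded_freeP (res_free F i).
have [y [hy yE]] := in_max_koszul b0 cm (res_d_deg hm).
suff [y' [hy' dy']] : exists y' : X i.+1, bih i.+1 1 j.+1 y' /\ kos (D i y') = base (res_d F i m).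
  apply: (vanish_of_koszul (y := y')) => //=.
  by rewrite raddfB /= ext_map_base ext_map_koszul dy' subrr.
case: i il j2 hr m hm cm b0 y hy yE => [|i] il j2 hr m hm cm b0 y hy yE.
  have [y' [hy' dy']] := dclosed_lift (dclosed_pos hy) hy.
  by exists y'; rewrite dy'.
have ky : kos (D i y) = 0.
  by rewrite -ext_map_koszul yE ext_map_base res_dd base0.
have hr' : acyclic_range i 1 j.+1.
  by apply/orP; case/orP: hr => /andP[h1 h2]; [left|right]; apply/andP; split; lia.
have van' a' j' : (0 < a' <= i)%N -> (a' < j')%N -> vanish a' j'.
  move=> /andP[_ h1] h2; apply: IH; first by lia.
  by rewrite h2 andbT; case/orP: hr => /andP[]; lia.
have [x [hx x0 dx]] := @koszul_cycle_lift i 1%N j.+1 (D i y) isT hr' van' (bih_d hy) ky (dclosed_d y).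
have dyx : dclosed (y - x) by rewrite /= raddfB /= dx subrr.
have [y' [hy' dy']] := dclosed_lift dyx (bihB hy hx).
by exists y'; rewrite dy' raddfB /= x0 subr0.
Qed.

End Resolution.

Lemma Tor_residue_high i j : ((i <= N)%N && (i < j)%N) || ((i == N.+1) && (N.+2 < j)%N) ->
  ~ Tor_residue_neq0 R i j.
Proof.
move=> hr [F [s [hs cs]]]; apply; apply: Tor_elements cs _ => // m hm cm.
exact: vanish_high hr m hm cm.
Qed.

End Chase.

(** * Upper bounds for the degrees of Tor over B *)

Section UpperBound.
Variables (n : nat) (k : fieldType).
Hypothesis n_gt1 : (1 < n)%N.
Hypothesis small_unit : forall r, (0 < r)%N -> (r.*2 <= n.+1)%N -> r%:R != 0 :> k.
Local Notation B := (B_ring n k).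
Local Notation R := (algB n k).
Local Notation II := 'I_(n + n).
Local Notation var := (@var n k : II -> B).
Local Notation piece := (@B_piece n k : nat -> B^o -> Prop).
Local Notation kosB := (koszul (@prank n) var).

(** In degree at least 2, an element of B is a Koszul cycle of exterior degree
    0, and a primitive of it is an expansion in the variables. *)
Lemma piece_gen d (r : B) : piece d.+1 r ->
  exists c : II -> B, (forall i, piece d (c i)) /\ r = \sum_i var i * c i.
Proof.
case: d => [|d] hr.
  have [c ->] := piece1_span hr; exists (fun i => B_const n k (c i)); split.
    by move=> i; exact: B_piece_const.
  by apply: eq_bigr => i _; rewrite mulrC.
pose z : {ffun {set II} -> B^o} := [ffun S : {set II} => if S == set0 then r else 0].
have hz : bihom piece 0 d.+2 z by move=> S; rewrite ffunE cards_eq0; case: (S == set0).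
have z0 : kosB z = 0.
  apply/ffunP => S; rewrite koszulE [RHS]ffunE big1 // => i iS; rewrite ffunE.
  by rewrite -cards_eq0 cardsU1 iS !scaler0.
have e2 : (2 <= d.+2)%N by [].
have n0 : (d.+2 == 2%N) ==> (0 < n)%N by rewrite (ltnW n_gt1) implybT.
have [y [hy yE]] := koszul_B_exact n_gt1 small_unit e2 n0 hz z0.
exists (fun i => ext_sign (@prank n) B i set0 * y (i |: set0)); split=> [i|].
  have := hy (i |: set0); rewrite cardsU1 inE cards0 eqxx /= => hi.
  case: (ext_sign_or (@prank n) B i set0) => ->; first by rewrite mul1r.
  by rewrite mulN1r; exact: B_piece_opp.
have := congr1 (fun f : {ffun _ -> _} => f set0) yE; rewrite ffunE eqxx koszulE => ->.
by apply: eq_bigl => i; rewrite inE.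
Qed.

Lemma Tor_B_high i j : ((i <= n)%N && (i < j)%N) || ((i == n.+1) && (n.+2 < j)%N) ->
  ~ Tor_residue_neq0 R i j.
Proof.
apply: (@Tor_residue_high k R _ (@prank n) (@prank_inj n) var n).
- exact: B_piece_var.
- exact: piece_gen.
- exact: koszul_B_exact n_gt1 small_unit.
- exact: koszul_const_inj.
- exact: koszul_homology_basis.
Qed.

End UpperBound.

(** * A test module over B *)

Section TestModule.
Variables (n : nat) (k : fieldType).
Local Notation S := {mpoly k[n]}.
Local Notation B := (B_ring n k).
Local Notation mon := (multinom n).
Local Notation X_ m := (mpolyX k m : S).
Local Notation II := 'I_(n + n).
Local Notation var := (@var n k : II -> B).
Local Notation p_ i := (var (lshift n i)).
Local Notation const := (@B_const n k).

Definition mpair (t : mon -> k) (h : S) : k := \sum_(m <- msupp h) h@_m * t m.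

Lemma mpair_widen t h s : uniq s -> {subset msupp h <= s} ->
  \sum_(m <- s) h@_m * t m = mpair t h.
Proof.
move=> us hs; apply: (@sum_uniq_widen _ k (msupp h) s) => //.
by move=> m /memN_msupp_eq0 ->; rewrite mul0r.
Qed.

Lemma mpair_linear t c x y : mpair t (c *: x + y) = c * mpair t x + mpair t y.
Proof.
pose s := undup (msupp x ++ msupp y ++ msupp (c *: x + y)).
have us : uniq s := undup_uniq _.
rewrite -!(@mpair_widen t _ s) //; try by move=> m mx; rewrite mem_undup !mem_cat mx ?orbT.
rewrite mulr_sumr -big_split; apply: eq_bigr => m _ /=.
by rewrite mcoeffD mcoeffZ mulrDl mulrA.
Qed.

Lemma mpair_monomial (phi : S -> k) : (forall c x y, phi (c *: x + y) = c * phi x + phi y) ->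
  forall h, mpair (fun m => phi (X_ m)) h = phi h.
Proof.
move=> hphi h; have phi0 : phi 0 = 0.
  by have := hphi 1 0 0; rewrite scale1r add0r mul1r => /(canLR (addKr _)); rewrite addNr.
have phiD x y : phi (x + y) = phi x + phi y by rewrite -[x in LHS]scale1r hphi mul1r.
rewrite [in RHS](mpolyE h) (big_morph phi phiD phi0); apply: eq_bigr => m _.
by rewrite -[_ *: _]addr0 hphi phi0 addr0.
Qed.

Lemma mpairX t m : mpair t (X_ m) = t m.
Proof. by rewrite /mpair msuppX big_seq1 mcoeffX eqxx mul1r. Qed.

Lemma mpair_addl t t' h : mpair (fun m => t m + t' m) h = mpair t h + mpair t' h.
Proof. by rewrite -big_split; apply: eq_bigr => m _; rewrite mulrDr. Qed.

Lemma mpairD t x y : mpair t (x + y) = mpair t x + mpair t y.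
Proof. by rewrite -[x in LHS]scale1r mpair_linear mul1r. Qed.

(** The second component is the dual of S = k[p] as a vector space, an element
    being given by its values on the monomials. The module is an extension of
    S, on which B acts through restriction to the p-axes, by this dual. *)
Definition test_module := (S * (mon -> k))%type.
HB.instance Definition _ := GRing.Zmodule.on test_module.

(** The part of the action of r that maps S to its dual: q_i sends s to the
    functional h |-> coefficient of p_i in s h, and w sends s to h |->
    constant coefficient of s h. In particular w does not annihilate this
    module. *)
Definition test_twist (r : B) (h : S) : k :=
  \sum_i (restr false r)@_U_(i) * h@_U_(i) + wcoef r * h@_0%MM.

Definition test_act (r : B) (x : test_module) : test_module :=
  (restr true r * x.1, fun m => mpair x.2 (restr true r * X_ m) + test_twist r (x.1 * X_ m)).

Lemma test_twist_linear r c x y :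
  test_twist r (c *: x + y) = c * test_twist r x + test_twist r y.
Proof.
rewrite /test_twist mulrDr mulr_sumr addrACA -big_split /=; congr (_ + _).
  by apply: eq_bigr => i _; rewrite mcoeffD mcoeffZ mulrDr mulrCA.
by rewrite mcoeffD mcoeffZ mulrDr mulrCA.
Qed.

Lemma test_twistD r x y : test_twist r (x + y) = test_twist r x + test_twist r y.
Proof. by rewrite -[x in LHS]scale1r test_twist_linear mul1r. Qed.

Lemma test_act_pair r x h :
  mpair (test_act r x).2 h = mpair x.2 (restr true r * h) + test_twist r (x.1 * h).
Proof.
rewrite (@mpair_monomial (fun h => mpair x.2 (restr true r * h) + test_twist r (x.1 * h))) //.
move=> c u v; rewrite !(mulrDr (restr true r)) !(mulrDr x.1) -!scalerAr mpair_linear test_twist_linear.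
ring.
Qed.

(** Both sides are combinations of the coefficients of degree at most 1 of h,
    and they agree by the formula [wcoefM] for the coefficient of w in a
    product. *)
Lemma test_twistM r r' h : test_twist (r * r') h =
  test_twist r (restr true r' * h) + test_twist r' (restr true r * h).
Proof.
rewrite /test_twist wcoefM /aug0.
rewrite (eq_bigr (fun i => (restr true r)@_0%MM * (restr false r')@_U_(i) * h@_U_(i) +
  (restr false r)@_U_(i) * (restr true r')@_0%MM * h@_U_(i))) => [|i _]; last first.
  by rewrite restrM coef1M !restr_coef0 mulrDl.
rewrite [in RHS](eq_bigr (fun i => (restr false r)@_U_(i) * (restr true r')@_0%MM * h@_U_(i) +
   (restr false r)@_U_(i) * (restr true r')@_U_(i) * h@_0%MM)) => [|i _]; last first.
  by rewrite coef1M mulrDr !mulrA.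
rewrite [X in _ = _ + (X + _)](eq_bigr (fun i => (restr true r)@_0%MM * (restr false r')@_U_(i) * h@_U_(i) +
   (restr false r')@_U_(i) * (restr true r)@_U_(i) * h@_0%MM)) => [|i _]; last first.
  by rewrite coef1M mulrDr; ring.
rewrite !big_split /= !mulrDl !mulr_suml.
rewrite !(rmorphM (mcoeff (0%MM : mon))) /=.
rewrite (eq_bigr (fun i => (restr false r')@_U_(i) * (restr true r)@_U_(i) * h@_0%MM) (fun i _ => congr1 (fun u => u * _) (mulrC _ _))).
ring.
Qed.

Lemma test_actA a b x : test_act a (test_act b x) = test_act (a * b) x.
Proof.
congr pair; first by rewrite /= mulrA restrM.
apply: funext => m; rewrite test_act_pair /= test_twistM restrM.
rewrite mulrCA [restr true b * x.1 * _]mulrAC -[restr true b * X_ m * _]mulrAC -!mulrA.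
by rewrite [x.1 * (_ * _)]mulrCA -addrA; congr (_ + _); exact: addrC.
Qed.

Lemma test_act1 : left_id 1 test_act.
Proof.
case=> s t; congr pair; first by rewrite /= restr1 mul1r.
apply: funext => m /=; rewrite restr1 mul1r mpairX /test_twist restr1.
have -> : wcoef (1 : B) = 0 by rewrite -[1](rmorph1 const) wcoef_const.
rewrite mul0r addr0 big1 ?addr0 // => i _.
by rewrite mcoeff1 mnm1_eq0 mul0r.
Qed.

Lemma test_actDr : right_distributive test_act +%R.
Proof.
move=> a x y; congr pair; first by rewrite /= mulrDr.
apply: funext => m; rewrite /= mulrDl test_twistD [mpair _ _](mpair_addl x.2 y.2).
exact: addrACA.
Qed.

Lemma test_actDl x : {morph test_act^~ x : a b / a + b}.
Proof.
move=> a b; congr pair; first by rewrite /= restrD mulrDl.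
apply: funext => m /=; rewrite restrD mulrDl mpairD [RHS]addrACA; congr (_ + _).
rewrite /test_twist restrD wcoefD mulrDl addrACA -big_split; congr (_ + _).
by apply: eq_bigr => i _; rewrite mcoeffD mulrDl.
Qed.

HB.instance Definition _ := GRing.Zmodule_isLmodule.Build B test_module
  test_actA test_act1 test_actDr test_actDl.

Lemma test_scale1 (r : B) (x : test_module) : (r *: x).1 = restr true r * x.1.
Proof. by []. Qed.

Lemma test_scale2_p i (x : test_module) m : (p_ i *: x).2 m = x.2 (U_(i) + m)%MM.
Proof.
rewrite /= restr_var_B restr_varl -mpolyXD mpairX /test_twist restr_var_B restr_varl.
rewrite big1 => [|j _]; last by rewrite mcoeff0 mul0r.
by rewrite (_ : wcoef _ = 0) ?mul0r ?addr0 // -[p_ i]mulr1 wcoef_p restr1 mcoeff1 mnm1_eq0.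
Qed.

End TestModule.

(** * The Koszul complex of the p-variables on the test module *)

Section TestKoszul.
Variables (n : nat) (k : fieldType).
Local Notation S := {mpoly k[n]}.
Local Notation B := (B_ring n k).
Local Notation mon := (multinom n).
Local Notation T := (test_module n k).
Local Notation pv := (fun i : 'I_n => @var n k (lshift n i)).
Local Notation rk := (@nat_of_ord n).
Local Notation Lx := {ffun {set 'I_n} -> T}.
Local Notation kosL := (koszul rk pv : Lx -> Lx).

Definition form_degree (b : nat) (z : Lx) := forall A : {set 'I_n}, #|A| != b -> z A = 0.

Lemma test_sign i A (x : T) : (ext_sign rk B i A *: x).1 = ext_sign rk S i A * x.1.
Proof. by rewrite test_scale1 /ext_sign rmorph_sign. Qed.

Lemma test_fst_sum (J : finType) (P : pred J) (G : J -> T) :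
  (\sum_(j | P j) G j).1 = \sum_(j | P j) (G j).1.
Proof. by apply: (big_morph (fun x : T => x.1)). Qed.

Lemma koszul_fst (z : Lx) :
  ([ffun A : {set 'I_n} => (kosL z A).1] : {ffun {set 'I_n} -> S^o}) =
  koszul rk (fun i => 'X_i : S) ([ffun A => (z A).1] : {ffun {set 'I_n} -> S^o}).
Proof.
apply/ffunP => A; rewrite ffunE koszulE test_fst_sum (@koszulE _ rk S S^o); apply: eq_bigr => i _.
by rewrite test_scale1 test_sign restr_var_B restr_varl ffunE.
Qed.

(** Only the contraction by e_i contributes to the coefficient of the variable
    of index i in the coordinate on A minus i. *)
Lemma koszul_coef1 (z : Lx) (A : {set 'I_n}) i : i \in A ->
  ((kosL z (A :\ i)).1)@_U_(i)%MM = ext_sign rk k i A * ((z A).1)@_0%MM.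
Proof.
move=> iA; have -> : (kosL z (A :\ i)).1 = [ffun A : {set 'I_n} => (kosL z A).1] (A :\ i).
  by rewrite ffunE.
rewrite koszul_fst (@koszulE _ rk S S^o) raddf_sum (bigD1 i) ?setD11 //= big1 => [|j /andP[_ ji]].
  rewrite /GRing.scale /= mcoeff_XMU eqxx addr0 ffunE setD1K // -[X in ext_sign rk k i X](setD1K iA) ext_sign_id.
  have -> : ext_sign rk S i (A :\ i) = mpolyC n (ext_sign rk k i (A :\ i)).
    by rewrite /ext_sign rmorph_sign.
  by rewrite mcoeffCM.
by rewrite /GRing.scale /= mcoeff_XMU (negbTE ji).
Qed.

(** Division by the variables is a left inverse of their action on S. It
    leaves only constants on the empty set, and these are excluded by
    hypothesis. *)
Lemma test_exact_fst b (z : Lx) : form_degree b z -> kosL z = 0 ->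
    (b == 0%N -> ((z set0).1)@_0%MM = 0) ->
  exists y : Lx, [/\ form_degree b.+1 y, forall A, (y A).2 = 0 &
    forall A, (z A).1 = (kosL y A).1].
Proof.
move=> hz z0 zc.
pose z1 : {ffun {set 'I_n} -> S^o} := [ffun A => (z A).1].
have z10 : koszul rk (fun i => 'X_i : S) z1 = 0.
  by rewrite -koszul_fst z0; apply/ffunP => A; rewrite !ffunE.
pose Pz (A : {set 'I_n}) (x : S^o) := #|A| != b -> x = 0.
pose Py (A : {set 'I_n}) (x : S^o) := #|A| != b.+1 -> x = 0.
pose dv (i : 'I_n) : {additive S^o -> S^o} := (@mdiv n k i : {additive S -> S}).
have [|||||||||i j x|||y [hy y1 y2]] :=
  @koszul_exact_inj _ rk (@ord_inj n) S S^o (fun i => 'X_i) dv _ Pz Py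
    _ _ _ _ _ _ (enum 'I_n) z1.
- by move=> i j x ij; exact: mdivX_comm.
- by move=> A x y hx hy /[dup] /hx -> /hy ->; rewrite subr0.
- by [].
- by move=> A x y hx hy /[dup] /hx -> /hy ->; rewrite subr0.
- move=> i A x iA hx hA; rewrite hx ?raddf0 //.
  by move: hA; rewrite (cardsD1 i A) iA add1n eqSS.
- move=> i A x iA hx hA; rewrite hx ?scaler0 //.
  by move: hA; rewrite cardsU1 iA add1n eqSS.
- by [].
- exact: enum_uniq.
- by move=> i _ x; exact: mdivXK.
- exact: mdiv_comm.
- exact: z10.
- by move=> A hA; rewrite ffunE hz.
exists [ffun A => (y A, 0)]; split.
- by move=> A /hy yA; rewrite ffunE yA.
- by move=> A; rewrite ffunE.
move=> A; pose Y : Lx := [ffun A => (y A, 0)].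
have -> : (kosL Y A).1 = [ffun A : {set 'I_n} => (kosL Y A).1] A by rewrite ffunE.
rewrite koszul_fst; have -> : [ffun A => (Y A).1] = y :> {ffun {set 'I_n} -> S^o}.
  by apply/ffunP => A'; rewrite !ffunE.
have z1E : (z A).1 = z1 A by rewrite ffunE.
rewrite z1E; have [i iA|A0] := pickP [in A].
  by apply: (y1 i A); rewrite ?mem_enum.
apply/eqP; rewrite -subr_eq0; apply/eqP.
have -> := mdiv_const (fun j => y2 j A (mem_enum _ j)).
rewrite -z1E; suff -> : ((z A).1 - koszul rk (fun i => 'X_i : S) y A)@_0%MM = 0.
  by rewrite mpolyC0.
have AE : A = set0 by apply/setP => i; rewrite [RHS]inE; exact: A0.
rewrite mcoeffB (@koszulE _ rk S S^o) raddf_sum big1 ?subr0 => [|i _]; last first.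
  by rewrite /GRing.scale /= mcoeff_XM0.
have [b0|b0] := eqVneq b 0%N; first by rewrite AE zc // b0.
by rewrite hz ?mcoeff0 // AE cards0 eq_sym.
Qed.

(** On the dual of S the variables act surjectively, and a right inverse is
    the transpose of division by 'X_i. *)
Definition test_shift (i : 'I_n) (x : T) : T :=
  (0, fun m : mon => if (0 < m i)%N then x.2 (m - U_(i))%MM else 0).

Lemma test_shift_is_zmod_morphism i : zmod_morphism (test_shift i).
Proof.
move=> x y; congr pair; first by rewrite /= subr0.
apply: funext => m; change ((if (0 < m i)%N then (x - y).2 (m - U_(i))%MM else 0) =
  (if (0 < m i)%N then x.2 (m - U_(i))%MM else 0) - (if (0 < m i)%N then y.2 (m - U_(i))%MM else 0)).
by case: ifP => // _; rewrite subr0.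
Qed.
HB.instance Definition _ i :=
  GRing.isZmodMorphism.Build T T (test_shift i) (test_shift_is_zmod_morphism i).

Lemma test_eq (x y : T) : x.1 = y.1 -> (forall m, x.2 m = y.2 m) -> x = y.
Proof. by case: x y => [s t] [s' t'] /= -> h; congr pair; apply: funext. Qed.

Lemma test_shiftK i (x : T) : x.1 = 0 -> pv i *: test_shift i x = x.
Proof.
move=> x0; apply: test_eq => [|m]; first by rewrite test_scale1 mulr0.
rewrite test_scale2_p /= mnmDE mnm1E eqxx add1n /=.
by congr (x.2 _); apply/mnmP => j; rewrite mnmBE mnmDE addKn.
Qed.

Lemma test_shift_comm i j (x : T) : i != j ->
  test_shift i (pv j *: x) = pv j *: test_shift i x.
Proof.
move=> ij; apply: test_eq => [|m]; first by rewrite test_scale1 mulr0.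
rewrite test_scale2_p; change ((if (0 < m i)%N then (pv j *: x).2 (m - U_(i))%MM else 0) =
  (if (0 < (U_(j) + m)%MM i)%N then x.2 (U_(j) + m - U_(i))%MM else 0)).
rewrite mnmDE mnm1E eq_sym (negbTE ij) add0n; case: ifP => // mi.
rewrite test_scale2_p; congr (x.2 _); apply/mnmP => l; rewrite !(mnmDE, mnmBE) !mnm1E.
case: (eqVneq i l) => [<-|_]; last by rewrite !subn0.
by rewrite eq_sym (negbTE ij) !add0n.
Qed.

(** The component in S is first made zero by [test_exact_fst]. The component
    in the dual of S is then corrected by [koszul_exact_surj] on all the sets
    that miss some index, and there is no other set of size b < n. *)
Lemma test_exact b (z : Lx) : (b < n)%N -> form_degree b z -> kosL z = 0 ->
    (b == 0%N -> ((z set0).1)@_0%MM = 0) ->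
  exists y : Lx, form_degree b.+1 y /\ kosL y = z.
Proof.
move=> bn hz z0 zc; have [y [hy _ yE]] := test_exact_fst hz z0 zc.
pose z' := z - kosL y.
have z'0 : kosL z' = 0.
  by rewrite raddfB /= z0 koszul_koszul ?subr0 //; exact: ord_inj.
pose Pz (A : {set 'I_n}) (x : T) := x.1 = 0 /\ (#|A| != b -> x = 0).
pose Py (A : {set 'I_n}) (x : T) := x.1 = 0 /\ (#|A| != b.+1 -> x = 0).
pose dv (i : 'I_n) : {additive T -> T} := test_shift i.
have hz' A : Pz A (z' A).
  rewrite /z' !ffunE; split=> [|hA]; first by rewrite /= yE subrr.
  rewrite hz // koszulE big1 ?subr0 // => i iA.
  by rewrite hy ?scaler0 // cardsU1 iA add1n eqSS.
have [||||||||y' [hy' y'E]] := @koszul_exact_surj _ rk (@ord_inj n) B T pv dv _ Pz Py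
    _ _ _ _ _ _ (enum 'I_n) z' _ z'0 hz'.
- by move=> i j x ij; exact: test_shift_comm.
- move=> A x x' [hx1 hx] [hx'1 hx']; split; first by rewrite /= hx1 hx'1 subr0.
  by move=> /[dup] /hx -> /hx' ->; rewrite subr0.
- by [].
- move=> A x x' [hx1 hx] [hx'1 hx']; split; first by rewrite /= hx1 hx'1 subr0.
  by move=> /[dup] /hx -> /hx' ->; rewrite subr0.
- move=> i A x iA [hx1 hx]; split=> // hA; rewrite hx ?raddf0 //.
  by move: hA; rewrite (cardsD1 i A) iA add1n eqSS.
- move=> i A x iA [hx1 hx]; split=> [|hA]; first by rewrite test_scale1 hx1 mulr0.
  by rewrite hx ?scaler0 //; move: hA; rewrite cardsU1 iA add1n eqSS.
- by [].
- by move=> i _ A x [x1 _]; exact: test_shiftK.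
exists (y + y'); split.
  by move=> A hA; rewrite ffunE hy // (proj2 (hy' A)) ?addr0.
apply/ffunP => A; rewrite raddfD /=; have [i iA|iA] := pickP [in ~: A].
  have := y'E i A; rewrite mem_enum -in_setC => /(_ isT iA).
  by rewrite !ffunE => <-; rewrite addrC subrK.
have AT : A = setT by apply/setP => i; have := iA i; rewrite /= !inE => /negbFE.
have Az : #|A| != b by rewrite AT cardsT card_ord; case: ltngtP bn.
have := proj2 (hz' A) Az; rewrite !ffunE hz // => /eqP.
rewrite sub0r oppr_eq0 => /eqP ->; rewrite add0r koszulE big1 // => i.
by rewrite AT inE.
Qed.

End TestKoszul.

(** * Koszul dual cycles and maps to the test module *)

Lemma dependent_choice (T : nat -> Type) (P : forall a, T a -> Prop)
    (Q : forall a, T a -> T a.+1 -> Prop) :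
  (exists x, P 0%N x) -> (forall a x, P a x -> exists y, P a.+1 y /\ Q a x y) ->
  exists u : forall a, T a, forall a, P a (u a) /\ Q a (u a) (u a.+1).
Proof.
move=> /boolp.cid[x0 Px0] h.
pose step a (x : {x : T a | P a x}) : {y : T a.+1 | P a.+1 y} :=
  let: exist y hy := boolp.cid (h a (sval x) (svalP x)) in exist _ y (proj1 hy).
pose u := nat_rect (fun a => {x : T a | P a x}) (exist _ x0 Px0) step.
exists (fun a => sval (u a)) => a; split; first exact: svalP.
by rewrite /= /step; case: boolp.cid => y [].
Qed.

(** Linear and semilinear identities can be checked on a basis by this
    principle. *)
Lemma gb_ind (k : fieldType) (R : stdGradedAlg k) (M : gmodule R) (b : gbasis M) (P : M -> Prop) :
  P 0 -> (forall (r : R) x y, P x -> P y -> P (r *: x + y)) ->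
  (forall x : gb_index b, P (gb_elt x)) -> forall m, P m.
Proof.
move=> P0 PD Pe m; rewrite (gb_expand b m); elim: (gb_supp b m) => [|x s IH].
  by rewrite big_nil.
by rewrite big_cons; apply: PD.
Qed.

Section LowerBound.
Variables (n : nat) (k : fieldType).
Hypothesis n_gt1 : (1 < n)%N.
Local Notation B := (B_ring n k).
Local Notation R := (algB n k).
Local Notation T := (test_module n k).
Local Notation pv := (fun i : 'I_n => @var n k (lshift n i) : B).
Local Notation rk := (@nat_of_ord n).
Local Notation Lx := {ffun {set 'I_n} -> T}.
Local Notation kosL := (koszul rk pv : Lx -> Lx).

Definition residue_aug (x : residue R) : k := aug0 (repr (x : {ideal_quot @hmax k R}) : B).

Lemma residue_aug_rone (r : R) : residue_aug (r *: (rone R : residue R)) = aug0 r.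
Proof.
set x := r *: _; have : (repr (x : {ideal_quot @hmax k R}) : R) *: rone R = x.
  by rewrite scale_rone reprK.
move=> /eqP; rewrite -subr_eq0 -scalerBl => /eqP/scale_rone_eq0/hmax_aug0.
by rewrite /aug0 restrB mcoeffB => /eqP; rewrite subr_eq0 => /eqP.
Qed.

Lemma residue_aug_linear (r : R) (x y : residue R) :
  residue_aug (r *: x + y) = aug0 r * residue_aug x + residue_aug y.
Proof.
have [s ->] := residue_gen x; have [t ->] := residue_gen y.
by rewrite scalerA -scalerDl !residue_aug_rone aug0D aug0M.
Qed.

Variable F : graded_free_resolution (residue_gmodule R).
Local Notation X a := {ffun {set 'I_n} -> F a}.
Local Notation D a := (ext_map (res_d F a)).
Local Notation cok := (cokoszul rk pv).

(** The element U_0 lifts 1. As multiplication by sum_i p_i e_i squares to 0,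
    the product of U_a with it is closed, so it lifts to U_(a+1). These are
    the cycles that pair with the products of the dual variables in the Yoneda
    algebra. *)
Lemma koszul_dual_cycles : exists U : forall a, X a,
  [/\ forall a, bihom (gm_piece (F a)) a a (U a),
      forall a, D a (U a.+1) = cok (U a) & res_aug F (U 0%N set0) = rone R].
Proof.
have [u0 au0] := res_aug_surj F (rone R).
have [u [hu au]] := hom_preimage (@res_aug_deg _ _ _ F) (I : gm_piece (residue_gmodule R) 0%N (rone R)) au0.
have cok_bihom a (z : X a) : bihom (gm_piece (F a)) a a z ->
    bihom (gm_piece (F a)) a.+1 a.+1 (cok z).
  apply: cokoszul_bihom; [exact: gm_piece0|exact: gm_pieceB|].
  by move=> i d x; exact: (@gm_piece_v k R _ pv (fun j => @B_piece_var n k _) (F a) i d x).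
pose P a (z : X a) := [/\ bihom (gm_piece (F a)) a a z, dclosed (cok z) &
  match a return X a -> Prop with 0 => fun z => res_aug F (z set0) = rone R | _ => fun=> True end z].
pose Q a (z : X a) (z' : X a.+1) := D a z' = cok z.
have P0 : exists z, P 0%N z.
  exists (base 'I_n u); have hb : bihom (gm_piece (F 0%N)) 0 0 (base 'I_n u) := base_bihom hu.
  split=> //.
    exact: dclosed_pos (cok_bihom _ _ hb).
  by rewrite ffunE eqxx.
have PS a z : P a z -> exists z', P a.+1 z' /\ Q a z z'.
  move=> [hz dz _]; have [z' [hz' dz']] := dclosed_lift dz (cok_bihom _ _ hz).
  exists z'; split=> //; split=> //=.
  by rewrite ext_map_cokoszul dz' cokoszul_cokoszul //; exact: ord_inj.
have [U UP] := dependent_choice P0 PS.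
exists U; split=> [a|a|]; first by case: (UP a) => -[].
  by case: (UP a) => _.
by case: (UP 0%N) => -[].
Qed.

Definition test_forms : lmodType R := (Lx : lmodType B).

Definition test_base (a : nat) : {linear F a -> test_forms} -> Prop :=
  match a with
  | 0 => fun f => forall x : F 0%N, (((f x : Lx) set0).1)@_0%MM = residue_aug (res_aug F x)
  | _ => fun=> True
  end.

(** A comparison map from the resolution to the Koszul complex of the
    p-variables on the test module. In degree 0 the constant coefficient of
    its component in S is the augmentation, and it extends through exterior
    degree n, because the target is exact there by [test_exact]. *)
Lemma test_lift : exists f : forall a, {linear F a -> test_forms},
  [/\ forall a x, form_degree a (f a x),
      forall a x, kosL (f a (res_d F a x)) = 0,
      test_base (f 0%N) &
      forall a x, (a < n)%N -> kosL (f a.+1 x) = f a (res_d F a x)].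
Proof.
pose P a (f : {linear F a -> test_forms}) := [/\ forall x, form_degree a (f x),
  forall x, kosL (f (res_d F a x)) = 0 & test_base f].
pose Q a (f : {linear F a -> test_forms}) (g : {linear F a.+1 -> test_forms}) :=
  (a < n)%N -> forall x, kosL (g x) = f (res_d F a x).
have degD a (c : B) (x y : Lx) : form_degree a x -> form_degree a y -> form_degree a (c *: x + y).
  by move=> hx hy A hA; rewrite !ffunE hx // hy // scaler0 addr0.
have deg0 a : form_degree a (0 : Lx) by move=> A _; rewrite ffunE.
have kos_deg0 (z : Lx) : form_degree 0 z -> kosL z = 0.
  move=> hz; apply/ffunP => A; rewrite koszulE [RHS]ffunE big1 // => i iA.
  by rewrite hz ?scaler0 // cardsU1 iA.
have P0 : exists f, P 0%N f.
  have [b] := graded_freeP (res_free F 0).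
  pose v (x : gb_index b) : Lx := [ffun A : {set 'I_n} => if A == set0
    then (mpolyC n (residue_aug (res_aug F (gb_elt x))), fun=> 0) : T else 0].
  exists (gb_extend (L := test_forms) v : {linear F 0%N -> test_forms}).
  have hdeg x : form_degree 0 (gb_extend (L := test_forms) v x).
    elim/(gb_ind (b := b)): x => [|r x y hx hy|x].
    - by rewrite raddf0; exact: deg0.
    - by rewrite linearP; exact: degD.
    - by rewrite gb_extend_elt => A; rewrite cards_eq0 ffunE => /negbTE ->.
  split; [exact: hdeg | by move=> x; exact: kos_deg0 (hdeg _) | move=> x].
  elim/(gb_ind (b := b)): x => [|r x y hx hy|x] /=.
  - rewrite !raddf0 ffunE mcoeff0.
    by have := residue_aug_rone 0; rewrite scale0r => ->; rewrite aug0_0.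
  - rewrite !linearP residue_aug_linear -hx -hy !ffunE.
    by rewrite mcoeffD test_scale1 rmorphM.
  - by rewrite gb_extend_elt ffunE eqxx /= mcoeffC eqxx mulr1.
have PS a f : P a f -> exists g, P a.+1 g /\ Q a f g.
  move=> [hf kf fb].
  have [b] := graded_freeP (res_free F a.+1).
  have /boolp.choice[v vP] (x : gb_index b) : exists y : Lx, form_degree a.+1 y /\
      ((a < n)%N -> kosL y = f (res_d F a (gb_elt x))).
    have [an|na] := ltnP a n; last by exists 0.
    have [|y [hy yE]] := test_exact an (hf (res_d F a (gb_elt x))) (kf _).
      case: a f hf kf fb b x an => [|a] f hf kf fb b x an // _.
      rewrite fb res_augd; have := residue_aug_rone 0; rewrite scale0r => ->.
      exact: aug0_0.
    by exists y.
  exists (gb_extend (L := test_forms) v : {linear F a.+1 -> test_forms}).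
  have hdeg x : form_degree a.+1 (gb_extend (L := test_forms) v x).
    elim/(gb_ind (b := b)): x => [|r x y hx hy|x].
    - by rewrite raddf0; exact: deg0.
    - by rewrite linearP; exact: degD.
    - by rewrite gb_extend_elt; case: (vP x).
  have hQ : Q a f (gb_extend (L := test_forms) v : {linear F a.+1 -> test_forms}).
    move=> an x; elim/(gb_ind (b := b)): x => [|r x y hx hy|x].
    - by rewrite !raddf0.
    - have E : kosL (gb_extend (L := test_forms) v (r *: x + y)) = (r : B) *:
          kosL (gb_extend (L := test_forms) v x) + kosL (gb_extend (L := test_forms) v y).
        rewrite -(koszul_linear rk pv).
        exact: (congr1 (koszul rk pv : Lx -> Lx) (@gb_extend_linear k R _ b test_forms v r x y)).
      apply: (etrans E); rewrite (_ : kosL _ = f (res_d F a x)); last exact: hx.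
      rewrite (_ : kosL _ = f (res_d F a y)); last exact: hy.
      by rewrite !linearP.
    - have [_ vQ] := vP x; rewrite -(vQ an).
      exact: (congr1 (koszul rk pv : Lx -> Lx) (@gb_extend_elt k R _ b test_forms v x)).
  split=> //; split=> // x; have [an|na] := ltnP a n; first by rewrite hQ // res_dd raddf0.
  have g0 : gb_extend (L := test_forms) v (res_d F a.+1 x) = 0 :> Lx; last first.
    exact: (etrans (congr1 (koszul rk pv : Lx -> Lx) g0) (raddf0 _)).
  apply/ffunP => A; rewrite [RHS]ffunE; apply: hdeg; apply/eqP => Aa.
  by have := max_card (mem A); rewrite card_ord Aa ltnNge na.
have [f fP] := dependent_choice P0 PS.
exists f; split=> [a x|a x||a x].
- by case: (fP a) => -[].
- by case: (fP a) => -[].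
- by case: (fP 0%N) => -[].
- by case: (fP a) => _ /(_ _ x); exact.
Qed.

End LowerBound.

(** * Nonvanishing classes in Tor *)

Section Nonvanishing.
Variables (n : nat) (k : fieldType).
Hypothesis n_gt1 : (1 < n)%N.
Local Notation B := (B_ring n k).
Local Notation R := (algB n k).
Local Notation T := (test_module n k).
Local Notation pv := (fun i : 'I_n => @var n k (lshift n i) : B).
Local Notation rk := (@nat_of_ord n).
Local Notation Lx := {ffun {set 'I_n} -> T}.
Local Notation kosL := (koszul rk pv : Lx -> Lx).
Local Notation cok := (cokoszul rk pv).
Variable F : graded_free_resolution (residue_gmodule R).
Local Notation X a := {ffun {set 'I_n} -> F a}.
Local Notation D a := (ext_map (res_d F a)).

Variable U : forall a, X a.
Hypothesis U_bihom : forall a, bihom (gm_piece (F a)) a a (U a).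
Hypothesis U_d : forall a, D a (U a.+1) = cok (U a).
Hypothesis U_0 : res_aug F (U 0%N set0) = rone R.
Variable f : forall a, {linear F a -> test_forms n k}.
Hypothesis f_degree : forall a x, form_degree a (f a x : Lx).
Hypothesis f_cycle : forall a x, kosL (f a (res_d F a x)) = 0.
Hypothesis f_base : test_base (f 0%N).
Hypothesis f_d : forall a x, (a < n)%N -> kosL (f a.+1 x) = f a (res_d F a x).

Definition const_coef (y : Lx) (A : {set 'I_n}) : k := ((y A).1)@_0%MM.

Lemma f_cok a (A C : {set 'I_n}) i : i \in C ->
  (((f a (cok (U a) A) : Lx) (C :\ i)).1)@_U_(i)%MM =
  if i \in A then ext_sign rk k i A * const_coef (f a (U a (A :\ i))) (C :\ i) else 0.
Proof.
move=> iC.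
pose g (x : F a) : k := (((f a x : Lx) (C :\ i)).1)@_U_(i)%MM.
have gD x y : g (x + y) = g x + g y.
  have E : (f a (x + y) : Lx) = f a x + f a y by exact: raddfD.
  by rewrite /g E ffunE /= mcoeffD.
have g0 : g 0 = 0.
  have E : (f a 0 : Lx) = 0 by exact: raddf0.
  by rewrite /g E ffunE /= mcoeff0.
have gp j (x : F a) (e : B) (c : k) : restr true e = mpolyC n c ->
    g ((pv j : R) *: ((e : R) *: x)) = if j == i then c * const_coef (f a x) (C :\ i) else 0.
  move=> eE; have E : (f a ((pv j : R) *: ((e : R) *: x)) : Lx) = pv j *: (e *: (f a x : Lx)).
    have E1 : f a ((pv j : R) *: ((e : R) *: x)) = (pv j : R) *: ((e : R) *: f a x).
      by rewrite linearZ linearZ.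
    exact: E1.
  rewrite /g E !ffunE !test_scale1 eE restr_var_B restr_varl mcoeff_XMU.
  by case: eqP => // _; rewrite mcoeffCM.
have -> : (((f a (cok (U a) A) : Lx) (C :\ i)).1)@_U_(i)%MM = g (cok (U a) A) by [].
rewrite cokoszulE (big_morph g gD g0).
have sE j : restr true (ext_sign rk B j A) = mpolyC n (ext_sign rk k j A).
  by rewrite /ext_sign !rmorph_sign.
rewrite (eq_bigr (fun j => if j == i then ext_sign rk k j A * const_coef (f a (U a (A :\ j))) (C :\ i) else 0)).
  rewrite -big_mkcondr /=; case: ifP => iA; last first.
    by rewrite big_pred0 // => j; apply/negP => /andP[jA /eqP ji]; rewrite -ji jA in iA.
  by rewrite (big_pred1 i) // => j /=; case: eqP => [->|_]; rewrite ?iA ?andbF.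
by move=> j jA; exact: gp (sE j).
Qed.

(** By [koszul_coef1], a constant coefficient of f_(a+1) U_(a+1) is a linear
    coefficient of its boundary, and this boundary is the image by f_a of
    sum_i p_i e_i times U_a. So it equals a constant coefficient of f_a U_a
    with one index less. *)
Lemma const_coef_U a (A C : {set 'I_n}) : (a <= n)%N -> #|A| = a -> #|C| = a ->
  const_coef (f a (U a A)) C = (A == C)%:R.
Proof.
elim: a A C => [|a IH] A C an Aa Ca.
  have -> : A = set0 by apply: cards0_eq.
  have -> : C = set0 by apply: cards0_eq.
  rewrite eqxx /const_coef f_base U_0 -[rone R]scale1r residue_aug_rone.
  by rewrite /aug0 restr1 mcoeff1 eqxx.
have [i iC] : exists i, i \in C by apply/set0Pn; rewrite -card_gt0 Ca.
have := koszul_coef1 (f a.+1 (U a.+1 A)) iC.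
rewrite f_d // -/(const_coef _ _).
have -> : res_d F a (U a.+1 A) = cok (U a) A.
  by have := congr1 (fun u : {ffun {set _} -> F a} => u A) (U_d a); rewrite ffunE.
rewrite f_cok // => E; have cC : #|C :\ i| = a.
  by have := cardsD1 i C; rewrite iC Ca add1n => -[].
apply: (can_inj (mulKr (_ : ext_sign rk k i C \is a GRing.unit))).
  by rewrite /ext_sign unitrX // unitrN unitr1.
rewrite -E; case: ifP => iA; last first.
  by case: eqP => [AeqC|_]; [rewrite AeqC iC in iA | rewrite mulr0].
have cA : #|A :\ i| = a by have := cardsD1 i A; rewrite iA Aa add1n => -[].
rewrite IH ?(ltnW an) //; have [->|AeqC] := eqVneq A C; first by rewrite eqxx.
case: eqP => [AiCi|_]; last by rewrite !mulr0.
by case/eqP: AeqC; rewrite -(setD1K iA) AiCi setD1K.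
Qed.

Lemma in_max_cok a (A : {set 'I_n}) : in_max (cok (U a) A).
Proof.
exists [seq (pv i : R, ext_sign rk R i A *: U a (A :\ i)) | i <- enum A]; split.
  by move=> z /mapP[i _ ->] /=; exact: var_hmax.
by rewrite cokoszulE big_map big_enum.
Qed.

Lemma const_coef_cycle a (z : Lx) (A : {set 'I_n}) : #|A| = a.+1 -> kosL z = 0 ->
  const_coef z A = 0.
Proof.
move=> Aa z0; have [i iA] : exists i, i \in A by apply/set0Pn; rewrite -card_gt0 Aa.
have := koszul_coef1 z iA; rewrite z0 ffunE mcoeff0 => /esym/eqP.
rewrite mulf_eq0 => /orP[|/eqP //]; rewrite /ext_sign => /eqP h.
by have := oner_neq0 k; rewrite -(ext_signK rk k i A) /ext_sign h mul0r eqxx.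
Qed.

(** The constant coefficient on A of f_i detects the cycle U_i(A), of degree
    i, by [const_coef_U]. It vanishes on differentials because f_i maps them
    to Koszul cycles, and f_0 to elements whose constant coefficient is their
    augmentation. *)
Lemma Tor_diagonal i : (i <= n)%N -> Tor_residue_neq0 R i i.
Proof.
move=> le_in.
have [A Ai] : exists A : {set 'I_n}, #|A| = i.
  exists [set widen_ord le_in j | j in 'I_i]; rewrite card_imset ?card_ord //.
  by move=> x y /(congr1 val) /= xy; exact: val_inj.
apply: (@Tor_detect k R F i i (U i A) (@aug0 n k) (fun x => const_coef (f i x) A)).
- exact: aug0_hmax.
- move=> r x y; have E : (f i (r *: x + y) : Lx) = (r : B) *: (f i x : Lx) + f i y.
    by exact: linearP.
  by rewrite /const_coef E !ffunE /= mcoeffD rmorphM.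
- move=> y; case: i le_in A Ai y => [|i] le_in A Ai y; last first.
    exact: const_coef_cycle Ai (f_cycle y).
  have -> : A = set0 by apply: cards0_eq.
  rewrite /const_coef f_base res_augd; have := residue_aug_rone (k := k) (n := n) 0.
  by rewrite scale0r => ->; rewrite /aug0 restr0 mcoeff0.
- by have := U_bihom i A; rewrite Ai eqxx.
- case: i le_in A Ai => [//|i] le_in A Ai /=.
  have -> : res_d F i (U i.+1 A) = cok (U i) A.
    by have := congr1 (fun u : {ffun {set _} -> F i} => u A) (U_d i); rewrite ffunE.
  exact: in_max_cok.
- by rewrite const_coef_U // eqxx oner_eq0.
Qed.

Definition top_value (y : Lx) : k := (y setT).2 0%MM.

(** A Koszul cycle of top degree is annihilated by every p_i, which leaves
    only the multiples of the functional of the constant coefficient. *)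
Lemma top_cycle (z : Lx) : kosL z = 0 ->
  (z setT).1 = 0 /\ forall m, m != 0%MM -> (z setT).2 m = 0.
Proof.
move=> z0; have pz i : pv i *: z setT = 0.
  have := congr1 (fun y : Lx => y (setT :\ i)) z0; rewrite koszulE ffunE.
  rewrite (bigD1 i) ?setD11 //= big1 => [|j /andP[]]; last first.
    by rewrite !inE andbT negbK => ->.
  rewrite addr0 setD1K ?inE // scalerA mulrC -scalerA.
  case: (ext_sign_or rk B i (setT :\ i)) => ->; first by rewrite scale1r.
  by rewrite scaleN1r => /eqP; rewrite oppr_eq0 => /eqP.
have i1 : 'I_n := Ordinal n_gt1; split.
  have := congr1 fst (pz i1); rewrite test_scale1 restr_var_B restr_varl => h.
  by rewrite -(mdivXK i1 (z setT).1) h raddf0.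
move=> m m0; have [i mi] : exists i, (0 < m i)%N.
  apply/existsP; apply: contraNT m0 => /existsPn h; apply/eqP/mnmP => i.
  by rewrite mnm0E; apply/eqP; rewrite -leqn0 leqNgt; exact: h.
have := congr1 (fun x : T => x.2 (m - U_(i))%MM) (pz i); rewrite test_scale2_p.
rewrite (_ : (U_(i) + (m - U_(i)))%MM = m) => [->//|].
apply/mnmP => j; rewrite mnmDE mnmBE mnm1E.
by case: eqP mi => [<-|_] mi; rewrite ?add0n ?subn0 // subnKC.
Qed.

Lemma top_value_scale (r : B) (z : Lx) : kosL z = 0 -> top_value (r *: z) = aug0 r * top_value z.
Proof.
move=> z0; have [z1 z2] := top_cycle z0.
rewrite /top_value ffunE /= z1 mul0r /test_twist big1 => [|i _]; last by rewrite mcoeff0 mulr0.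
rewrite mcoeff0 mulr0 !addr0 mpolyX0 mulr1 /mpair /aug0.
rewrite (eq_bigr (fun m => if m == 0%MM then (restr true r)@_0%MM * (z setT).2 0%MM else 0)).
  have [h|h] := boolP ((0%MM : multinom n) \in msupp (restr true r)).
    by rewrite (bigD1_seq 0%MM) //= eqxx big1 ?addr0 // => m /negbTE ->.
  rewrite (memN_msupp_eq0 h) mul0r big1 // => m _; by case: ifP.
by move=> m _; case: eqP => [->//|/eqP m0]; rewrite z2 ?mulr0.
Qed.

(** The variables annihilate w, so w kills the differential of U_a. *)
Lemma w_cycle_lift a (A : {set 'I_n}) : (0 < a)%N ->
  exists y, res_d F a y = (wB k n_gt1 : R) *: U a A.
Proof.
case: a => // a _; have [h _] := res_exactS ((wB k n_gt1 : R) *: U a.+1 A); apply: h.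
rewrite linearZ /=.
have -> : res_d F a (U a.+1 A) = cok (U a) A.
  by have := congr1 (fun u : {ffun {set _} -> F a} => u A) (U_d a); rewrite ffunE.
rewrite cokoszulE scaler_sumr big1 // => i _.
have wp : (wB k n_gt1 : R) * (pv i : R) = 0 := etrans (mulrC _ _) (var_w k n_gt1 (lshift n i)).
exact: (etrans (scalerA (wB k n_gt1 : R) (pv i : R) _)
  (etrans (congr1 (fun r : R => r *: _) wp) (scale0r _))).
Qed.

(** Let d m = w U_n on the top form. The functional x |-> [top_value (f_n (d
    x))] is linear over the augmentation by [top_cycle]. On m it is the value
    of w on an element of S with constant coefficient 1, which is 1. *)
Lemma Tor_off_diagonal : Tor_residue_neq0 R n.+1 n.+2.
Proof.
pose w : R := wB k n_gt1; pose u : F n := U n setT.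
have pu : gm_piece (F n) n u by have := U_bihom n setT; rewrite cardsT card_ord eqxx.
have wu : gm_piece (F n) n.+2 (w *: u).
  by rewrite -add2n; apply: gm_pieceZ pu; exact: B_piece_w.
have [m [hm dm]] : exists m, gm_piece (F n.+1) n.+2 m /\ res_d F n m = w *: u.
  have [y dy] := w_cycle_lift setT (ltnW n_gt1).
  exact: hom_preimage (@res_d_deg _ _ _ F n) wu dy.
apply: (@Tor_detect k R F n.+1 n.+2 m (@aug0 n k) (fun x => top_value (f n (res_d F n x)))).
- exact: aug0_hmax.
- move=> r x y.
  have E : (f n (res_d F n (r *: x + y)) : Lx) = (r : B) *: (f n (res_d F n x) : Lx) + f n (res_d F n y).
    by rewrite !linearP.
  rewrite -(top_value_scale r (f_cycle x)) E /top_value !ffunE //.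
- by move=> y; rewrite res_dd; have E : (f n 0 : Lx) = 0 by [exact: raddf0]; rewrite /top_value E ffunE.
- exact: hm.
- exists [:: (w, u)]; split; last by rewrite big_seq1.
  move=> z; rewrite inE => /eqP -> /=.
  by rewrite -[w]mul1r; apply: mem_ideal_gen; exists 2%N => //; exact: B_piece_w.
rewrite dm; have E : (f n (w *: u) : Lx) = (w : B) *: (f n u : Lx) by rewrite linearZ.
rewrite /top_value E ffunE /= restr_w mul0r /test_twist big1 => [|i _]; last first.
  by rewrite restr_w mcoeff0 mul0r.
rewrite wcoef_w mul1r add0r mpolyX0 mulr1.
have cT : #|[set: 'I_n]| = n by rewrite cardsT card_ord.
have := const_coef_U (leqnn n) cT cT; rewrite eqxx /const_coef => ->.
by rewrite /mpair msupp0 big_nil add0r oner_eq0.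
Qed.

End Nonvanishing.

(** * The invariants of B *)

Section Conclusion.
Variables (n : nat) (k : fieldType).
Hypothesis n_gt1 : (1 < n)%N.
Local Notation R := (algB n k).

Lemma Tor_B_neq0 : (forall i, (i <= n)%N -> Tor_residue_neq0 R i i) /\ Tor_residue_neq0 R n.+1 n.+2.
Proof.
have F := resolution_exists (residue_gmodule R).
have [U [Ub Ud U0]] := koszul_dual_cycles F.
have [f [fdeg fcyc fb fd]] := test_lift F.
split=> [i|]; first exact: (@Tor_diagonal n k F U Ub Ud U0 f fcyc fb fd i).
exact: (@Tor_off_diagonal n k n_gt1 F U Ub Ud U0 f fcyc fb fd).
Qed.

End Conclusion.

(** A prime p with n + 1 < 2 p divides no r with 0 < 2 r <= n + 1. *)
Lemma small_unit_char (n : nat) (k : fieldType) :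
  [pchar k] =i pred0 \/ (exists2 p, p \in [pchar k] & (n + 1 < 2 * p)%N) ->
  forall r, (0 < r)%N -> (r.*2 <= n.+1)%N -> r%:R != 0 :> k.
Proof.
case=> [/pcharf0P ch0|[p chp pn]] r r0 rn; first by rewrite ch0 -lt0n.
rewrite -(dvdn_pcharf chp); apply/negP => /(dvdn_leq r0); lia.
Qed.

Lemma t_residue_max (k : fieldType) (R : stdGradedAlg k) i j :
  Tor_residue_neq0 R i j -> (forall j', (j < j')%N -> ~ Tor_residue_neq0 R i j') ->
  t_residue R i = (j%:Z)%:E.
Proof.
move=> hj hmax; rewrite /t_residue; set A := (X in supremum _ X).
have Aj : A (j%:Z)%:E by exists j.
have supA : supremums A (j%:Z)%:E.
  split=> [_ [j' /= hj' <-]|y]; last exact.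
  by rewrite lee_fin lez_nat leqNgt; apply/negP => /hmax.
rewrite /supremum; case: ifPn => [/eqP A0|_]; first by rewrite A0 in Aj.
by case: xgetP => [y _ yA|/(_ _ supA)//]; exact: is_subset1_supremums yA supA.
Qed.

Theorem proposition5p2 (n : nat) (k : fieldType) (hn : (2 <= n)%N)
    (hk : [pchar k] =i pred0 \/
          exists2 p, p \in [pchar k] & (n + 1 < 2 * p)%N) :
  [/\ forall i, (i <= n)%N -> t_residue (algB n k) i = (i%:Z)%:E,
      t_residue (algB n k) n.+1 = (n.+2%:Z)%:E
    & ~ Koszul (algB n k)].
Proof.
have small := small_unit_char hk; have [Tdiag Toff] := Tor_B_neq0 k hn.
split=> [i le_in||koszulB].
- apply: t_residue_max (Tdiag i le_in) _ => j ij.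
  by apply: (Tor_B_high hn small); rewrite le_in ij.
- apply: t_residue_max Toff _ => j nj.
  by apply: (Tor_B_high hn small); rewrite eqxx nj orbT.
- by apply: (koszulB n.+1 n.+2) Toff; rewrite eqn_leq ltnn.
Qed.
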